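(* Let $K$ be a field of characteristic zero. Any $9$-nodal cubic threefold $X$ over $K$ is $K$-isomorphic to a hyperplane section of some Perazzo cubic fourfold over $K$.
   Context: A $9$-nodal cubic threefold over $K$ is a cubic hypersurface $X\subset\mathbb P^4_K$ such that the singular locus of $X\otimes\overline K$ consists of exactly nine points, each an ordinary node. Let $P\subset\mathbb P^5$ be the cubic fourfold $x_1x_2x_3=y_1y_2y_3$. A Perazzo cubic fourfold over $K$ is a cubic fourfold $Y\subset\mathbb P^5_K$ that is a $\operatorname{Gal}_K$-twist of $P$, i.e. $Y_{\overline K}$ is isomorphic (projectively equivalent) to $P_{\overline K}$. *)

(* Defs.v *)
From HB Require Import structures.
From mathcomp Require Import all_boot all_order all_algebra.
From mathcomp Require Import mpoly.

Set Implicit Arguments.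
Unset Strict Implicit.
Unset Printing Implicit Defensive.

Import GRing.Theory.
Local Open Scope ring_scope.

(* An n-dimensional projective space has homogeneous coordinates indexed by
   'I_n.+1.  A point of it is given by a nonzero row vector, up to scaling; the
   hypersurface V(f) by a nonzero form f, up to scaling. *)

Definition same_point (F : fieldType) (n : nat) (u v : 'rV[F]_n) : Prop :=
  exists2 c : F, c != 0 & u = c *: v.

Definition evalv (F : fieldType) (n : nat) (f : {mpoly F[n]}) (v : 'rV[F]_n) :
  F := f.@[fun j => v 0 j].

Definition cubic_form (F : fieldType) (n : nat) (f : {mpoly F[n]}) : Prop :=
  f != 0 /\ f \is 3.-homog.

(* (lin_subst A f)(x) = f(x *m A), for a row vector x of length m. *)
Definition lin_subst (F : fieldType) (m n : nat) (A : 'M[F]_(m, n))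
    (f : {mpoly F[n]}) : {mpoly F[m]} :=
  f \mPo [tuple \sum_(i < m) A i j *: 'X_i | j < n].

(* The linear automorphism x |-> x *m A of projective space maps V(f) onto
   V(g). *)
Definition proj_equiv (F : fieldType) (n : nat) (f g : {mpoly F[n]}) : Prop :=
  exists2 A : 'M[F]_n, A \in unitmx &
    exists2 c : F, c != 0 & lin_subst A g = c *: f.

Definition singular_point (F : fieldType) (n : nat) (f : {mpoly F[n]})
    (p : 'rV[F]_n) : Prop :=
  [/\ p != 0, evalv f p = 0 & forall j : 'I_n, evalv f^`M(j) p = 0].

(* Equation of V(f) in the affine chart x_i = 1, the origin being translated to
   the point p (for which p_i != 0): x_i is replaced by 1 and every other x_j
   by p_j / p_i + t_j, with n affine coordinates t. *)
Definition local_equation (F : fieldType) (n : nat) (f : {mpoly F[n.+1]})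
    (p : 'rV[F]_n.+1) (i : 'I_n.+1) : {mpoly F[n]} :=
  f \mPo [tuple (p 0 j / p 0 i)%:MP + oapp (fun k : 'I_n => 'X_k) 0 (unlift i j)
         | j < n.+1].

Definition hessian (F : fieldType) (n : nat) (q : {mpoly F[n]}) (v : 'rV[F]_n) :
  'M[F]_n := \matrix_(j, k) evalv q^`M(j)^`M(k) v.

(* A double point whose projectivized tangent cone is a smooth quadric.  In
   characteristic different from 2, the quadratic part of the local equation
   is nondegenerate exactly when its Hessian matrix is invertible. *)
Definition ordinary_node (F : fieldType) (n : nat) (f : {mpoly F[n.+1]})
    (p : 'rV[F]_n.+1) : Prop :=
  exists2 i : 'I_n.+1, p 0 i != 0 &
    let q := local_equation f p i in
    [/\ evalv q 0 = 0,
        forall k : 'I_n, evalv q^`M(k) 0 = 0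
      & hessian q 0 \in unitmx].

Definition algebraic_closure_of (K : fieldType) (Kbar : closedFieldType)
    (iota : {rmorphism K -> Kbar}) : Prop :=
  forall x : Kbar, algebraicOver iota x.

Definition nine_nodal_cubic_threefold (K : fieldType) (Kbar : closedFieldType)
    (iota : {rmorphism K -> Kbar}) (f : {mpoly K[5]}) : Prop :=
  cubic_form f /\
  exists s : 'I_9 -> 'rV[Kbar]_5,
    [/\ forall a b : 'I_9, same_point (s a) (s b) -> a = b,
        forall p : 'rV[Kbar]_5,
          singular_point (map_mpoly iota f) p <->
          exists a : 'I_9, same_point p (s a)
      & forall a : 'I_9, ordinary_node (map_mpoly iota f) (s a)].

(* x_1 x_2 x_3 - y_1 y_2 y_3, with x = (X_0, X_1, X_2), y = (X_3, X_4, X_5). *)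
Definition perazzo_form (F : fieldType) : {mpoly F[6]} :=
  \prod_(i < 3) 'X_(lshift 3 i) - \prod_(i < 3) 'X_(rshift 3 i).

Definition perazzo_cubic_fourfold (K : fieldType) (Kbar : closedFieldType)
    (iota : {rmorphism K -> Kbar}) (g : {mpoly K[6]}) : Prop :=
  cubic_form g /\ proj_equiv (map_mpoly iota g) (perazzo_form Kbar).

(* For a nonzero column h, the hyperplane H is {y | y *m h = 0}.  A row-free A
   with A *m h = 0 is a linear isomorphism x |-> x *m A from P^n onto H, and it
   identifies V(f) with the intersection of V(g) and H. *)
Definition isom_hyperplane_section (F : fieldType) (n : nat)
    (f : {mpoly F[n.+1]}) (g : {mpoly F[n.+2]}) (h : 'cV[F]_n.+2) : Prop :=
  exists A : 'M[F]_(n.+1, n.+2),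
    [/\ row_free A, A *m h = 0
      & exists2 c : F, c != 0 & lin_subst A g = c *: f].

(* Main.v *)
(** Write F for the polar form of the cubic.  A node p satisfies F p p _ = 0, and
   F p k _ = 0 only for k on the line of p.  These two facts bound the linear
   dependencies between nodes: a minimal one involves four or six nodes, a
   plane contains at most four nodes, and each hyperplane at most six.  Nine
   nodes therefore span the space, and in a basis of five of them at least three
   of the others are combinations of exactly three basis vectors.  A finite
   analysis of these triples leaves the dependencies among the edges of
   K_{3,3}, and the cubic becomes al x1 x2 x3 - be y1 y2 y3 on the hyperplane
   x1 + x2 + x3 = y1 + y2 + y3, the nodes being the points x_k = y_l = 1 with the
   other coordinates 0.

   For the descent, each x_k or y_l vanishes at exactly six nodes, and a linear
   form with this property is a multiple of one of them.  So a Galois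
   automorphism permutes the six forms up to scalars; the scalars are equal
   by the relation between the forms, and they are 1 once x1 + x2 + x3 has a
   coefficient equal to 1.  The values of the squares of the six forms at a
   suitable rational vector extend the 5 x 6 matrix of the forms to an
   invertible 6 x 6 matrix whose columns are permuted in the same way.  It
   defines a Perazzo cubic over K, and X is its section by the last coordinate
   hyperplane. *)
Require Import Defs.
From HB Require Import structures.
From mathcomp Require Import all_boot all_order all_algebra all_field.
From mathcomp Require Import mpoly ring.
From Stdlib Require Import Classical.
Local Open Scope ring_scope.

Set Implicit Arguments.
Unset Strict Implicit.
Unset Printing Implicit Defensive.
Import GRing.Theory.

(** In a frame of five nodes, [F] vanishes as soon as a basis vector is repeated, so the cubic is
    squarefree in the frame coordinates and has ten coefficients [F x_i x_j x_k]. A further node on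
    three basis vectors kills one coefficient and relates others linearly, which turns the geometry
    into a finite question about triples. In the final model the node p_kl is an edge of K_{3,3},
    and p_kl + p_k'l' = p_kl' + p_k'l. Four-cycles thus give the dependencies of four nodes and
    six-cycles those of six. Eight nodes along a path still leave a ratio of coefficients free that
    has to be fixed, so the ninth one is really used. In the descent, the six forms are dependent
    and cannot be coordinates of P^5: a sixth row is needed that Galois permutes like the forms.
    Values of the forms at a rational vector are permuted correctly, but they satisfy the relation
    between the forms and add nothing. Their squares are permuted in the same way and violate the
    relation for a suitable vector. The argument runs in a finite Galois extension containing all
    coefficients. *)

Ltac swapF f12 f23 a b := rewrite ?(f12 b a) ?(f23 _ b a).

(** A bubble sort by oriented uses of the symmetry of [F], so that equal values become syntactically
    equal. *)
Ltac sortF5 f12 f23 x1 x2 x3 x4 x5 :=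
  do 3 (swapF f12 f23 x1 x2; swapF f12 f23 x1 x3; swapF f12 f23 x1 x4;
        swapF f12 f23 x1 x5; swapF f12 f23 x2 x3; swapF f12 f23 x2 x4;
        swapF f12 f23 x2 x5; swapF f12 f23 x3 x4; swapF f12 f23 x3 x5;
        swapF f12 f23 x4 x5).

(** * Dependencies between nodes *)

Section Patterns.
Local Open Scope nat_scope.
(* Unlike [has], this does not evaluate the whole list under [vm_compute]. *)
Fixpoint some T (a : pred T) s :=
  if s is x :: s' then if a x then true else some a s' else false.

Lemma someE T (a : pred T) s : some a s = has a s.
Proof. by elim: s => //= x s ->; case: (a x). Qed.

(* The list [m] gives, for each of the further nodes, which coordinates in the
   frame are nonzero.  Permuting the nodes by [q] and the frame by [o] has to
   turn these supports into the sets listed in [P]. *)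
Definition matches (m : seq (seq bool)) (P : seq (seq nat)) (o q : seq nat) :=
  ~~ some (fun j => some (fun i => nth false (nth [::] m (nth 0 q j)) (nth 0 o i)
      != (i \in nth [::] P j)) (iota 0 5)) (iota 0 (size P)).

Lemma matchesP m P o q j i : matches m P o q -> j < size P -> i < 5 ->
  nth false (nth [::] m (nth 0 q j)) (nth 0 o i) = (i \in nth [::] P j).
Proof.
move=> M jP i5; apply/eqP; apply: contraNT M => ne; rewrite someE.
apply/hasP; exists j; first by rewrite mem_iota.
by rewrite someE; apply/hasP; exists i; rewrite ?mem_iota.
Qed.

Definition has_pattern (m : seq (seq bool)) (Ps : seq (seq (seq nat))) :=
  some (fun P => some (fun o => some (matches m P o) (permutations (iota 0 3)))
    (permutations (iota 0 5))) Ps.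

Definition masks n k : seq (seq bool) :=
  filter (fun s => count id s == k)
    (iter n (fun l => map (cons true) l ++ map (cons false) l) [:: [::]]).

Definition same_triple := [:: [:: 0; 1; 2]; [:: 0; 1; 2]].
Definition common_pair := [:: [:: 0; 1; 2]; [:: 0; 1; 3]; [:: 0; 1; 4]].
Definition common_hyperplane := [:: [:: 0; 1; 2]; [:: 0; 1; 3]; [:: 0; 2; 3]].
Definition path_pattern := [:: [:: 0; 1; 2]; [:: 1; 2; 3]; [:: 2; 3; 4]].
Definition path_edge_pattern := [:: [:: 2; 3; 4]; [:: 0; 3; 4]; [:: 0; 1; 2]].

(* Only [path_pattern] and [path_edge_pattern] occur, and the latter becomes
   the former in another frame. *)
Lemma three_triples : all (fun m1 => all (fun m2 => all (fun m3 =>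
  has_pattern [:: m1; m2; m3] [:: same_triple; path_pattern; path_edge_pattern;
    common_pair; common_hyperplane]) (masks 5 3)) (masks 5 3)) (masks 5 3).
Proof. by vm_compute. Qed.

(** Distinct triples in a four-element set omit distinct elements, so three of them share the
    element that none omits. *)
Lemma three_triples_in_hyperplane : all (fun m1 => all (fun m2 => all (fun m3 =>
  has_pattern [:: m1; m2; m3] [:: same_triple; common_hyperplane])
  (map (rcons^~ false) (masks 4 3))) (map (rcons^~ false) (masks 4 3)))
  (map (rcons^~ false) (masks 4 3)).
Proof. by vm_compute. Qed.

End Patterns.

Section Trilinear.
Variables (L : fieldType) (V : vectType L) (F : V -> V -> V -> L).
Hypothesis nz2 : 2%:R != 0 :> L.
Hypothesis nz3 : 3%:R != 0 :> L.
Hypothesis dimV : \dim {:V} = 5%N.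
Hypothesis F_linear :
  forall a u u' v w, F (a *: u + u') v w = a * F u v w + F u' v w.
Hypothesis F12 : forall u v w, F u v w = F v u w.
Hypothesis F23 : forall u v w, F u v w = F u w v.

Definition prop_to (p q : V) := exists c, q = c *: p.

Definition isotropic p := forall v, F p p v = 0.

Definition node p :=
  [/\ p != 0, isotropic p & forall k, (forall v, F p k v = 0) -> prop_to p k].

Lemma node_isotropic p : node p -> isotropic p.
Proof. by case. Qed.

Lemma trilinDl u u' v w : F (u + u') v w = F u v w + F u' v w.
Proof. by rewrite -[u]scale1r F_linear mul1r scale1r. Qed.

Lemma trilin0l v w : F 0 v w = 0.
Proof.
have := trilinDl 0 0 v w.
by rewrite addr0 => /eqP; rewrite -subr_eq0 opprD addrA subrr add0r oppr_eq0 =>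
  /eqP.
Qed.

Lemma trilinZl a u v w : F (a *: u) v w = a * F u v w.
Proof. by rewrite -[a *: u]addr0 F_linear trilin0l addr0. Qed.

Lemma trilinDm u u' v w : F v (u + u') w = F v u w + F v u' w.
Proof. by rewrite F12 trilinDl !(F12 v). Qed.

Lemma trilinZm a u v w : F v (a *: u) w = a * F v u w.
Proof. by rewrite F12 trilinZl F12. Qed.

Lemma trilinDr u u' v w : F v w (u + u') = F v w u + F v w u'.
Proof. by rewrite F23 trilinDm !(F23 v w). Qed.

Lemma trilinZr a u v w : F v w (a *: u) = a * F v w u.
Proof. by rewrite F23 trilinZm F23. Qed.

Definition trilinE :=
  (trilinDl, trilinDm, trilinDr, trilinZl, trilinZm, trilinZr).

Lemma trilin_diag0 u v w : (forall x, F x x x = 0) -> F u v w = 0.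
Proof.
move=> d0; have sq x y : F x x y = 0.
  (* Subtracting the two expansions isolates [6 F x x y]. *)
  have := d0 (x + y); have := d0 (x + (- 1) *: y); rewrite !trilinE !d0.
  do 3 rewrite ?(F12 y x) ?(F23 _ y x); rewrite ?d0 ?(mulr0, addr0, add0r) => E1 E2.
  apply: (mulfI (mulf_neq0 nz2 nz3)); rewrite mulr0.
  transitivity (0 - 0 : L); last by rewrite subr0.
  by rewrite -{1}E2 -E1; ring.
have := sq (u + v) w; rewrite !trilinE !sq (F12 v u) => E.
by apply: (mulfI nz2); rewrite mulr0 -E; ring.
Qed.

Lemma nodeZ c p : c != 0 -> node p -> node (c *: p).
Proof.
move=> c0 [p0 ip kp]; split; first by rewrite scaler_eq0 negb_or c0.
  by move=> v; rewrite !trilinE ip !mulr0.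
move=> k Hk; case: (kp k) => [v|d ->].
  by have /eqP := Hk v; rewrite trilinE mulf_eq0 (negPf c0) => /eqP.
by exists (d / c); rewrite scalerA divfK.
Qed.

Lemma isotropic_r p v : isotropic p -> F v p p = 0.
Proof. by move=> ip; rewrite F12 F23 ip. Qed.

Lemma prop_toZl c p q : c != 0 -> prop_to (c *: p) q <-> prop_to p q.
Proof.
move=> c0; split=> -[d ->]; first by exists (d * c); rewrite scalerA.
by exists (d / c); rewrite scalerA divfK.
Qed.

Definition lc5 (t1 t2 t3 t4 t5 : L) (x1 x2 x3 x4 x5 : V) :=
  t1 *: x1 + t2 *: x2 + t3 *: x3 + t4 *: x4 + t5 *: x5.

Lemma lc5D t1 t2 t3 t4 t5 u1 u2 u3 u4 u5 x1 x2 x3 x4 x5 :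
  lc5 t1 t2 t3 t4 t5 x1 x2 x3 x4 x5 + lc5 u1 u2 u3 u4 u5 x1 x2 x3 x4 x5 =
  lc5 (t1 + u1) (t2 + u2) (t3 + u3) (t4 + u4) (t5 + u5) x1 x2 x3 x4 x5.
Proof. by rewrite /lc5 !scalerDl; do 4 (rewrite [LHS]addrACA; congr (_ + _)). Qed.

Lemma lc5Z c t1 t2 t3 t4 t5 x1 x2 x3 x4 x5 :
  c *: lc5 t1 t2 t3 t4 t5 x1 x2 x3 x4 x5 =
  lc5 (c * t1) (c * t2) (c * t3) (c * t4) (c * t5) x1 x2 x3 x4 x5.
Proof. by rewrite /lc5 !scalerDr !scalerA. Qed.

Lemma polar_lc5 x1 x2 x3 x4 x5 t1 t2 t3 t4 t5 u1 u2 u3 u4 u5 v :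
  isotropic x1 -> isotropic x2 -> isotropic x3 -> isotropic x4 ->
  isotropic x5 ->
  F (lc5 t1 t2 t3 t4 t5 x1 x2 x3 x4 x5) (lc5 u1 u2 u3 u4 u5 x1 x2 x3 x4 x5) v =
  (t1 * u2 + t2 * u1) * F x1 x2 v + (t1 * u3 + t3 * u1) * F x1 x3 v +
  (t1 * u4 + t4 * u1) * F x1 x4 v + (t1 * u5 + t5 * u1) * F x1 x5 v +
  (t2 * u3 + t3 * u2) * F x2 x3 v + (t2 * u4 + t4 * u2) * F x2 x4 v +
  (t2 * u5 + t5 * u2) * F x2 x5 v + (t3 * u4 + t4 * u3) * F x3 x4 v +
  (t3 * u5 + t5 * u3) * F x3 x5 v + (t4 * u5 + t5 * u4) * F x4 x5 v.
Proof.
move=> i1 i2 i3 i4 i5; rewrite /lc5 !trilinE i1 i2 i3 i4 i5.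
rewrite (F12 x2 x1) (F12 x3 x1) (F12 x4 x1) (F12 x5 x1) (F12 x3 x2).
rewrite (F12 x4 x2) (F12 x5 x2) (F12 x4 x3) (F12 x5 x3) (F12 x5 x4).
by ring.
Qed.

Lemma polar_lc3 x1 x2 x3 t1 t2 t3 u1 u2 u3 v :
  isotropic x1 -> isotropic x2 -> isotropic x3 ->
  F (t1 *: x1 + t2 *: x2 + t3 *: x3) (u1 *: x1 + u2 *: x2 + u3 *: x3) v =
  (t1 * u2 + t2 * u1) * F x1 x2 v + (t1 * u3 + t3 * u1) * F x1 x3 v +
  (t2 * u3 + t3 * u2) * F x2 x3 v.
Proof.
move=> i1 i2 i3; rewrite !trilinE i1 i2 i3.
by rewrite (F12 x2 x1) (F12 x3 x1) (F12 x3 x2); ring.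
Qed.

Lemma polar_lc4 x1 x2 x3 x4 t1 t2 t3 t4 v :
  isotropic x1 -> isotropic x2 -> isotropic x3 -> isotropic x4 ->
  F (t1 *: x1 + t2 *: x2 + t3 *: x3 + t4 *: x4)
    (t1 *: x1 + t2 *: x2 + t3 *: x3 + t4 *: x4) v =
  2%:R * (t1 * t2 * F x1 x2 v + t1 * t3 * F x1 x3 v + t1 * t4 * F x1 x4 v +
  t2 * t3 * F x2 x3 v + t2 * t4 * F x2 x4 v + t3 * t4 * F x3 x4 v).
Proof.
move=> i1 i2 i3 i4; rewrite !trilinE i1 i2 i3 i4.
rewrite (F12 x2 x1) (F12 x3 x1) (F12 x4 x1) (F12 x3 x2).
rewrite (F12 x4 x2) (F12 x4 x3).
by ring.
Qed.

(** Isotropy of a third point on the line says [F x1 x2 _ = 0], so [x2] would lie in the kernel at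
    [x1]. *)
Lemma no_collinear_nodes x1 x2 t1 t2 :
  node x1 -> node x2 -> ~ prop_to x1 x2 -> t1 != 0 -> t2 != 0 ->
  ~ isotropic (t1 *: x1 + t2 *: x2).
Proof.
move=> [_ i1 k1] [_ i2 _] n12 t10 t20 ip; apply/n12/k1 => v.
have := ip v; rewrite !trilinE i1 i2 (F12 x2 x1) !mulr0 add0r addr0.
have -> : t1 * (t2 * F x1 x2 v) + t2 * (t1 * F x1 x2 v) =
  (2%:R * t1 * t2) * F x1 x2 v by ring.
by move/eqP; rewrite !mulf_eq0 (negPf nz2) (negPf t10) (negPf t20) => /eqP.
Qed.

Lemma plane_rel x1 x2 x3 t1 t2 t3 v :
  isotropic x1 -> isotropic x2 -> isotropic x3 ->
  isotropic (t1 *: x1 + t2 *: x2 + t3 *: x3) ->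
  t1 * t2 * F x1 x2 v + t1 * t3 * F x1 x3 v + t2 * t3 * F x2 x3 v = 0.
Proof.
move=> i1 i2 i3 ip; have := ip v; rewrite polar_lc3 // => E.
by apply: (mulfI nz2); rewrite mulr0 -[RHS]E; ring.
Qed.

(** At [v = x1] only the term with three different nodes survives in [plane_rel]. *)
Lemma plane_zero x1 x2 x3 t1 t2 t3 :
  isotropic x1 -> isotropic x2 -> isotropic x3 -> t2 != 0 -> t3 != 0 ->
  isotropic (t1 *: x1 + t2 *: x2 + t3 *: x3) -> F x1 x2 x3 = 0.
Proof.
move=> i1 i2 i3 t20 t30 ip; have := plane_rel x1 i1 i2 i3 ip.
rewrite !(F23 x1 _ x1) i1 i1 !mulr0 !add0r F23 (F12 x2 x1) => /eqP.
by rewrite !mulf_eq0 (negPf t20) (negPf t30) => /eqP.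
Qed.

Definition frame5 (x1 x2 x3 x4 x5 : V) := free [:: x1; x2; x3; x4; x5].

Lemma frame_indep x1 x2 x3 x4 x5 t1 t2 t3 t4 t5 :
  frame5 x1 x2 x3 x4 x5 -> lc5 t1 t2 t3 t4 t5 x1 x2 x3 x4 x5 = 0 ->
  [/\ t1 = 0, t2 = 0, t3 = 0, t4 = 0 & t5 = 0].
Proof.
move=> /(@freeP _ _ 5 [tuple x1; x2; x3; x4; x5]) fr E.
have /fr z : \sum_(i < 5) [:: t1; t2; t3; t4; t5]`_i *:
    [tuple x1; x2; x3; x4; x5]`_i = 0.
  by rewrite !big_ord_recl big_ord0 /= addr0 -[RHS]E /lc5 !addrA.
split; [exact: (z (Ordinal (isT : (0 < 5)%N)))
       |exact: (z (Ordinal (isT : (1 < 5)%N)))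
       |exact: (z (Ordinal (isT : (2 < 5)%N)))
       |exact: (z (Ordinal (isT : (3 < 5)%N)))
       |exact: (z (Ordinal (isT : (4 < 5)%N)))].
Qed.

Lemma frame_of_indep x1 x2 x3 x4 x5 :
  (forall t1 t2 t3 t4 t5, lc5 t1 t2 t3 t4 t5 x1 x2 x3 x4 x5 = 0 ->
    [/\ t1 = 0, t2 = 0, t3 = 0, t4 = 0 & t5 = 0]) ->
  frame5 x1 x2 x3 x4 x5.
Proof.
move=> ind; apply/(@freeP _ _ 5 [tuple x1; x2; x3; x4; x5]) => k.
rewrite !big_ord_recl big_ord0 /= addr0 !addrA => /ind[z0 z1 z2 z3 z4] i.
case: i => -[|[|[|[|[|//]]]]] lti; [rewrite -[RHS]z0|rewrite -[RHS]z1|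
  rewrite -[RHS]z2|rewrite -[RHS]z3|rewrite -[RHS]z4]; congr k; exact: val_inj.
Qed.

Lemma frame_span x1 x2 x3 x4 x5 v :
  frame5 x1 x2 x3 x4 x5 ->
  exists t1 t2 t3 t4 t5, v = lc5 t1 t2 t3 t4 t5 x1 x2 x3 x4 x5.
Proof.
move=> fr; pose X := [tuple x1; x2; x3; x4; x5].
have bX : basis_of {:V} X by rewrite basisEfree [free _]fr subvf dimV.
have /(coord_basis bX) E := memvf v.
move: E; rewrite !big_ord_recl big_ord0 /= addr0 !addrA => E.
by do 5!eexists; exact: E.
Qed.

Lemma lc5_2 x1 x2 x3 x4 x5 : x2 = lc5 0 1 0 0 0 x1 x2 x3 x4 x5.
Proof. by rewrite /lc5 scale1r !scale0r !addr0 add0r. Qed.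

Lemma lc5_5 x1 x2 x3 x4 x5 : x5 = lc5 0 0 0 0 1 x1 x2 x3 x4 x5.
Proof. by rewrite /lc5 scale1r !scale0r !add0r. Qed.

Lemma frame_exchange x1 x2 x3 x4 x5 t1 t2 t3 t4 t5 :
  frame5 x1 x2 x3 x4 x5 -> t1 != 0 ->
  frame5 (lc5 t1 t2 t3 t4 t5 x1 x2 x3 x4 x5) x2 x3 x4 x5.
Proof.
move=> fr t10; apply: frame_of_indep => u1 u2 u3 u4 u5 E.
have E1 : lc5 (u1 * t1) (u1 * t2 + u2) (u1 * t3 + u3) (u1 * t4 + u4)
    (u1 * t5 + u5) x1 x2 x3 x4 x5 = 0.
  rewrite -[u1 * t1]addr0 -lc5D -lc5Z -[RHS]E /lc5 scale0r add0r -!addrA.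
  by congr (_ + _).
have [/eqP] := frame_indep fr E1.
rewrite mulf_eq0 (negPf t10) orbF => /eqP->.
by rewrite !mul0r !add0r.
Qed.

Lemma lc5_eq x1 x2 x3 x4 x5 t1 t2 t3 t4 t5 u1 u2 u3 u4 u5 :
  frame5 x1 x2 x3 x4 x5 ->
  lc5 t1 t2 t3 t4 t5 x1 x2 x3 x4 x5 = lc5 u1 u2 u3 u4 u5 x1 x2 x3 x4 x5 ->
  [/\ t1 = u1, t2 = u2, t3 = u3, t4 = u4 & t5 = u5].
Proof.
move=> fr /eqP; rewrite -subr_eq0 -scaleN1r lc5Z lc5D !mulN1r => /eqP E.
have [/eqP + /eqP + /eqP + /eqP + /eqP] := frame_indep fr E.
by rewrite !subr_eq0 => /eqP-> /eqP-> /eqP-> /eqP-> /eqP->.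
Qed.

Lemma frame_nprop x1 x2 x3 x4 x5 : frame5 x1 x2 x3 x4 x5 -> ~ prop_to x1 x2.
Proof.
move=> fr [c E]; have : lc5 0 1 0 0 0 x1 x2 x3 x4 x5 = lc5 c 0 0 0 0 x1 x2 x3 x4 x5.
  by rewrite -lc5_2 E /lc5 !scale0r !addr0.
by case/(lc5_eq fr) => _ /eqP; rewrite oner_eq0.
Qed.

Lemma frame_perm x1 x2 x3 x4 x5 y1 y2 y3 y4 y5 :
  frame5 x1 x2 x3 x4 x5 ->
  perm_eq [:: y1; y2; y3; y4; y5] [:: x1; x2; x3; x4; x5] ->
  frame5 y1 y2 y3 y4 y5.
Proof. by move=> fr /perm_free E; rewrite /frame5 E. Qed.

(* Otherwise F x1 x2 _ and F x1 x3 _ vanish on the hyperplane x1, ..., x4, hence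
   are proportional, and a combination of x2 and x3 lies in the kernel of F x1. *)
Lemma hyperplane_nonzero x1 x2 x3 x4 x5 : frame5 x1 x2 x3 x4 x5 ->
  node x1 -> isotropic x2 -> isotropic x3 -> isotropic x4 ->
  F x1 x2 x3 = 0 -> F x1 x2 x4 = 0 -> F x1 x3 x4 = 0 -> False.
Proof.
move=> fr [_ i1 k1] i2 i3 i4 F123 F124 F134.
have ker k : F x1 k x1 = 0 -> F x1 k x2 = 0 -> F x1 k x3 = 0 ->
    F x1 k x4 = 0 -> F x1 k x5 = 0 -> prop_to x1 k.
  move=> E1 E2 E3 E4 E5; apply: k1 => v.
  have [t1[t2[t3[t4[t5 ->]]]]] := frame_span v fr.
  by rewrite /lc5 !trilinE E1 E2 E3 E4 E5 !mulr0 !addr0.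
set a := F x1 x2 x5; set b := F x1 x3 x5.
have F213 : F x1 x3 x2 = 0 by rewrite F23.
case: (ker (b *: x2 + (- a) *: x3)).
- by rewrite !trilinE !(F23 x1 _ x1) !i1 !mulr0 addr0.
- by rewrite !trilinE F213 isotropic_r // !mulr0 addr0.
- by rewrite !trilinE F123 isotropic_r // !mulr0 addr0.
- by rewrite !trilinE F124 F134 !mulr0 addr0.
- by rewrite !trilinE -/a -/b; ring.
move=> c E; have : lc5 0 b (- a) 0 0 x1 x2 x3 x4 x5 = lc5 c 0 0 0 0 x1 x2 x3 x4 x5.
  rewrite /lc5 !scale0r !addr0 add0r; exact: E.
case/(lc5_eq fr) => _ b0 /eqP; rewrite oppr_eq0 => /eqP a0 _ _.
apply: (frame_nprop fr); apply: ker => //; first by rewrite F23.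
exact: isotropic_r.
Qed.

(** On the span of [x1], ..., [x4] the cubic is squarefree with four coefficients. All its partial
    derivatives vanish at the point, hence so does its value. The value minus [t_i] times the [i]-th
    derivative is the one monomial without [t_i], so every coefficient vanishes, against
    [hyperplane_nonzero]. *)
Lemma no_four_support x1 x2 x3 x4 x5 t1 t2 t3 t4 : frame5 x1 x2 x3 x4 x5 ->
  node x1 -> isotropic x2 -> isotropic x3 -> isotropic x4 ->
  t1 != 0 -> t2 != 0 -> t3 != 0 -> t4 != 0 ->
  ~ isotropic (t1 *: x1 + t2 *: x2 + t3 *: x3 + t4 *: x4).
Proof.
move=> fr n1 i2 i3 i4 t10 t20 t30 t40 ip; have i1 := node_isotropic n1.
have rel v : t1 * t2 * F x1 x2 v + t1 * t3 * F x1 x3 v + t1 * t4 * F x1 x4 v +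
    t2 * t3 * F x2 x3 v + t2 * t4 * F x2 x4 v + t3 * t4 * F x3 x4 v = 0.
  by have := ip v; rewrite polar_lc4 // => /eqP; rewrite mulf_eq0 (negPf nz2) =>
    /eqP.
have := rel x1; have := rel x2; have := rel x3; have := rel x4.
sortF5 F12 F23 x1 x2 x3 x4 x5.
rewrite !isotropic_r // !i1 !i2 !i3 !mulr0 !addr0 !add0r => E4 E3 E2 E1.
have sumE : t1 * t2 * t3 * F x1 x2 x3 + t1 * t2 * t4 * F x1 x2 x4 +
    t1 * t3 * t4 * F x1 x3 x4 + t2 * t3 * t4 * F x2 x3 x4 = 0.
  apply: (mulfI nz3); rewrite mulr0.
  transitivity (t1 * 0 + t2 * 0 + t3 * 0 + t4 * 0 : L); last by ring.
  by rewrite -{1}E1 -{1}E2 -{1}E3 -E4; ring.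
apply: (hyperplane_nonzero fr n1) => //.
- apply: (mulfI (mulf_neq0 (mulf_neq0 t10 t20) t30)); rewrite mulr0.
  transitivity (0 - t4 * 0 : L); last by ring.
  by rewrite -{1}sumE -E4; ring.
- apply: (mulfI (mulf_neq0 (mulf_neq0 t10 t20) t40)); rewrite mulr0.
  transitivity (0 - t3 * 0 : L); last by ring.
  by rewrite -{1}sumE -E3; ring.
- apply: (mulfI (mulf_neq0 (mulf_neq0 t10 t30) t40)); rewrite mulr0.
  transitivity (0 - t2 * 0 : L); last by ring.
  by rewrite -{1}sumE -E2; ring.
Qed.

(* The Cremona involution (t_i) |-> (1 / t_i) turns the conics F _ _ v into lines
   through the images of both nodes; the direction of the line joining these,
   mapped back, is the kernel vector (t_i^2 / u_i) at the first node. *)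
Lemma plane_unique x1 x2 x3 x4 x5 t1 t2 t3 u1 u2 u3 :
  frame5 x1 x2 x3 x4 x5 -> isotropic x1 -> isotropic x2 -> isotropic x3 ->
  t1 != 0 -> t2 != 0 -> t3 != 0 -> u1 != 0 -> u2 != 0 -> u3 != 0 ->
  node (t1 *: x1 + t2 *: x2 + t3 *: x3) ->
  isotropic (u1 *: x1 + u2 *: x2 + u3 *: x3) ->
  prop_to (u1 *: x1 + u2 *: x2 + u3 *: x3) (t1 *: x1 + t2 *: x2 + t3 *: x3).
Proof.
move=> fr i1 i2 i3 t10 t20 t30 u10 u20 u30 [_ ip kp] iq.
case: (kp (t1 ^+ 2 / u1 *: x1 + t2 ^+ 2 / u2 *: x2 + t3 ^+ 2 / u3 *: x3)).
  move=> v; have Ep := plane_rel v i1 i2 i3 ip.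
  have Eq := plane_rel v i1 i2 i3 iq; rewrite polar_lc3 //.
  transitivity ((t1 / u1 + t2 / u2 + t3 / u3) * 0
     - t1 * t2 * t3 / (u1 * u2 * u3) * 0); last by ring.
  by rewrite -{1}Ep -Eq; field; rewrite u10 u20 u30.
move=> c E; exists c.
have : lc5 (t1 ^+ 2 / u1) (t2 ^+ 2 / u2) (t3 ^+ 2 / u3) 0 0 x1 x2 x3 x4 x5 =
       lc5 (c * t1) (c * t2) (c * t3) 0 0 x1 x2 x3 x4 x5.
  by rewrite /lc5 !scale0r !addr0 E !scalerDr !scalerA.
have aux t u : t != 0 -> u != 0 -> t ^+ 2 / u = c * t -> t = c * u.
  move=> t0 u0 H; apply: (mulfI t0); rewrite -expr2 -[t ^+ 2](divfK u0) H.
  by ring.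
case/(lc5_eq fr) => /aux-> // /aux-> // /aux-> // _ _.
by rewrite !scalerDr !scalerA.
Qed.

(** These are the partial derivatives at [t] of the squarefree cubic with coefficients
    [F x_i x_j x_k]; the common factor 2 is cancelled. *)
Lemma isotropic_rel x1 x2 x3 x4 x5 t1 t2 t3 t4 t5 :
  isotropic x1 -> isotropic x2 -> isotropic x3 -> isotropic x4 ->
  isotropic x5 -> isotropic (lc5 t1 t2 t3 t4 t5 x1 x2 x3 x4 x5) ->
  [/\ t2 * t3 * F x1 x2 x3 + t2 * t4 * F x1 x2 x4 + t2 * t5 * F x1 x2 x5 + t3 *
    t4 * F x1 x3 x4 + t3 * t5 * F x1 x3 x5 + t4 * t5 * F x1 x4 x5 = 0,
    t1 * t3 * F x1 x2 x3 + t1 * t4 * F x1 x2 x4 + t1 * t5 * F x1 x2 x5 + t3 *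
    t4 * F x2 x3 x4 + t3 * t5 * F x2 x3 x5 + t4 * t5 * F x2 x4 x5 = 0,
    t1 * t2 * F x1 x2 x3 + t1 * t4 * F x1 x3 x4 + t1 * t5 * F x1 x3 x5 + t2 *
    t4 * F x2 x3 x4 + t2 * t5 * F x2 x3 x5 + t4 * t5 * F x3 x4 x5 = 0,
    t1 * t2 * F x1 x2 x4 + t1 * t3 * F x1 x3 x4 + t1 * t5 * F x1 x4 x5 + t2 *
    t3 * F x2 x3 x4 + t2 * t5 * F x2 x4 x5 + t3 * t5 * F x3 x4 x5 = 0 &
    t1 * t2 * F x1 x2 x5 + t1 * t3 * F x1 x3 x5 + t1 * t4 * F x1 x4 x5 + t2 *
    t3 * F x2 x3 x5 + t2 * t4 * F x2 x4 x5 + t3 * t4 * F x3 x4 x5 = 0].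
Proof.
move=> i1 i2 i3 i4 i5 iso.
have := iso x1; have := iso x2; have := iso x3; have := iso x4; have := iso x5.
rewrite !polar_lc5 //; sortF5 F12 F23 x1 x2 x3 x4 x5.
rewrite !isotropic_r // !i1 !i2 !i3 !i4 !mulr0 !addr0 !add0r => E5 E4 E3 E2 E1.
by split; apply: (mulfI nz2); rewrite mulr0;
  [rewrite -[RHS]E1|rewrite -[RHS]E2|rewrite -[RHS]E3|rewrite -[RHS]E4
  |rewrite -[RHS]E5]; ring.
Qed.

(** Euler's relation: weighting the derivatives of [isotropic_rel] by [t_i] counts each monomial
    three times. *)
Lemma isotropic_total x1 x2 x3 x4 x5 t1 t2 t3 t4 t5 :
  isotropic x1 -> isotropic x2 -> isotropic x3 -> isotropic x4 ->
  isotropic x5 -> isotropic (lc5 t1 t2 t3 t4 t5 x1 x2 x3 x4 x5) ->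
  t1 * t2 * t3 * F x1 x2 x3 + t1 * t2 * t4 * F x1 x2 x4 + t1 * t2 * t5 * F x1
  x2 x5 + t1 * t3 * t4 * F x1 x3 x4 + t1 * t3 * t5 * F x1 x3 x5 + t1 * t4 * t5
  * F x1 x4 x5 + t2 * t3 * t4 * F x2 x3 x4 + t2 * t3 * t5 * F x2 x3 x5 + t2 *
  t4 * t5 * F x2 x4 x5 + t3 * t4 * t5 * F x3 x4 x5 = 0.
Proof.
move=> i1 i2 i3 i4 i5 /(isotropic_rel i1 i2 i3 i4 i5)[E1 E2 E3 E4 E5].
apply: (mulfI nz3); rewrite mulr0.
transitivity (t1 * 0 + t2 * 0 + t3 * 0 + t4 * 0 + t5 * 0 : L); last by ring.
by rewrite -{1}E1 -{1}E2 -{1}E3 -{1}E4 -E5; ring.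
Qed.

(* As for [plane_unique]: the Cremona involution now turns the cubic into a
   quadric cone with both points in its vertex. *)
Lemma full_unique x1 x2 x3 x4 x5 t1 t2 t3 t4 t5 u1 u2 u3 u4 u5 :
  frame5 x1 x2 x3 x4 x5 -> isotropic x1 -> isotropic x2 -> isotropic x3 ->
  isotropic x4 -> isotropic x5 ->
  t1 != 0 -> t2 != 0 -> t3 != 0 -> t4 != 0 -> t5 != 0 ->
  u1 != 0 -> u2 != 0 -> u3 != 0 -> u4 != 0 -> u5 != 0 ->
  node (lc5 t1 t2 t3 t4 t5 x1 x2 x3 x4 x5) ->
  isotropic (lc5 u1 u2 u3 u4 u5 x1 x2 x3 x4 x5) ->
  prop_to (lc5 u1 u2 u3 u4 u5 x1 x2 x3 x4 x5)
          (lc5 t1 t2 t3 t4 t5 x1 x2 x3 x4 x5).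
Proof.
move=> fr i1 i2 i3 i4 i5 t10 t20 t30 t40 t50 u10 u20 u30 u40 u50.
(* With [w_i = t_i / u_i] the kernel vector has the coordinates [w_i * t_i], and denominators
   disappear from the identities below. *)
have [w1 tE1] : exists w, t1 = w * u1 by exists (t1 / u1); rewrite divfK.
have [w2 tE2] : exists w, t2 = w * u2 by exists (t2 / u2); rewrite divfK.
have [w3 tE3] : exists w, t3 = w * u3 by exists (t3 / u3); rewrite divfK.
have [w4 tE4] : exists w, t4 = w * u4 by exists (t4 / u4); rewrite divfK.
have [w5 tE5] : exists w, t5 = w * u5 by exists (t5 / u5); rewrite divfK.
move=> [_ ip kp] iq.
case: (kp (lc5 (w1 * t1) (w2 * t2) (w3 * t3) (w4 * t4) (w5 * t5)
  x1 x2 x3 x4 x5)); last first.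
  move=> c E; exists c; move: E; rewrite !lc5Z => /(lc5_eq fr)[].
  move=> /(mulIf t10) e1 /(mulIf t20) e2 /(mulIf t30) e3 /(mulIf t40) e4.
  by move=> /(mulIf t50) e5; rewrite tE1 tE2 tE3 tE4 tE5 e1 e2 e3 e4 e5.
have [p1 p2 p3 p4 p5] := isotropic_rel i1 i2 i3 i4 i5 ip.
have [q1 q2 q3 q4 q5] := isotropic_rel i1 i2 i3 i4 i5 iq.
have S := isotropic_total i1 i2 i3 i4 i5 ip.
have S' := isotropic_total i1 i2 i3 i4 i5 iq.
suff [k1 k2 k3 k4 k5] : [/\ F (lc5 t1 t2 t3 t4 t5 x1 x2 x3 x4 x5)
 (lc5 (w1 * t1) (w2 * t2) (w3 * t3) (w4 * t4) (w5 * t5) x1 x2 x3 x4 x5) x1 = 0,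
 F (lc5 t1 t2 t3 t4 t5 x1 x2 x3 x4 x5)
 (lc5 (w1 * t1) (w2 * t2) (w3 * t3) (w4 * t4) (w5 * t5) x1 x2 x3 x4 x5) x2 = 0,
 F (lc5 t1 t2 t3 t4 t5 x1 x2 x3 x4 x5)
 (lc5 (w1 * t1) (w2 * t2) (w3 * t3) (w4 * t4) (w5 * t5) x1 x2 x3 x4 x5) x3 = 0,
 F (lc5 t1 t2 t3 t4 t5 x1 x2 x3 x4 x5)
 (lc5 (w1 * t1) (w2 * t2) (w3 * t3) (w4 * t4) (w5 * t5) x1 x2 x3 x4 x5) x4 = 0 &
 F (lc5 t1 t2 t3 t4 t5 x1 x2 x3 x4 x5)
 (lc5 (w1 * t1) (w2 * t2) (w3 * t3) (w4 * t4) (w5 * t5) x1 x2 x3 x4 x5) x5 = 0].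
  move=> v; have [v1[v2[v3[v4[v5 ->]]]]] := frame_span v fr.
  by rewrite {3}/lc5 !trilinDr !trilinZr k1 k2 k3 k4 k5 !mulr0 !addr0.
rewrite !polar_lc5 //; sortF5 F12 F23 x1 x2 x3 x4 x5.
rewrite !isotropic_r // !i1 !i2 !i3 !i4 !mulr0 !addr0 !add0r.
move: p1 p2 p3 p4 p5 S; rewrite tE1 tE2 tE3 tE4 tE5 => p1 p2 p3 p4 p5 S.
split.
(* The relations at [t] give the wanted value up to terms [- w_m t_j t_k t_l F x_j x_k x_l] without
   [x1]. As [t_i = w_i u_i], these are cancelled by [w2 w3 w4 w5] times [S' - u1 q1], the part
   without [x1] of the cubic at [u]. The other four cases are symmetric. *)
-  apply: (mulfI t10); rewrite mulr0 tE1.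
  transitivity ((w2 + w3 + w4 + w5) * (w1 * u1) * 0 +
    (w2 * (w2 * u2) * 0 + w3 * (w3 * u3) * 0 + w4 * (w4 * u4) * 0 + w5 * (w5 * u5)
      * 0) -
    (w2 + w3 + w4 + w5) * 0 +
    w2 * w3 * w4 * w5 * (0 - u1 * 0) : L); last by ring.
  rewrite -{1}p1 -{1}p2 -{1}p3 -{1}p4 -{1}p5 -{1}S -{1}S' -q1; ring.
-  apply: (mulfI t20); rewrite mulr0 tE2.
  transitivity ((w1 + w3 + w4 + w5) * (w2 * u2) * 0 +
    (w1 * (w1 * u1) * 0 + w3 * (w3 * u3) * 0 + w4 * (w4 * u4) * 0 + w5 * (w5 * u5)
      * 0) -
    (w1 + w3 + w4 + w5) * 0 +
    w1 * w3 * w4 * w5 * (0 - u2 * 0) : L); last by ring.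
  rewrite -{1}p2 -{1}p1 -{1}p3 -{1}p4 -{1}p5 -{1}S -{1}S' -q2; ring.
-  apply: (mulfI t30); rewrite mulr0 tE3.
  transitivity ((w1 + w2 + w4 + w5) * (w3 * u3) * 0 +
    (w1 * (w1 * u1) * 0 + w2 * (w2 * u2) * 0 + w4 * (w4 * u4) * 0 + w5 * (w5 * u5)
      * 0) -
    (w1 + w2 + w4 + w5) * 0 +
    w1 * w2 * w4 * w5 * (0 - u3 * 0) : L); last by ring.
  rewrite -{1}p3 -{1}p1 -{1}p2 -{1}p4 -{1}p5 -{1}S -{1}S' -q3; ring.
-  apply: (mulfI t40); rewrite mulr0 tE4.
  transitivity ((w1 + w2 + w3 + w5) * (w4 * u4) * 0 +
    (w1 * (w1 * u1) * 0 + w2 * (w2 * u2) * 0 + w3 * (w3 * u3) * 0 + w5 * (w5 * u5)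
      * 0) -
    (w1 + w2 + w3 + w5) * 0 +
    w1 * w2 * w3 * w5 * (0 - u4 * 0) : L); last by ring.
  rewrite -{1}p4 -{1}p1 -{1}p2 -{1}p3 -{1}p5 -{1}S -{1}S' -q4; ring.
-  apply: (mulfI t50); rewrite mulr0 tE5.
  transitivity ((w1 + w2 + w3 + w4) * (w5 * u5) * 0 +
    (w1 * (w1 * u1) * 0 + w2 * (w2 * u2) * 0 + w3 * (w3 * u3) * 0 + w4 * (w4 * u4)
      * 0) -
    (w1 + w2 + w3 + w4) * 0 +
    w1 * w2 * w3 * w4 * (0 - u5 * 0) : L); last by ring.
  rewrite -{1}p5 -{1}p1 -{1}p2 -{1}p3 -{1}p4 -{1}S -{1}S' -q5; ring.
Qed.

Definition supp (s : seq (L * V)) := count (fun y => y.1 != 0) s.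

(** Support one is a repeated node, support two is excluded by [no_collinear_nodes] and support four
    by [no_four_support]. Only vectors with a nonzero coefficient have to be nodes, so that a few
    nodes may be completed to a basis by arbitrary vectors. *)
Lemma node_support s : size s = 5%N -> free (unzip2 s) ->
  (forall y, y \in s -> y.1 != 0 -> node y.2) ->
  node (\sum_(y <- s) y.1 *: y.2) ->
  (forall y, y \in s -> y.1 != 0 -> ~ prop_to y.2 (\sum_(y <- s) y.1 *: y.2)) ->
  supp s = 3%N \/ supp s = 5%N.
Proof.
pose a (y : L * V) := y.1 != 0.
(* Moving the nonzero coefficients to the front leaves one case for each size of the support. *)
have pe : perm_eq s (filter a s ++ filter (predC a) s).
  by rewrite perm_sym; apply/permPl; apply: perm_filterC.
rewrite (perm_big _ pe) /= /supp -/a -size_filter => sz.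
rewrite (perm_free (perm_map snd pe)) => fr nods nodp nprop.
have {}nods y : y \in filter a s -> a y /\ node y.2.
  by rewrite mem_filter => /andP[ay ys]; split=> //; apply: nods.
have {}nprop y : y \in filter a s ->
    ~ prop_to y.2 (\sum_(y <- filter a s ++ filter (predC a) s) y.1 *: y.2).
  by rewrite mem_filter => /andP[ay ys]; apply: nprop.
have zero y : y \in filter (predC a) s -> y.1 = 0.
  by rewrite mem_filter => /andP[/= /negPn/eqP].
have {}zero : \sum_(y <- filter (predC a) s) y.1 *: y.2 = 0.
  by rewrite big_seq big1 // => y /zero->; rewrite scale0r.
move: nodp nprop; rewrite big_cat zero /= addr0.
have : (size (filter a s) + size (filter (predC a) s) = 5)%N.
  by rewrite -sz (perm_size pe) size_cat.
move: fr; rewrite /unzip2 map_cat.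
case: (filter a s) nods => [|[t1 x1] [|[t2 x2] [|[t3 x3] [|[t4 x4] [|[t5 x5] [|?
  ?]]]]]] nods;
  rewrite ?big_cons ?big_nil /= ?addr0.
- by move=> _ _ [/eqP].
- move=> _ _ _ /(_ (t1, x1)) []; first by rewrite inE.
  by exists t1.
- case: (filter _ _) => [|[t3 x3] [|[t4 x4] [|[t5 x5] [|? ?]]]] //= fr _ np _.
  have [/= a1 n1] : a (t1, x1) /\ node x1 by apply: nods; rewrite !inE eqxx ?orbT.
  have [/= a2 n2] : a (t2, x2) /\ node x2 by apply: nods; rewrite !inE eqxx ?orbT.
  case: (no_collinear_nodes n1 n2 (frame_nprop fr) a1 a2).
  exact: node_isotropic.
- by left.
- case: (filter _ _) => [|[t5 x5] [|? ?]] //= fr _ np _.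
  have [/= a1 n1] : a (t1, x1) /\ node x1 by apply: nods; rewrite !inE eqxx ?orbT.
  have [/= a2 n2] : a (t2, x2) /\ node x2 by apply: nods; rewrite !inE eqxx ?orbT.
  have [/= a3 n3] : a (t3, x3) /\ node x3 by apply: nods; rewrite !inE eqxx ?orbT.
  have [/= a4 n4] : a (t4, x4) /\ node x4 by apply: nods; rewrite !inE eqxx ?orbT.
  case: (no_four_support fr n1 (node_isotropic n2) (node_isotropic n3)
    (node_isotropic n4) a1 a2 a3 a4); rewrite -!addrA.
  exact: node_isotropic.
- by right.
- by move=> _ /eqP.
Qed.

(* The cubics singular at the eight given nodes form a three-parameter family,
   and a ninth node fixes [z].  The value 0 of [z] corresponds to a ninth node
   with full support, the others to the supports ACE, ABE and ADE. *)
Lemma path_form A B C D E (p : V) :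
  frame5 A B C D E -> node A -> node B -> node C -> node D -> node E ->
  node (lc5 1 (-1) 1 0 0 A B C D E) -> node (lc5 0 1 (-1) 1 0 A B C D E) ->
  node (lc5 0 0 1 (-1) 1 A B C D E) ->
  node p ->
  (forall q, q \in [:: A; B; C; D; E; lc5 1 (-1) 1 0 0 A B C D E;
     lc5 0 1 (-1) 1 0 A B C D E; lc5 0 0 1 (-1) 1 A B C D E] -> ~ prop_to q p) ->
  exists al be z : L, [/\ al != 0, be != 0,
    forall a b c d e (v := lc5 a b c d e A B C D E), F v v v =
      6%:R * (al * (a * (b + c) * (d + e)) - be * ((a + b) * (c + d) * e)
              + z * (a * e * (b + c + d))) &
    [\/ z = 0, z = be - al, z = - al | z = be]].
Proof.
move=> fr nA nB nC nD nE n6 n7 n8 np nprop.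
have [iA iB iC iD iE] := And5 (node_isotropic nA) (node_isotropic nB)
  (node_isotropic nC) (node_isotropic nD) (node_isotropic nE).
have := isotropic_rel iA iB iC iD iE (node_isotropic n6).
have := isotropic_rel iA iB iC iD iE (node_isotropic n7).
have := isotropic_rel iA iB iC iD iE (node_isotropic n8).
rewrite !(mul0r, mulr0, mul1r, mulr1, mulN1r, addr0, add0r, oppr0).
move=> [ADE BDE /eqP CDE _ _] [ACD /eqP BCD _ _ BCE] [/eqP ABC _ _ _ ABE].
move: CDE BCD ABC; rewrite !oppr_eq0 => /eqP CDE /eqP BCD /eqP ABC.
move: BDE ACD BCE; rewrite CDE BCD ABC ?oppr0 ?add0r.
move=> /eqP; rewrite subr_eq0 => /eqP BDE.
move=> /eqP; rewrite subr_eq0 => /eqP ACD _.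
(* The three given dependencies kill [ABC], [BCD] and [CDE]; the other seven coefficients depend on
   [ABD], [BCE] and [ACE]. The shift in [z] makes the cubic a difference of two products when
   [z = 0]. *)
set al := F A B D; set be := - F B C E; exists al, be.
set z := F A C E - al + be; exists z.
have ACE : F A C E = z + al - be by rewrite /z; ring.
have {}ABE : F A B E = z + al.
  by rewrite -[LHS]addr0 -ABE /z /be; ring.
have {}ADE : F A D E = z - be.
  by rewrite -[LHS]addr0 -ADE -ACD /z /be /al; ring.
have BCE : F B C E = - be by rewrite opprK.
have {}BDE : F B D E = - be by rewrite -BDE.
have {}ACD : F A C D = al by [].
have ABD : F A B D = al by [].
have al0 : al != 0.
  apply/eqP => al0; apply: (hyperplane_nonzero fr nA iB iC iD) => //.
  by rewrite ACD.
have be0 : be != 0.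
  have fr' : frame5 E B C D A.
    by apply: (frame_perm fr); apply/permP => q /=; ring.
  apply/eqP => be0; apply: (hyperplane_nonzero fr' nE iB iC iD).
  - by rewrite F12 F23 BCE be0 oppr0.
  - by rewrite F12 F23 BDE be0 oppr0.
  - by rewrite F12 F23 CDE.
split=> //.
  move=> a b c d e v; rewrite {1 2}/v polar_lc5 // /v /lc5 !trilinDr !trilinZr.
  sortF5 F12 F23 A B C D E; rewrite !isotropic_r // !iA !iB !iC !iD.
  by rewrite ABC ABD ABE ACD ACE ADE BCD BCE BDE CDE; ring.
clearbody al be z.
have [a[b[c[d[e pE]]]]] := frame_span p fr.
have := node_support (s := [:: (a, A); (b, B); (c, C); (d, D); (e, E)]) erefl fr.
rewrite !big_cons big_nil addr0 /= !addrA -[_ + _]/(lc5 a b c d e A B C D E) -pE.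
case.
- by move=> y; rewrite !inE => /or4P[|||/orP[|]] /eqP->.
- by [].
- by move=> y; rewrite !inE => /or4P[|||/orP[|]] /eqP-> _ /=; apply: nprop;
    rewrite !inE eqxx ?orbT.
- have := isotropic_total iA iB iC iD iE; move: (np); rewrite {1}pE =>
  /node_isotropic ip.
  move=> /(_ _ _ _ _ _ ip).
  (* Support three forces the coefficient of that triple to vanish. Of the ten triples, [ABC], [BCD]
     and [CDE] give back a known node, [ABD], [ACD], [BCE] and [BDE] have coefficient [al] or
     [- be], and [ADE], [ACE] and [ABE] determine [z]. *)
  rewrite ABC ABD ABE ACD ACE ADE BCD BCE BDE CDE /supp /=.
  have [a0|a0] := eqVneq a 0; have [b0|b0] := eqVneq b 0;
  have [c0|c0] := eqVneq c 0; have [d0|d0] := eqVneq d 0;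
  have [e0|e0] := eqVneq e 0 => // + _.
  + move=> _; case: (nprop (lc5 0 0 1 (-1) 1 A B C D E)); first by rewrite !inE
    eqxx ?orbT.
    have fr' : frame5 C D E A B.
      by apply: (frame_perm fr); apply/permP => q /=; ring.
    have pT : p = c *: C + d *: D + e *: E.
      by rewrite pE /lc5 a0 b0 !scale0r ?addr0 ?add0r.
    have qT : lc5 0 0 1 (-1) 1 A B C D E = 1 *: C + (-1) *: D + 1 *: E.
      by rewrite /lc5 !scale0r ?addr0 ?add0r.
    rewrite qT pT; apply: (plane_unique fr') => //; rewrite ?oner_eq0 ?oppr_eq0
      ?oner_eq0 //.
      by rewrite -pT.
    by rewrite -qT; apply: node_isotropic.
  + rewrite a0 c0 !(mul0r, mulr0, add0r, addr0) => /eqP.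
    rewrite !mulf_eq0 (negPf b0) (negPf d0) (negPf e0) /= ?oppr_eq0.
    by rewrite (negPf be0).
  + rewrite a0 d0 !(mul0r, mulr0, add0r, addr0) => /eqP.
    rewrite !mulf_eq0 (negPf b0) (negPf c0) (negPf e0) /= ?oppr_eq0.
    by rewrite (negPf be0).
  + move=> _; case: (nprop (lc5 0 1 (-1) 1 0 A B C D E)); first by rewrite !inE
    eqxx ?orbT.
    have fr' : frame5 B C D A E.
      by apply: (frame_perm fr); apply/permP => q /=; ring.
    have pT : p = b *: B + c *: C + d *: D.
      by rewrite pE /lc5 a0 e0 !scale0r ?addr0 ?add0r.
    have qT : lc5 0 1 (-1) 1 0 A B C D E = 1 *: B + (-1) *: C + 1 *: D.
      by rewrite /lc5 !scale0r ?addr0 ?add0r.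
    rewrite qT pT; apply: (plane_unique fr') => //; rewrite ?oner_eq0 ?oppr_eq0
      ?oner_eq0 //.
      by rewrite -pT.
    by rewrite -qT; apply: node_isotropic.
  + rewrite b0 c0 !(mul0r, mulr0, add0r, addr0) => /eqP.
    rewrite !mulf_eq0 (negPf a0) (negPf d0) (negPf e0) /= ?oppr_eq0.
    by rewrite subr_eq0 => /eqP ->; constructor 4.
  + rewrite b0 d0 !(mul0r, mulr0, add0r, addr0) => /eqP.
    rewrite !mulf_eq0 (negPf a0) (negPf c0) (negPf e0) /= ?oppr_eq0.
    by rewrite -addrA addr_eq0 opprB => /eqP ->; constructor 2.
  + rewrite b0 e0 !(mul0r, mulr0, add0r, addr0) => /eqP.
    rewrite !mulf_eq0 (negPf a0) (negPf c0) (negPf d0) /= ?oppr_eq0.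
    by rewrite (negPf al0).
  + rewrite c0 d0 !(mul0r, mulr0, add0r, addr0) => /eqP.
    rewrite !mulf_eq0 (negPf a0) (negPf b0) (negPf e0) /= ?oppr_eq0.
    by rewrite addr_eq0 => /eqP ->; constructor 3.
  + rewrite c0 e0 !(mul0r, mulr0, add0r, addr0) => /eqP.
    rewrite !mulf_eq0 (negPf a0) (negPf b0) (negPf d0) /= ?oppr_eq0.
    by rewrite (negPf al0).
  + move=> _; case: (nprop (lc5 1 (-1) 1 0 0 A B C D E)); first by rewrite !inE
    eqxx ?orbT.
    have fr' : frame5 A B C D E.
      by apply: (frame_perm fr); apply/permP => q /=; ring.
    have pT : p = a *: A + b *: B + c *: C.
      by rewrite pE /lc5 d0 e0 !scale0r ?addr0 ?add0r.
    have qT : lc5 1 (-1) 1 0 0 A B C D E = 1 *: A + (-1) *: B + 1 *: C.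
      by rewrite /lc5 !scale0r ?addr0 ?add0r.
    rewrite qT pT; apply: (plane_unique fr') => //; rewrite ?oner_eq0 ?oppr_eq0
      ?oner_eq0 //.
      by rewrite -pT.
    by rewrite -qT; apply: node_isotropic.
- have := isotropic_total iA iB iC iD iE; have := isotropic_rel iA iB iC iD iE.
  move: (np); rewrite {1}pE => /node_isotropic ip /(_ _ _ _ _ _ ip).
  move=> + /(_ _ _ _ _ _ ip).
  rewrite ABC ABD ABE ACD ACE ADE BCD BCE BDE CDE /supp /=.
  have [a0|a0] := eqVneq a 0; have [b0|b0] := eqVneq b 0;
  have [c0|c0] := eqVneq c 0; have [d0|d0] := eqVneq d 0;
  have [e0|e0] := eqVneq e 0 => //; rewrite !(mulr0, addr0, add0r).
  move=> -[E1 E2 E3 E4 E5] S _.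
  (* Each combination of a derivative with the value [S] factors. Together they give [b = d = - c]
     and [a = e = c], so the node is a multiple of [A - B + C - D + E]; the derivative along [C]
     then leaves [z = 0]. *)
  have /eqP : b * e * be * (c + d) = 0.
    transitivity (a * 0 - 0 : L); last by ring.
    by rewrite -{1}E1 -S; ring.
  rewrite !mulf_eq0 (negPf b0) (negPf e0) (negPf be0) addrC addr_eq0 /= => /eqP dE.
  have /eqP : a * d * al * (b + c) = 0.
    transitivity (0 - e * 0 : L); last by ring.
    by rewrite -{1}S -E5; ring.
  rewrite !mulf_eq0 (negPf a0) (negPf d0) (negPf al0) addr_eq0 /= => /eqP bE.
  subst b d.
  have /eqP : a * c * al * (e - c) = 0.
    transitivity (0 - (- c) * 0 : L); last by ring.
    by rewrite -{1}S -E2; ring.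
  rewrite !mulf_eq0 (negPf a0) (negPf c0) (negPf al0) subr_eq0 /= => /eqP eE.
  have /eqP : c * e * be * (c - a) = 0.
    transitivity (0 - (- c) * 0 : L); last by ring.
    by rewrite -{1}S -E4; ring.
  rewrite !mulf_eq0 (negPf c0) (negPf e0) (negPf be0) subr_eq0 /= => /eqP aE.
  subst e; rewrite -aE in S E3.
  have /eqP : 2%:R * c ^+ 3 * z = 0.
    transitivity (c * 0 - 0 : L); last by ring.
    by rewrite -{1}E3 -S; ring.
  rewrite !mulf_eq0 (negPf nz2) (negPf c0) /= => /eqP ->.
  by constructor 1.
Qed.

(** The normal form reached by [path_form]. The four values of [z] are kept apart because the cubic
    splits into products of different linear forms in each case. *)
Definition product_frame := exists A B C D E al be z,
  [/\ frame5 A B C D E, al != 0, be != 0,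
    forall a b c d e (v := lc5 a b c d e A B C D E), F v v v =
      6%:R * (al * (a * (b + c) * (d + e)) - be * ((a + b) * (c + d) * e)
              + z * (a * e * (b + c + d))) &
    [\/ z = 0, z = be - al, z = - al | z = be]].

(* If this failed, eliminating x2 would give a dependency between five nodes. *)
Lemma concurrent x1 x2 x3 x4 x5 t1 t2 t3 u1 u2 u4 :
  frame5 x1 x2 x3 x4 x5 -> node x1 -> isotropic x3 -> isotropic x4 ->
  t1 != 0 -> t2 != 0 -> t3 != 0 -> u1 != 0 -> u2 != 0 -> u4 != 0 ->
  isotropic (lc5 t1 t2 t3 0 0 x1 x2 x3 x4 x5) ->
  isotropic (lc5 u1 u2 0 u4 0 x1 x2 x3 x4 x5) -> t1 * u2 = t2 * u1.
Proof.
move=> fr n1 i3 i4 t10 t20 t30 u10 u20 u40 ip iq.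
set p := lc5 t1 _ _ _ _ _ _ _ _ _ in ip.
have fr' : frame5 x1 p x3 x4 x5.
  have fr2 : frame5 x2 x1 x3 x4 x5.
    by apply: (frame_perm fr); apply/permP => q /=; ring.
  apply: (frame_perm (frame_exchange t1 t3 0 0 fr2 t20)).
  rewrite (_ : lc5 t2 _ _ _ _ _ _ _ _ _ = p); last by rewrite /p /lc5 (addrC (t2 *:
    _)).
  by apply/permP => q /=; ring.
apply/eqP; rewrite -subr_eq0; apply/negP => /negP n0.
have [] // := @no_four_support x1 p x3 x4 x5 (u1 - u2 * t1 / t2) (u2 / t2)
  (- u2 * t3 / t2) u4 fr' n1 ip i3 i4 _ _ _ u40.
- apply: contraNneq n0 => E; apply/eqP.
  rewrite -(mulr0 (- t2)) -E; field; exact: t20.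
- by rewrite mulf_neq0 ?invr_eq0.
- by rewrite !mulf_neq0 ?invr_eq0 ?oppr_eq0.
suff -> : (u1 - u2 * t1 / t2) *: x1 + u2 / t2 *: p + - u2 * t3 / t2 *: x3 + u4 *: x4
  = lc5 u1 u2 0 u4 0 x1 x2 x3 x4 x5 by [].
have E1 a : a *: x1 = lc5 a 0 0 0 0 x1 x2 x3 x4 x5 by rewrite /lc5 !scale0r !addr0.
have E3 a : a *: x3 = lc5 0 0 a 0 0 x1 x2 x3 x4 x5.
  by rewrite /lc5 !scale0r !addr0 !add0r.
have E4 a : a *: x4 = lc5 0 0 0 a 0 x1 x2 x3 x4 x5.
  by rewrite /lc5 !scale0r !addr0 !add0r.
by rewrite E1 E3 E4 /p !lc5Z !lc5D; congr lc5; field.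
Qed.

(** Rescaling the frame makes all coefficients of the three dependencies equal to 1 or -1. The first
    fixes the scales of [A], [B], [C], the second that of [D] and the third that of [E]; the two
    overlaps [B], [C] and [C], [D] are consistent by [concurrent]. *)
Lemma path_product A B C D E a1 b1 c1 b2 c2 d2 c3 d3 e3 p :
  frame5 A B C D E -> node A -> node B -> node C -> node D -> node E ->
  a1 != 0 -> b1 != 0 -> c1 != 0 -> b2 != 0 -> c2 != 0 -> d2 != 0 ->
  c3 != 0 -> d3 != 0 -> e3 != 0 ->
  node (lc5 a1 b1 c1 0 0 A B C D E) -> node (lc5 0 b2 c2 d2 0 A B C D E) ->
  node (lc5 0 0 c3 d3 e3 A B C D E) -> node p ->
  (forall q, q \in [:: A; B; C; D; E; lc5 a1 b1 c1 0 0 A B C D E;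
     lc5 0 b2 c2 d2 0 A B C D E; lc5 0 0 c3 d3 e3 A B C D E] -> ~ prop_to q p) ->
  product_frame.
Proof.
move=> fr nA nB nC nD nE a10 b10 c10 b20 c20 d20 c30 d30 e30 n6 n7 n8 np nprop.
have bc : b1 * c2 = c1 * b2.
  have fr' : frame5 B C A D E.
    by apply: (frame_perm fr); apply/permP => q /=; ring.
  apply: (concurrent (t3 := a1) (u4 := d2) fr' nB) => //; try exact: node_isotropic.
    have <- : lc5 a1 b1 c1 0 0 A B C D E = lc5 b1 c1 a1 0 0 B C A D E.
      by rewrite /lc5 -(addrA (a1 *: A)) (addrC (a1 *: A)).
    exact: node_isotropic.
  have <- : lc5 0 b2 c2 d2 0 A B C D E = lc5 b2 c2 0 d2 0 B C A D E.
    by rewrite /lc5 !scale0r add0r !addr0.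
  exact: node_isotropic.
have cd : c2 * d3 = d2 * c3.
  have fr' : frame5 C D B E A.
    by apply: (frame_perm fr); apply/permP => q /=; ring.
  apply: (concurrent (t3 := b2) (u4 := e3) fr' nC) => //; try exact: node_isotropic.
    have <- : lc5 0 b2 c2 d2 0 A B C D E = lc5 c2 d2 b2 0 0 C D B E A.
      by rewrite /lc5 !scale0r add0r !addr0 -(addrA (b2 *: B)) (addrC (b2 *: B)).
    exact: node_isotropic.
  have <- : lc5 0 0 c3 d3 e3 A B C D E = lc5 c3 d3 0 e3 0 C D B E A.
    by rewrite /lc5 !scale0r !add0r !addr0.
  exact: node_isotropic.
pose d' := - (b1 * d2 / b2); pose e' := c1 * e3 / c3.
have d'0 : d' != 0 by rewrite oppr_eq0 !mulf_neq0 ?invr_eq0.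
have e'0 : e' != 0 by rewrite !mulf_neq0 ?invr_eq0.
have b10' : - b1 != 0 by rewrite oppr_eq0.
have mu0 : - (b1 / b2) != 0 by rewrite oppr_eq0 mulf_neq0 ?invr_eq0.
have nu0 : c1 / c3 != 0 by rewrite mulf_neq0 ?invr_eq0.
pose A' := a1 *: A; pose B' := (- b1) *: B; pose C' := c1 *: C.
pose D' := d' *: D; pose E' := e' *: E.
have lcE u1 u2 u3 u4 u5 : lc5 u1 u2 u3 u4 u5 A' B' C' D' E' =
  lc5 (u1 * a1) (u2 * - b1) (u3 * c1) (u4 * d') (u5 * e') A B C D E.
  by rewrite /lc5 /A' /B' /C' /D' /E' !scalerA.
have p6E : lc5 1 (-1) 1 0 0 A' B' C' D' E' = 1 *: lc5 a1 b1 c1 0 0 A B C D E.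
  by rewrite lcE lc5Z; congr lc5; ring.
have p7E : lc5 0 1 (-1) 1 0 A' B' C' D' E' =
    (- (b1 / b2)) *: lc5 0 b2 c2 d2 0 A B C D E.
  rewrite lcE lc5Z; congr lc5; rewrite ?mul0r ?mulr0 // ?mul1r.
  - by field.
  - by rewrite mulN1r mulNr; congr (- _); rewrite mulrAC bc; field.
  - by rewrite /d'; field.
have p8E : lc5 0 0 1 (-1) 1 A' B' C' D' E' = (c1 / c3) *: lc5 0 0 c3 d3 e3 A B C D
  E.
  rewrite lcE lc5Z; congr lc5; rewrite ?mul0r ?mulr0 // ?mul1r.
  - by field.
  - rewrite mulN1r opprK; apply: (mulfI (mulf_neq0 (mulf_neq0 b20 c30) c20)).
    transitivity ((b1 * c2) * (d2 * c3)); first by field.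
    by rewrite bc -cd; field.
  - by rewrite /e'; field.
clearbody d' e'.
have fr' : frame5 A' B' C' D' E'.
  apply: frame_of_indep => t1 t2 t3 t4 t5; rewrite lcE => /(frame_indep fr)[].
  move=> /eqP + /eqP + /eqP + /eqP + /eqP.
  by rewrite !mulf_eq0 (negPf a10) (negPf b10') (negPf c10) (negPf d'0) (negPf e'0)
    !orbF => /eqP-> /eqP-> /eqP-> /eqP-> /eqP->.
have [] // := path_form fr' (nodeZ a10 nA) (nodeZ b10' nB) (nodeZ c10 nC)
  (nodeZ d'0 nD) (nodeZ e'0 nE) _ _ _ np _.
- by rewrite p6E; apply: nodeZ; rewrite ?oner_eq0.
- by rewrite p7E; apply: nodeZ.
- by rewrite p8E; apply: nodeZ.
- move=> q; rewrite p6E p7E p8E !inE.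
  case/or4P => [|||/or4P[|||/orP[]]] /eqP->; rewrite prop_toZl ?oner_eq0 //;
    apply: nprop; by rewrite !inE eqxx ?orbT.
by move=> al [be [z [? ? ? ?]]]; exists A', B', C', D', E', al, be, z.
Qed.

(** * Arrangements of the supports of nodes in a frame *)

Lemma pattern_witness (t : nat -> nat -> L) Ps :
  has_pattern [seq [seq t j i != 0 | i <- iota 0 5] | j <- iota 0 3] Ps ->
  exists P o q, [/\ P \in Ps, perm_eq o (iota 0 5), perm_eq q (iota 0 3) &
    forall j i, (j < size P)%N -> (i < 5)%N ->
      (t (nth 0%N q j) (nth 0%N o i) != 0) = (i \in nth [::] P j)].
Proof.
rewrite /has_pattern someE => /hasP[P PPs]; rewrite someE => /hasP[o].
rewrite mem_permutations => po; rewrite someE => /hasP[q].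
rewrite mem_permutations => pq M; exists P, o, q; split=> // j i jP i5.
rewrite -(matchesP M jP i5).
have lt (s : seq nat) n k : (0 < n)%N -> perm_eq s (iota 0 n) -> (nth 0%N s k <
  n)%N.
  move=> n0 ps; have [ks|ks] := ltnP k (size s); last by rewrite nth_default.
  by have := mem_nth 0%N ks; rewrite (perm_mem ps) mem_iota.
rewrite (nth_map 0%N) ?size_iota ?lt // (nth_map 0%N) ?size_iota ?lt //.
by rewrite !nth_iota ?lt.
Qed.

Lemma mem_masks (t : nat -> L) : count (fun i => t i != 0) (iota 0 5) = 3%N ->
  [seq t i != 0 | i <- iota 0 5] \in masks 5 3.
Proof.
rewrite /=; case: (t 0%N != 0); case: (t 1%N != 0); case: (t 2%N != 0);
by case: (t 3%N != 0); case: (t 4%N != 0).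
Qed.

Lemma mem_masks4 (t : nat -> L) : count (fun i => t i != 0) (iota 0 5) = 3%N ->
  t 4%N = 0 ->
  [seq t i != 0 | i <- iota 0 5] \in map (rcons^~ false) (masks 4 3).
Proof.
move=> + t4; rewrite /= t4 eqxx /=; case: (t 0%N != 0); case: (t 1%N != 0);
by case: (t 2%N != 0); case: (t 3%N != 0).
Qed.

(** Indexing by [nat] lets a permutation list act on coordinates and vectors by composition. *)
Definition lcn (t : nat -> L) (x : nat -> V) :=
  lc5 (t 0%N) (t 1%N) (t 2%N) (t 3%N) (t 4%N) (x 0%N) (x 1%N) (x 2%N) (x 3%N) (x
    4%N).

Definition frame (x : nat -> V) := frame5 (x 0%N) (x 1%N) (x 2%N) (x 3%N) (x 4%N).

Lemma lcn_perm o t x : perm_eq o (iota 0 5) ->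
  lcn (t \o nth 0%N o) (x \o nth 0%N o) = lcn t x.
Proof.
move=> po; have lcnE u y : lcn u y = \sum_(i <- iota 0 5) u i *: y i.
  by rewrite !big_cons big_nil /= addr0 /lcn /lc5 !addrA.
transitivity (\sum_(k <- o) t k *: x k); last by rewrite lcnE; apply: perm_big.
rewrite lcnE -{3}(take_size o) -(map_nth_iota0 0%N (leqnn (size o))) big_map.
by rewrite (perm_size po).
Qed.

Lemma frame_perm_nat o x : perm_eq o (iota 0 5) -> frame x -> frame (x \o nth 0%N
  o).
Proof.
move=> po fr; apply: (frame_perm fr).
change (perm_eq (map x (map (nth 0%N o) (iota 0 5))) (map x (iota 0 5))).
have -> : iota 0 5 = iota 0 (size o) by rewrite (perm_size po).
by rewrite map_nth_iota0 ?take_size ?(perm_size po) // perm_map.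
Qed.

Definition lcE5 := (scale0r, add0r, addr0).

(** Each arrangement of three supports either contradicts the properties of a node or gives eight
    nodes placed as in [path_product], with [y] as the ninth. *)
Lemma product_of_supports (x : nat -> V) (t : nat -> nat -> L) (y : V) :
  frame x -> (forall i, (i < 5)%N -> node (x i)) ->
  (forall j, (j < 3)%N -> node (lcn (t j) x)) ->
  (forall j k, (j < 3)%N -> (k < 3)%N -> j != k ->
     ~ prop_to (lcn (t j) x) (lcn (t k) x)) ->
  (forall j, (j < 3)%N -> count (fun i => t j i != 0) (iota 0 5) = 3%N) ->
  node y -> (forall i, (i < 5)%N -> ~ prop_to (x i) y) ->
  (forall j, (j < 3)%N -> ~ prop_to (lcn (t j) x) y) -> product_frame.
Proof.
move=> fr nx np dp sp ny dxy dpy.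
have /pattern_witness[P [o [q [PPs po pq M]]]] :
    has_pattern [seq [seq t j i != 0 | i <- iota 0 5] | j <- iota 0 3]
     [:: same_triple; path_pattern; path_edge_pattern; common_pair;
       common_hyperplane].
  move/allP: three_triples => /(_ _ (mem_masks (sp 0%N isT))).
  by move=> /allP/(_ _ (mem_masks (sp 1%N isT)))/allP/(_ _ (mem_masks (sp 2%N
    isT))).
have lt n (s : seq nat) : perm_eq s (iota 0 n) -> forall k, (k < n)%N -> (nth 0%N s
  k < n)%N.
  move=> ps k kn; have : nth 0%N s k \in s.
    by apply: mem_nth; rewrite (perm_size ps) size_iota.
  by rewrite (perm_mem ps) mem_iota.
have {lt} [lo lq] := (lt _ _ po, lt _ _ pq).
have uq j k : (j < 3)%N -> (k < 3)%N -> j != k -> nth 0%N q j != nth 0%N q k.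
  move=> j3 k3; rewrite nth_uniq ?(perm_size pq) ?size_iota //.
  by rewrite (perm_uniq pq) iota_uniq.
pose X := x \o nth 0%N o; pose T j := t (nth 0%N q j) \o nth 0%N o.
have pE j : lcn (T j) X = lcn (t (nth 0%N q j)) x by rewrite /T /X lcn_perm.
have {fr} frX : frame X by apply: frame_perm_nat.
have nX i : (i < 5)%N -> node (X i) by move=> /lo; apply: nx.
have dXy i : (i < 5)%N -> ~ prop_to (X i) y by move=> /lo; apply: dxy.
have {np} nP j : (j < 3)%N -> node (lcn (T j) X) by rewrite pE => /lq; apply: np.
have {dpy} dPy j : (j < 3)%N -> ~ prop_to (lcn (T j) X) y.
  by rewrite pE => /lq; apply: dpy.
have {dp} dP j k : (j < 3)%N -> (k < 3)%N -> j != k ->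
    ~ prop_to (lcn (T j) X) (lcn (T k) X).
  by rewrite !pE => j3 k3 jk; apply: dp; [exact: lq|exact: lq|exact: uq].
have {M} M j i : (j < size P)%N -> (i < 5)%N -> (T j i != 0) = (i \in nth [::] P j).
  exact: M.
clearbody X T; clear t x nx sp dxy uq lo lq pE po pq.
have iX i : (i < 5)%N -> isotropic (X i) by move=> /nX/node_isotropic.
have total j : (j < 3)%N -> _ := fun j3 => isotropic_total (iX 0%N isT) (iX 1%N isT)
  (iX 2%N isT) (iX 3%N isT) (iX 4%N isT) (node_isotropic (nP j j3)).
have N j i (jP : (j < size P)%N) (i5 : (i < 5)%N) : i \in nth [::] P j -> T j i !=
  0.
  by rewrite M.
have Z j i (jP : (j < size P)%N) (i5 : (i < 5)%N) : i \notin nth [::] P j -> T j i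
  = 0.
  by rewrite -M // negbK => /eqP.
move: PPs; rewrite !inE => /or4P[|||/orP[]] /eqP PE; rewrite {P M}PE in N Z.
- case: (dP 1%N 0%N) => //.
  have E j : (j < 2)%N -> lcn (T j) X =
      T j 0%N *: X 0%N + T j 1%N *: X 1%N + T j 2%N *: X 2%N.
    by case: j => [|[|//]] _; rewrite /lcn /lc5 (Z _ 3) // (Z _ 4) // !lcE5.
  have iE j : (j < 2)%N -> isotropic (lcn (T j) X).
    by move=> j2; apply/node_isotropic/nP; apply: leq_trans j2 _.
  have nE := nP 0%N isT; have := iE 1%N isT; move: nE; rewrite !E // => n0 i1.
  by apply: (plane_unique frX _ _ _ _ _ _ _ _ _ n0 i1); first [exact: iX | exact:
    N].
- have e0 : lc5 (T 0 0) (T 0 1) (T 0 2) 0 0 (X 0) (X 1) (X 2) (X 3) (X 4) = lcn (T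
  0) X.
    by rewrite /lcn (Z 0 3) // (Z 0 4).
  have e1 : lc5 0 (T 1 1) (T 1 2) (T 1 3) 0 (X 0) (X 1) (X 2) (X 3) (X 4) = lcn (T
    1) X.
    by rewrite /lcn (Z 1 0) // (Z 1 4).
  have e2 : lc5 0 0 (T 2 2) (T 2 3) (T 2 4) (X 0) (X 1) (X 2) (X 3) (X 4) = lcn (T
    2) X.
    by rewrite /lcn (Z 2 0) // (Z 2 1).
  move: (nP 0 isT) (nP 1 isT) (nP 2 isT) (dPy 0 isT) (dPy 1 isT) (dPy 2 isT).
  rewrite -e0 -e1 -e2 => n0 n1 n2 d0 d1 d2.
  apply: (path_product frX (nX 0 isT) (nX 1 isT) (nX 2 isT) (nX 3 isT) (nX 4 isT)
    _ _ _ _ _ _ _ _ _ n0 n1 n2 ny); try exact: N.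
  by move=> z; rewrite !inE => /or4P[|||/or4P[|||/orP[]]] /eqP-> //; apply: dXy.
(* Exchanging [X 4] for the node [p0] gives the frame [X 3], [p0], [X 2], [X 0], [X 1]. By
   [concurrent] the coefficient of [X 3] in [p1] vanishes there, so [X 4], [p1] and [p2] have three
   consecutive supports, as in [path_pattern]. *)
- have := nP 0 isT; have := nP 1 isT; have := nP 2 isT.
  have := dPy 0 isT; have := dPy 1 isT; have := dPy 2 isT.
  set p0 := lcn (T 0) X; set p1 := lcn (T 1) X; set p2 := lcn (T 2) X.
  move=> d2 d1 d0 n2 n1 n0.
  have N02 : T 0 2 != 0 by apply: N.
  have N03 : T 0 3 != 0 by apply: N.
  have N04 : T 0 4 != 0 by apply: N.
  have N10 : T 1 0 != 0 by apply: N.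
  have N13 : T 1 3 != 0 by apply: N.
  have N14 : T 1 4 != 0 by apply: N.
  have E1 : p1 = lc5 (T 1 0) 0 0 (T 1 3) (T 1 4) (X 0) (X 1) (X 2) (X 3) (X 4).
    by rewrite /p1 /lcn (Z 1 1) // (Z 1 2).
  have E0 : p0 = lc5 0 0 (T 0 2) (T 0 3) (T 0 4) (X 0) (X 1) (X 2) (X 3) (X 4).
    by rewrite /p0 /lcn (Z 0 0) // (Z 0 1).
  have conc : T 0 3 * T 1 4 = T 0 4 * T 1 3.
    have fr' : frame5 (X 3) (X 4) (X 2) (X 0) (X 1).
      by apply: (frame_perm frX); apply/permP => z /=; ring.
    apply: (concurrent (t3 := T 0 2) (u4 := T 1 0) fr' (nX 3 isT) (iX 2 isT) (iX 0
      isT)) => //.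
      have <- : p0 = lc5 (T 0 3) (T 0 4) (T 0 2) 0 0 (X 3) (X 4) (X 2) (X 0) (X 1).
        by rewrite E0 /lc5 !lcE5 -addrA addrC.
      exact: node_isotropic.
    have <- : p1 = lc5 (T 1 3) (T 1 4) 0 (T 1 0) 0 (X 3) (X 4) (X 2) (X 0) (X 1).
      by rewrite E1 /lc5 !lcE5 -addrA addrC.
    exact: node_isotropic.
  have fr' : frame5 (X 3) p0 (X 2) (X 0) (X 1).
    have fr2 : frame5 (X 4) (X 3) (X 2) (X 0) (X 1).
      by apply: (frame_perm frX); apply/permP => z /=; ring.
    apply: (frame_perm (frame_exchange (T 0 3) (T 0 2) 0 0 fr2 N04)).
    have -> : lc5 (T 0 4) (T 0 3) (T 0 2) 0 0 (X 4) (X 3) (X 2) (X 0) (X 1) = p0.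
      by rewrite E0 /lc5 !lcE5 addrC (addrC (_ *: X 4)) addrA.
    by apply/permP => z /=; ring.
  have X4E : lc5 (- (T 0 3 / T 0 4)) (T 0 4)^-1 (- (T 0 2 / T 0 4)) 0 0
      (X 3) p0 (X 2) (X 0) (X 1) = X 4.
    rewrite [RHS](lc5_5 (X 0) (X 1) (X 2) (X 3)) {1}/lc5 !lcE5.
    have -> : - (T 0 3 / T 0 4) *: X 3 = lc5 0 0 0 (- (T 0 3 / T 0 4)) 0
       (X 0) (X 1) (X 2) (X 3) (X 4) by rewrite /lc5 !lcE5.
    have -> : (- (T 0 2 / T 0 4)) *: X 2 = lc5 0 0 (- (T 0 2 / T 0 4)) 0 0
       (X 0) (X 1) (X 2) (X 3) (X 4) by rewrite /lc5 !lcE5.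
    by rewrite E0 lc5Z !lc5D; congr lc5; field.
  have p1E : lc5 0 (T 1 4 / T 0 4) (- (T 1 4 * T 0 2 / T 0 4)) (T 1 0) 0
      (X 3) p0 (X 2) (X 0) (X 1) = p1.
    rewrite E1 {1}/lc5 !lcE5.
    have -> a : a *: X 2 = lc5 0 0 a 0 0 (X 0) (X 1) (X 2) (X 3) (X 4).
      by rewrite /lc5 !lcE5.
    have -> : T 1 0 *: X 0 = lc5 (T 1 0) 0 0 0 0 (X 0) (X 1) (X 2) (X 3) (X 4).
      by rewrite /lc5 !lcE5.
    rewrite E0 lc5Z !lc5D; congr lc5; try by field.
    by apply: (mulfI N04); rewrite -conc; field.
  have p2E : lc5 0 0 (T 2 2) (T 2 0) (T 2 1) (X 3) p0 (X 2) (X 0) (X 1) = p2.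
    by rewrite /p2 /lcn (Z 2 3) // (Z 2 4) // /lc5 !lcE5 -addrA addrC.
  apply: (path_product (p := y) (a1 := - (T 0 3 / T 0 4)) (b1 := (T 0 4)^-1)
    (c1 := - (T 0 2 / T 0 4)) (b2 := T 1 4 / T 0 4) (c2 := - (T 1 4 * T 0 2 / T 0
      4))
    (d2 := T 1 0) (c3 := T 2 2) (d3 := T 2 0) (e3 := T 2 1)
    fr' (nX 3 isT) n0 (nX 2 isT) (nX 0 isT) (nX 1 isT));
  rewrite ?X4E ?p1E ?p2E ?oppr_eq0 ?mulf_neq0 ?invr_eq0 //; try exact: N; try
    exact: nX.
  by move=> z; rewrite !inE => /or4P[|||/or4P[|||/orP[]]] /eqP-> //; apply: dXy.
(* The triples through the pair 0, 1 make [F (X 0) (X 1)] vanish on the whole frame, so [X 1] would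
   lie on the line of [X 0]. *)
- have F012 : F (X 0%N) (X 1%N) (X 2%N) = 0.
    have := total 0%N isT; rewrite (Z 0 3) // (Z 0 4) // !(mul0r, mulr0, add0r,
      addr0) => /eqP.
    by rewrite !mulf_eq0 !(negPf (N _ _ _ _ _)) // => /eqP.
  have F013 : F (X 0%N) (X 1%N) (X 3%N) = 0.
    have := total 1%N isT; rewrite (Z 1 2) // (Z 1 4) // !(mul0r, mulr0, add0r,
      addr0) => /eqP.
    by rewrite !mulf_eq0 !(negPf (N _ _ _ _ _)) // => /eqP.
  have F014 : F (X 0%N) (X 1%N) (X 4%N) = 0.
    have := total 2%N isT; rewrite (Z 2 2) // (Z 2 3) // !(mul0r, mulr0, add0r,
      addr0) => /eqP.
    by rewrite !mulf_eq0 !(negPf (N _ _ _ _ _)) // => /eqP.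
  case: (frame_nprop frX); have [_ i0 k0] := nX 0 isT; apply: k0 => v.
  have [v0 [v1 [v2 [v3 [v4 ->]]]]] := frame_span v frX.
  rewrite /lc5 !trilinDr !trilinZr F012 F013 F014 F23 i0 F12 F23 iX //.
  by rewrite !mulr0 !addr0.
- have F012 : F (X 0%N) (X 1%N) (X 2%N) = 0.
    have := total 0%N isT; rewrite (Z 0 3) // (Z 0 4) // !(mul0r, mulr0, add0r,
      addr0) => /eqP.
    by rewrite !mulf_eq0 !(negPf (N _ _ _ _ _)) // => /eqP.
  have F013 : F (X 0%N) (X 1%N) (X 3%N) = 0.
    have := total 1%N isT; rewrite (Z 1 2) // (Z 1 4) // !(mul0r, mulr0, add0r,
      addr0) => /eqP.
    by rewrite !mulf_eq0 !(negPf (N _ _ _ _ _)) // => /eqP.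
  have F023 : F (X 0%N) (X 2%N) (X 3%N) = 0.
    have := total 2%N isT; rewrite (Z 2 1) // (Z 2 4) // !(mul0r, mulr0, add0r,
      addr0) => /eqP.
    by rewrite !mulf_eq0 !(negPf (N _ _ _ _ _)) // => /eqP.
  by case: (hyperplane_nonzero frX (nX 0 isT) (iX 1 isT) (iX 2 isT) (iX 3 isT)).
Qed.

(** Three further nodes on distinct triples of [x 0], ..., [x 3] kill the three coefficients through
    a common node, against [hyperplane_nonzero]. The vector [x 4] only completes the basis and may
    fail to be a node. *)
Lemma no_three_in_hyperplane (x : nat -> V) (t : nat -> nat -> L) :
  frame x -> (forall i, (i < 4)%N -> node (x i)) ->
  (forall j, (j < 3)%N -> node (lcn (t j) x)) ->
  (forall j k, (j < 3)%N -> (k < 3)%N -> j != k ->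
     ~ prop_to (lcn (t j) x) (lcn (t k) x)) ->
  (forall j, (j < 3)%N -> count (fun i => t j i != 0) (iota 0 5) = 3%N) ->
  (forall j, (j < 3)%N -> t j 4 = 0) -> False.
Proof.
move=> fr nx np dp sp t4.
have /pattern_witness[P [o [q [PPs po pq M]]]] :
    has_pattern [seq [seq t j i != 0 | i <- iota 0 5] | j <- iota 0 3]
     [:: same_triple; common_hyperplane].
  move/allP: three_triples_in_hyperplane.
  move=> /(_ _ (mem_masks4 (sp 0 isT) (t4 0 isT))).
  move=> /allP/(_ _ (mem_masks4 (sp 1 isT) (t4 1 isT))).
  by move=> /allP/(_ _ (mem_masks4 (sp 2 isT) (t4 2 isT))).
have lt n (s : seq nat) : perm_eq s (iota 0 n) -> forall k, (k < n)%N -> (nth 0%N s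
  k < n)%N.
  move=> ps k kn; have : nth 0%N s k \in s.
    by apply: mem_nth; rewrite (perm_size ps) size_iota.
  by rewrite (perm_mem ps) mem_iota.
have {lt} [lo lq] := (lt _ _ po, lt _ _ pq).
have q10 : nth 0%N q 1 != nth 0%N q 0.
  by rewrite nth_uniq ?(perm_size pq) ?size_iota // (perm_uniq pq) iota_uniq.
pose X := x \o nth 0%N o; pose T j := t (nth 0%N q j) \o nth 0%N o.
have pE j : lcn (T j) X = lcn (t (nth 0%N q j)) x by rewrite /T /X lcn_perm.
have frX : frame X by apply: frame_perm_nat.
have nP j : (j < 3)%N -> node (lcn (T j) X) by rewrite pE => /lq; apply: np.
have nX j i : (j < size P)%N -> (j < 3)%N -> (i < 5)%N -> i \in nth [::] P j ->
  node (X i).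
  move=> jP j3 i5; rewrite -M // => tn0; apply: nx; have := lo i i5.
  rewrite ltnS leq_eqVlt => /orP[/eqP E|//].
  by move: tn0; rewrite E t4 ?eqxx // lq.
have N j i : (j < size P)%N -> (i < 5)%N -> i \in nth [::] P j -> T j i != 0.
  by move=> jP i5; rewrite -M.
have Z j i : (j < size P)%N -> (i < 5)%N -> i \notin nth [::] P j -> T j i = 0.
  by move=> jP i5; rewrite -M // negbK => /eqP.
have d10 : ~ prop_to (lcn (T 1) X) (lcn (T 0) X).
  by rewrite !pE; apply: dp => //; apply: lq.
move: PPs; rewrite !inE => /orP[] /eqP PE; rewrite {M P}PE in N Z nX.
- apply: d10.
  have E j : (j < 2)%N -> lcn (T j) X = T j 0 *: X 0 + T j 1 *: X 1 + T j 2 *: X 2.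
    by case: j => [|[|//]] _; rewrite /lcn /lc5 (Z _ 3) // (Z _ 4) // !lcE5.
  have iE j : (j < 2)%N -> isotropic (lcn (T j) X).
    by move=> j2; apply/node_isotropic/nP; apply: leq_trans j2 _.
  have nE := nP 0 isT; have := iE 1 isT; move: nE; rewrite !E // => n0 i1.
  have i0' := node_isotropic (nX 0 0 isT isT isT isT).
  have i1' := node_isotropic (nX 0 1 isT isT isT isT).
  have i2' := node_isotropic (nX 0 2 isT isT isT isT).
  by apply: (plane_unique frX i0' i1' i2' _ _ _ _ _ _ n0 i1); exact: N.
- have i0 := node_isotropic (nX 0 0 isT isT isT isT).
  have i1 := node_isotropic (nX 0 1 isT isT isT isT).
  have i2 := node_isotropic (nX 0 2 isT isT isT isT).
  have i3 := node_isotropic (nX 1 3 isT isT isT isT).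
  have F012 : F (X 0) (X 1) (X 2) = 0.
    have := node_isotropic (nP 0 isT); rewrite /lcn /lc5 (Z 0 3) // (Z 0 4) //
      !lcE5.
    by apply: plane_zero => //; exact: N.
  have F013 : F (X 0) (X 1) (X 3) = 0.
    have := node_isotropic (nP 1 isT); rewrite /lcn /lc5 (Z 1 2) // (Z 1 4) //
      !lcE5.
    by apply: plane_zero => //; exact: N.
  have F023 : F (X 0) (X 2) (X 3) = 0.
    have := node_isotropic (nP 2 isT); rewrite /lcn /lc5 (Z 2 1) // (Z 2 4) //
      !lcE5.
    by apply: plane_zero => //; exact: N.
  by apply: (hyperplane_nonzero frX) => //; exact: (nX 0).
Qed.

Lemma frame_span_nat x v : frame x -> exists t, v = lcn t x.
Proof.
move=> /(frame_span v)[t1 [t2 [t3 [t4 [t5 ->]]]]].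
by exists (nth 0 [:: t1; t2; t3; t4; t5]).
Qed.

Lemma node_support_nat (x : nat -> V) t : frame x ->
  (forall i, (i < 5)%N -> t i != 0 -> node (x i)) -> node (lcn t x) ->
  (forall i, (i < 5)%N -> t i != 0 -> ~ prop_to (x i) (lcn t x)) ->
  count (fun i => t i != 0) (iota 0 5) = 3%N \/
  count (fun i => t i != 0) (iota 0 5) = 5%N.
Proof.
move=> fr nx nt dx.
have sE : \sum_(y <- [seq (t i, x i) | i <- iota 0 5]) y.1 *: y.2 = lcn t x.
  by rewrite !big_cons big_nil /= addr0 /lcn /lc5 !addrA.
have := @node_support [seq (t i, x i) | i <- iota 0 5]; rewrite sE /supp count_map.
apply=> //.
- by move=> y /mapP[i]; rewrite mem_iota => i5 -> /=; apply: nx.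
- by move=> y /mapP[i]; rewrite mem_iota => i5 -> /=; apply: dx.
Qed.

(** At most one of the four has full support, by [full_unique]. Three with support three therefore
    remain, and the fourth serves as the extra node. *)
Lemma product_of_four (x y : nat -> V) : frame x ->
  (forall i, (i < 5)%N -> node (x i)) -> (forall j, (j < 4)%N -> node (y j)) ->
  (forall i j, (i < 5)%N -> (j < 4)%N -> ~ prop_to (x i) (y j)) ->
  (forall j k, (j < 4)%N -> (k < 4)%N -> j != k -> ~ prop_to (y j) (y k)) ->
  product_frame.
Proof.
move=> fr nx ny dxy dyy.
have [t yE] : exists t, forall j, (j < 4)%N -> y j = lcn (t j) x.
  have [t0 E0] := frame_span_nat (y 0) fr; have [t1 E1] := frame_span_nat (y 1) fr.
  have [t2 E2] := frame_span_nat (y 2) fr; have [t3 E3] := frame_span_nat (y 3) fr.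
  by exists (nth t0 [:: t0; t1; t2; t3]) => -[|[|[|[|//]]]] _ /=.
pose c j := count (fun i => t j i != 0) (iota 0 5).
have c35 j : (j < 4)%N -> c j = 3%N \/ c j = 5%N.
  move=> j4; apply: (node_support_nat fr).
  - by move=> i i5 _; apply: nx.
  - by rewrite -yE //; apply: ny.
  - by move=> i i5 _; rewrite -yE //; apply: dxy.
have c5 j : c j = 5%N -> forall i, (i < 5)%N -> t j i != 0.
  have : size (iota 0 5) = 5%N by [].
  move=> <- /eqP; rewrite -all_count => /allP H i i5; apply: H; rewrite mem_iota //.
have iso i : (i < 5)%N -> isotropic (x i) by move=> /nx/node_isotropic.
have one5 j k : (j < 4)%N -> (k < 4)%N -> j != k -> c j = 5%N -> c k = 3%N.
  move=> j4 k4 jk cj; case: (c35 k k4) => // ck; case: (dyy j k j4 k4 jk).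
  have nk := ny k k4; have ij := node_isotropic (ny j j4).
  move: nk ij; rewrite !yE // => nk ij.
  by apply: (full_unique fr _ _ _ _ _ _ _ _ _ _ _ _ _ _ _ nk ij);
    first [exact: iso | exact: c5].
have done o : perm_eq o (iota 0 4) ->
    (forall j, (j < 3)%N -> c (nth 0%N o j) = 3%N) -> product_frame.
  move=> po c3; have so : size o = 4%N by rewrite (perm_size po).
  have lt4 k : (k < 4)%N -> (nth 0%N o k < 4)%N.
    move=> kn; have : nth 0%N o k \in o by apply: mem_nth; rewrite so.
    by rewrite (perm_mem po) mem_iota.
  have lt3 k : (k < 3)%N -> (nth 0%N o k < 4)%N.
    by move=> k3; apply: lt4; apply: leq_trans k3 _.
  have ne j k : (j < 4)%N -> (k < 4)%N -> j != k -> nth 0%N o j != nth 0%N o k.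
    by move=> j4 k4; rewrite nth_uniq ?so // (perm_uniq po) iota_uniq.
  apply: (product_of_supports (t := fun j => t (nth 0%N o j)) (y := y (nth 0%N o
    3)) fr nx).
  - by move=> j j3; rewrite -yE ?lt3 //; apply/ny/lt3.
  - move=> j k j3 k3 jk; rewrite -!yE ?lt3 //.
    exact: dyy (lt3 j j3) (lt3 k k3) (ne j k (leqW j3) (leqW k3) jk).
  - exact: c3.
  - exact/ny/lt4.
  - by move=> i i5; apply: dxy; rewrite ?lt4.
  - move=> j j3; rewrite -yE ?lt3 //.
    exact: dyy (lt3 j j3) (lt4 3 isT) (ne j 3 (leqW j3) isT (negbT (ltn_eqF j3))).
have [c0|c0] := c35 0 isT; last first.
  by apply: (done [:: 1; 2; 3; 0]%N) => // -[|[|[|//]]] _; apply: (one5 0).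
have [c1|c1] := c35 1 isT; last first.
  by apply: (done [:: 0; 2; 3; 1]%N) => // -[|[|[|//]]] _; apply: (one5 1).
have [c2|c2] := c35 2 isT; last first.
  by apply: (done [:: 0; 1; 3; 2]%N) => // -[|[|[|//]]] _; apply: (one5 2).
by apply: (done [:: 0; 1; 2; 3]%N) => // -[|[|[|//]]] _.
Qed.

(** * Choosing a frame among nine nodes *)

Lemma span_lc (xs : seq V) v : v \in <<xs>>%VS ->
  exists t : nat -> L, v = \sum_(i < size xs) t i *: xs`_i.
Proof.
move=> /(coord_span (X := in_tuple xs)) E.
exists (fun i => if insub i is Some j then coord (in_tuple xs) j v else 0).
rewrite {1}E; apply: eq_bigr => i _; rewrite (insubT (fun k => k < size xs)%N
  (ltn_ord i)); congr (coord _ _ _ *: _).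
exact: val_inj.
Qed.

Lemma free_extend (xs : seq V) : free xs -> (size xs < 5)%N ->
  exists v, free (v :: xs).
Proof.
move=> fx sx; exists (vpick (<<xs>>^C)); rewrite free_cons fx andbT.
apply/negP => vx.
have : vpick (<<xs>>^C) \in (<<xs>> :&: <<xs>>^C)%VS by rewrite memv_cap vx
  memv_pick.
rewrite capv_compl memv0 vpick0 => /eqP C0.
have := dimv_compl <<xs>>%VS.
by rewrite C0 dimv0 dimV => /eqP; rewrite eq_sym subn_eq0 leqNgt (eqP fx) sx.
Qed.

Theorem nine_nodes_product (s : nat -> V) :
  (forall i, (i < 9)%N -> node (s i)) ->
  (forall i j, (i < 9)%N -> (j < 9)%N -> i != j -> ~ prop_to (s i) (s j)) ->
  product_frame.
Proof.
move=> ns ds.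
have f12 : free [:: s 1; s 2].
  rewrite free_cons seq1_free span_seq1; have [-> _ _] := ns 2 isT; rewrite andbT.
  by apply/vlineP => -[c E]; case: (ds 2 1) => //; exists c.
have f012 : free [:: s 0; s 1; s 2].
  rewrite free_cons f12 andbT; apply/negP => /span_lc[t].
  rewrite !big_ord_recl big_ord0 /= addr0 => E.
  have [z0|n0] := eqVneq (t 0) 0.
    by case: (ds 2 0) => //; exists (t 1); rewrite E z0 scale0r add0r.
  have [z1|n1] := eqVneq (t 1) 0.
    by case: (ds 1 0) => //; exists (t 0); rewrite E z1 scale0r addr0.
  apply: (no_collinear_nodes (ns 1 isT) (ns 2 isT) (ds 1 2 isT isT isT) n0 n1).
  by rewrite -E; apply: node_isotropic; apply: ns.
have out3 k : (2 < k < 9)%N -> s k \in <<[:: s 0%N; s 1%N; s 2%N]>>%VS ->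
    exists t0 t1 t2, [/\ t0 != 0, t1 != 0, t2 != 0 &
      s k = t0 *: s 0 + t1 *: s 1 + t2 *: s 2].
  move=> /andP[k2 k9] /span_lc[t]; rewrite !big_ord_recl big_ord0 /= addr0 addrA =>
    E.
  exists (t 0), (t 1), (t 2).
  suff [n0 n1 n2] : [/\ t 0 != 0, t 1 != 0 & t 2 != 0] by [].
  (* The vectors [v] and [w] have coefficient 0 and are only needed to apply the support lemma. *)
  have [v fv] := free_extend f012 isT; have [w fw] := free_extend fv isT.
  pose x := nth 0 [:: s 0; s 1; s 2; v; w].
  have fx : frame x.
    by apply: (frame_perm fw); apply/permP => z /=; ring.
  pose u i := if (i < 3)%N then t i else 0.
  have uE : lcn u x = s k by rewrite E /lcn /lc5 /x /u /= !lcE5.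
  have := @node_support_nat x u fx; rewrite uE /=.
  case=> [i _||i i5||].
  - by case: i => [|[|[|i]]]; rewrite /u /= ?eqxx // => _; apply: ns.
  - exact: ns.
  - case: i i5 => [|[|[|i]]] _; rewrite /u /= ?eqxx // => _; apply: ds => //;
      by rewrite ltn_eqF // (leq_trans _ k2).
  - rewrite /u /= eqxx; case: (t 0 != 0); case: (t 1 != 0); case: (t 2 != 0) => //.
  - rewrite /u /= eqxx; case: (t 0 != 0); case: (t 1 != 0); case: (t 2 != 0) => //.
(* A plane spanned by three nodes holds only one more, so it misses [s 3] or [s 4]. *)
have [k3 [k34 f3]] : exists k, (k = 3%N \/ k = 4%N) /\ free [:: s k; s 0; s 1; s 2].
  have [s3|s3] := boolP (s 3 \in <<[:: s 0%N; s 1%N; s 2%N]>>%VS); last first.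
    by exists 3%N; split; [left|rewrite free_cons s3].
  have [s4|s4] := boolP (s 4 \in <<[:: s 0%N; s 1%N; s 2%N]>>%VS); last first.
    by exists 4%N; split; [right|rewrite free_cons s4].
  have [t0 [t1 [t2 [n0 n1 n2 E3]]]] := out3 3%N isT s3.
  have [u0 [u1 [u2 [m0 m1 m2 E4]]]] := out3 4%N isT s4.
  have [v fv] := free_extend f012 isT; have [w fw] := free_extend fv isT.
  have fx : frame5 (s 0) (s 1) (s 2) v w.
    by apply: (frame_perm fw); apply/permP => z /=; ring.
  case: (ds 4 3) => //; rewrite E3 E4; apply: (plane_unique fx) => //;
    rewrite -?E3 -?E4; try exact: ns; apply: node_isotropic; exact: ns.
have k39 : (k3 < 9)%N by case: k34 => ->.
(* The hyperplane spanned by four nodes holds at most two others, so it misses one of [s 5], [s 6],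
   [s 7]. *)
have [k4 [k456 f4]] : exists k, [\/ k = 5%N, k = 6%N | k = 7%N] /\
    free [:: s k; s k3; s 0; s 1; s 2].
  have [v fv] := free_extend f3 isT.
  pose o := [:: k3; 0; 1; 2]%N; pose x i := nth v (map s o) i.
  have fx : frame x by apply: (frame_perm fv); apply/permP => z /=; ring.
  have nx i : (i < 4)%N -> node (x i).
    by case: i => [|[|[|[|]]]] //= _; apply: ns.
  have in4 k : (4 < k < 9)%N -> s k \in <<[:: s k3; s 0%N; s 1%N; s 2%N]>>%VS ->
      exists t, [/\ s k = lcn t x, t 4 = 0 & count (fun i => t i != 0) (iota 0 5) =
        3%N].
    move=> /andP[k5 k9] /span_lc[t]; rewrite !big_ord_recl big_ord0 /= addr0 !addrA
      => E.
    pose u i := if (i < 4)%N then t i else 0.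
    have uE : lcn u x = s k by rewrite E /lcn /lc5 /x /u /= !lcE5.
    exists u; split=> //; have := @node_support_nat x u fx; rewrite uE.
    case=> [i _||i i5||].
    - by rewrite {1}/u; case: ifP => [i4 _|]; [exact: nx|rewrite eqxx].
    - exact: ns.
    - rewrite {1}/u; case: ifP => [|_]; last by rewrite eqxx.
      case: i i5 => [|[|[|[|//]]]] _ _ _ /=; apply: ds => //;
        try by rewrite ltn_eqF // (leq_trans _ k5).
      by case: k34 => ->; rewrite ltn_eqF // (leq_trans _ k5).
    - exact: id.
    - rewrite /u /= eqxx; case: (t 0 != 0); case: (t 1 != 0); case: (t 2 != 0);
      by case: (t 3 != 0).
  have [s5|s5] := boolP (s 5 \in <<[:: s k3; s 0%N; s 1%N; s 2%N]>>%VS); last first.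
    by exists 5%N; split; [constructor 1|rewrite free_cons s5].
  have [s6|s6] := boolP (s 6 \in <<[:: s k3; s 0%N; s 1%N; s 2%N]>>%VS); last first.
    by exists 6%N; split; [constructor 2|rewrite free_cons s6].
  have [s7|s7] := boolP (s 7 \in <<[:: s k3; s 0%N; s 1%N; s 2%N]>>%VS); last first.
    by exists 7%N; split; [constructor 3|rewrite free_cons s7].
  have [t5 [E5 z5 c5]] := in4 5%N isT s5; have [t6 [E6 z6 c6]] := in4 6%N isT s6.
  have [t7 [E7 z7 c7]] := in4 7%N isT s7.
  have tE j : (j < 3)%N -> lcn (nth t5 [:: t5; t6; t7] j) x = s (j + 5).
    by case: j => [|[|[|]]].
  case: (@no_three_in_hyperplane x (nth t5 [:: t5; t6; t7]) fx nx).
  - by move=> j j3; rewrite tE //; apply: ns; case: j j3 => [|[|[|]]].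
  - move=> j k j3 k3' jk; rewrite !tE //; apply: ds; rewrite ?eqn_add2r //.
      by case: j j3 {jk} => [|[|[|]]].
    by case: k k3' {jk} => [|[|[|]]].
  - by move=> [|[|[|]]].
  - by move=> [|[|[|]]].
pose o := [:: k4; k3; 0; 1; 2]%N.
pose r := filter (fun k => k \notin o) (iota 0 9).
apply: (@product_of_four (fun i => s (nth 0%N o i)) (fun j => s (nth 0%N r j))).
- exact: f4.
- by case: k34 k456 @o @r => -> [] -> o r [|[|[|[|[|//]]]]] _; apply: ns.
- by case: k34 k456 @o @r => -> [] -> o r [|[|[|[|//]]]] _; apply: ns.
- by case: k34 k456 @o @r => -> [] -> o r [|[|[|[|[|//]]]]] [|[|[|[|//]]]] _ _;
    apply: ds.
- by case: k34 k456 @o @r => -> [] -> o r [|[|[|[|//]]]] [|[|[|[|//]]]] _ _ //= _;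
    apply: ds.
Qed.

End Trilinear.

(** * The polar form of a cubic polynomial *)

Lemma mderivU (R : nzRingType) n (i j : 'I_n) :
  ('X_j : {mpoly R[n]})^`M(i) = (j == i)%:R%:MP.
Proof.
rewrite mderivX mnm1E; have [->|_] := eqVneq j i; last by rewrite scale0r.
by rewrite scale1r -{1}[U_(i)%MM]add0m addmK mpolyX0 mpolyC1.
Qed.

Lemma mpoly_ring_ind (R : comNzRingType) n (P : {mpoly R[n]} -> Prop) :
  P 1 -> (forall i, P 'X_i) -> (forall c p, P p -> P (c *: p)) ->
  (forall p q, P p -> P q -> P (p + q)) -> (forall p q, P p -> P q -> P (p * q)) ->
  forall p, P p.
Proof.
move=> P1 PX PZ PD PM p; rewrite (mpolyE p); apply: big_ind => [||m _]; [|exact: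
  PD|].
  by rewrite -(scale0r 1); apply: PZ.
apply: PZ; rewrite mpolyXE_id; apply: big_ind => // i _.
by elim: (m i) => [|d IH]; rewrite ?expr0 // exprS; apply: PM.
Qed.

Section Polar.
Variables (F : fieldType) (n : nat).
Implicit Types (f g : {mpoly F[n]}) (u v w : 'rV[F]_n).

Definition ddir u f : {mpoly F[n]} := \sum_i u 0 i *: f^`M(i).

Lemma ddirDl a u v f : ddir (a *: u + v) f = a *: ddir u f + ddir v f.
Proof.
rewrite /ddir scaler_sumr -big_split; apply: eq_bigr => i _ /=.
by rewrite !mxE scalerDl scalerA.
Qed.

Lemma mderiv_ddir u f j : (ddir u f)^`M(j) = ddir u f^`M(j).
Proof.
rewrite /ddir raddf_sum; apply: eq_bigr => i _ /=.
by rewrite mderivZ mderiv_comm.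
Qed.

Lemma ddirC u v f : ddir u (ddir v f) = ddir v (ddir u f).
Proof.
rewrite {1 4}/ddir; under eq_bigr do rewrite mderiv_ddir /ddir scaler_sumr.
rewrite exchange_big; apply: eq_bigr => j _ /=.
rewrite mderiv_ddir /ddir scaler_sumr; apply: eq_bigr => i _.
by rewrite !scalerA mulrC mderiv_comm.
Qed.

Lemma ddir_delta i f : ddir (delta_mx 0 i) f = f^`M(i).
Proof.
rewrite /ddir (bigD1 i) //= big1 => [|j ji]; rewrite mxE eqxx ?eqxx.
  by rewrite scale1r addr0.
by rewrite (negPf ji) scale0r.
Qed.

Lemma mderiv_homog d f i : f \is d.+1.-homog -> f^`M(i) \is d.-homog.
Proof.
move=> hf; apply/dhomogP => m; rewrite mcoeff_msupp mcoeff_mderiv => nz.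
have : f@_(m + U_(i)) != 0 by apply: contraNneq nz => ->; rewrite mul0rn.
by rewrite -mcoeff_msupp => /(dhomogP _ _ _ hf); rewrite /= mdegD mdeg1 addn1 =>
  -[].
Qed.

Lemma ddir_homog d f u : f \is d.+1.-homog -> ddir u f \is d.-homog.
Proof. by move=> hf; apply: rpred_sum => i _; apply/rpredZ/mderiv_homog. Qed.

Lemma euler d f : f \is d.-homog -> \sum_i 'X_i * f^`M(i) = d%:R *: f.
Proof.
move=> hf; rewrite {2}(mpolyE f) scaler_sumr.
under eq_bigr => i _ do rewrite [in f^`M(i)](mpolyE f) raddf_sum mulr_sumr.
rewrite exchange_big big_seq [RHS]big_seq; apply: eq_bigr => m mf /=.
rewrite -(dhomogP _ _ _ hf _ mf) /= mdegE natr_sum scaler_suml.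
apply: eq_bigr => i _; rewrite mderivZ mderivX !scalerA -scalerAr -mpolyXD mulrC.
have [->|mi] := eqVneq (m i) 0%N; first by rewrite mul0r !scale0r.
congr (_ *: 'X_[_]); rewrite addmC submK //.
by rewrite lep1mP.
Qed.

Lemma evalv_ddir f u v : evalv (ddir u f) v = \sum_i u 0 i * evalv f^`M(i) v.
Proof. by rewrite /evalv /ddir raddf_sum; apply: eq_bigr => i _; rewrite /= mevalZ.
  Qed.

Lemma evalv_euler d f v : f \is d.-homog -> evalv (ddir v f) v = d%:R * evalv f v.
Proof.
move=> hf; rewrite -mevalZ -(euler hf) raddf_sum evalv_ddir.
by apply: eq_bigr => i _; rewrite /= mevalM mevalXU.
Qed.

Lemma homog0_const f : f \is 0.-homog -> f = (f@_0)%:MP.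
Proof.
move=> hf; apply/mpolyP => m; rewrite mcoeffC.
have [<-|m0] := eqVneq 0%MM m; first by rewrite mulr1.
by rewrite mulr0 (dhomog_nemf_coeff hf) // mdeg_eq0 eq_sym.
Qed.

Lemma evalv_homog0 f v : f \is 0.-homog -> evalv f v = f@_0.
Proof. by move=> /homog0_const {1}->; rewrite /evalv mevalC. Qed.

(** The third derivative of a cubic is constant, so its constant coefficient is its value. There is
    no division by 3!, whence the factor 6 in [polar_diag]. *)
Definition polar f u v w := (ddir u (ddir v (ddir w f)))@_0.

Lemma polar_linear f a u u' v w :
  polar f (a *: u + u') v w = a * polar f u v w + polar f u' v w.
Proof. by rewrite /polar ddirDl mcoeffD mcoeffZ. Qed.

Lemma polarC12 f u v w : polar f u v w = polar f v u w.
Proof. by rewrite /polar ddirC. Qed.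

Lemma polarC23 f u v w : polar f u v w = polar f u w v.
Proof. by rewrite /polar (ddirC v). Qed.

Lemma polarE f x u v w : f \is 3.-homog ->
  polar f u v w = evalv (ddir u (ddir v (ddir w f))) x.
Proof. by move=> hf; rewrite evalv_homog0 //; do 3!apply: ddir_homog. Qed.

Lemma polar_diag f v : f \is 3.-homog -> polar f v v v = 6%:R * evalv f v.
Proof.
move=> hf; rewrite (polarE v) // (@evalv_euler 1); last by do 2!apply: ddir_homog.
rewrite (@evalv_euler 2); last by apply: ddir_homog.
by rewrite (@evalv_euler 3) // !mulrA -!natrM.
Qed.

Lemma polar_diag2 f p w : f \is 3.-homog ->
  polar f p p w = 2%:R * evalv (ddir w f) p.
Proof.
move=> hf; rewrite (polarE p) // (@evalv_euler 1); last by do 2!apply: ddir_homog.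
by rewrite (@evalv_euler 2) ?mul1r //; apply: ddir_homog.
Qed.

Lemma polar_singular f p w : f \is 3.-homog -> singular_point f p ->
  polar f p p w = 0.
Proof.
move=> hf [_ _ sf]; rewrite polar_diag2 // evalv_ddir big1 ?mulr0 // => i _.
by rewrite sf mulr0.
Qed.

Lemma polar_delta2 f p i j : f \is 3.-homog ->
  polar f p (delta_mx 0 i) (delta_mx 0 j) = evalv f^`M(j)^`M(i) p.
Proof.
move=> hf; rewrite (polarE p) // !ddir_delta (@evalv_euler 1) ?mul1r //.
by do 2!apply: mderiv_homog.
Qed.

(** In characteristic zero, Euler's formula recovers a form of positive degree from its partial
    derivatives; it is applied in degrees 3, 2 and 1. *)
Lemma homog_third_deriv0 f : [pchar F] =i pred0 -> f \is 3.-homog ->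
  (forall u v w, polar f u v w = 0) -> f = 0.
Proof.
move=> ch0 hf pf0; have nz d : d.+1%:R != 0 :> F by rewrite (proj1 (pcharf0P F)
  ch0).
have lift0 d g : g \is d.+1.-homog -> (forall i, g^`M(i) = 0) -> g = 0.
  move=> hg g0; apply/eqP; have /eqP := euler hg.
  rewrite big1 => [|i _]; last by rewrite g0 mulr0.
  by rewrite eq_sym scaler_eq0 (negPf (nz d)).
apply: (lift0 2 _ hf) => i; apply: (lift0 1%N); first exact: mderiv_homog.
move=> j; apply: (lift0 0%N); first by do 2!apply: mderiv_homog.
move=> k; rewrite [LHS]homog0_const; last by do 3!apply: mderiv_homog.
by have := pf0 (delta_mx 0 k) (delta_mx 0 j) (delta_mx 0 i);
  rewrite /polar !ddir_delta => ->.
Qed.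

(** The values determine the polar form by polarization, and the polar form determines the cubic. *)
Lemma cubic_eq f g : [pchar F] =i pred0 -> f \is 3.-homog -> g \is 3.-homog ->
  (forall v, evalv f v = evalv g v) -> f = g.
Proof.
move=> ch0 hf hg fg; have nz d : d.+1%:R != 0 :> F by rewrite (proj1 (pcharf0P F)
  ch0).
apply/eqP; rewrite -subr_eq0; apply/eqP; set h := f - g.
have hh : h \is 3.-homog by rewrite rpredB.
apply: homog_third_deriv0 => // u v w.
have d0 x : polar h x x x = 0.
  by rewrite polar_diag // /h /evalv mevalB -/(evalv f x) fg subrr mulr0.
exact: (trilin_diag0 (nz 1%N) (nz 2) (@polar_linear h) (@polarC12 h) (@polarC23 h)).
Qed.

Lemma mderiv_comp m (lq : n.-tuple {mpoly F[m]}) f k :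
  (f \mPo lq)^`M(k) = \sum_j (f^`M(j) \mPo lq) * (tnth lq j)^`M(k).
Proof.
pose P g := (g \mPo lq)^`M(k) = \sum_j (g^`M(j) \mPo lq) * (tnth lq j)^`M(k).
have PM g h : P g -> P h -> P (g * h).
  rewrite /P rmorphM mderivM => -> ->; rewrite mulr_suml mulr_sumr -big_split.
  apply: eq_bigr => j _ /=; rewrite mderivM rmorphD !rmorphM /=.
  by rewrite mulrDl mulrA; congr (_ + _); rewrite mulrAC.
have P1 : P 1.
  rewrite /P rmorph1 -mpolyC1 mderivC big1 // => j _.
  by rewrite mderivC raddf0 mul0r.
have PX i : P 'X_i.
  rewrite /P comp_mpolyXU (bigD1 i) //= big1 => [|j ji].
    by rewrite mderivU eqxx comp_mpolyC mul1r addr0 (tnth_nth 0).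
  by rewrite mderivU eq_sym (negPf ji) raddf0 mul0r.
have PZ c g : P g -> P (c *: g).
  rewrite /P linearZ mderivZ /= => ->; rewrite scaler_sumr; apply: eq_bigr => j _.
  by rewrite mderivZ linearZ /= scalerAl.
have PD g h : P g -> P h -> P (g + h).
  rewrite /P raddfD mderivD /= => -> ->; rewrite -big_split; apply: eq_bigr => j _.
  by rewrite mderivD raddfD mulrDl.
exact: (mpoly_ring_ind P1 PX PZ PD PM f).
Qed.

End Polar.

Section OrdinaryNode.
Variables (F : fieldType) (n : nat).
Implicit Types (f : {mpoly F[n.+1]}) (p : 'rV[F]_n.+1).

Definition chart p (i : 'I_n.+1) : n.+1.-tuple {mpoly F[n]} :=
  [tuple (p 0 j / p 0 i)%:MP + oapp (fun k : 'I_n => 'X_k) 0 (unlift i j)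
  | j < n.+1].

Lemma mderiv_chart f p i k :
  (f \mPo chart p i)^`M(k) = f^`M(lift i k) \mPo chart p i.
Proof.
rewrite mderiv_comp (bigD1 (lift i k)) //= big1 => [|j jk].
  by rewrite tnth_mktuple liftK /= mderivD mderivC add0r mderivU eqxx mulr1 addr0.
rewrite tnth_mktuple mderivD mderivC add0r.
case: unliftP jk => [l -> kl|_ _] /=; last by rewrite mderiv0 mulr0.
rewrite mderivU (_ : (l == k) = false) ?mulr0 //.
by apply/eqP => lk; rewrite lk eqxx in kl.
Qed.

Lemma evalv_chart f p i : p 0 i != 0 ->
  evalv (f \mPo chart p i) 0 = evalv f ((p 0 i)^-1 *: p).
Proof.
move=> pi0; rewrite /evalv comp_mpoly_meval; apply: meval_eq => j.
rewrite tnth_mktuple mevalD mevalC !mxE mulrC; case: unliftP => [l _|_] /=.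
  by rewrite mevalXU mxE addr0.
by rewrite meval0 addr0.
Qed.

(** On vectors with [i]-th coordinate 0, the Hessian in the chart is the bilinear form [polar f p]
    divided by [p_i]. Subtracting a multiple of [p] brings [k] into this hyperplane, where
    invertibility of the Hessian makes it zero. *)
Lemma ordinary_node_kernel f p k : f \is 3.-homog -> singular_point f p ->
  ordinary_node f p -> (forall v, polar f p k v = 0) -> exists c, k = c *: p.
Proof.
move=> hf sp [i pi0 [_ _ Hu]] pk0; exists (k 0 i / p 0 i).
pose w := k - (k 0 i / p 0 i) *: p; apply/eqP; rewrite -subr_eq0 -/w; apply/eqP.
have pw0 v : polar f p w v = 0.
  rewrite polarC12 /w addrC -scaleNr polar_linear polarC12 pk0 polar_singular //.
  by rewrite mulr0 addr0.
have wi : w 0 i = 0 by rewrite !mxE divfK // subrr.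
pose w' : 'rV[F]_n := \row_a w 0 (lift i a).
have wE : w = \sum_a w' 0 a *: delta_mx 0 (lift i a).
  apply/rowP => j; rewrite summxE; case: (unliftP i j) => [b ->|->].
    rewrite (bigD1 b) //= big1 => [|a ab]; rewrite !mxE eqxx /=.
      by rewrite eqxx mulr1 addr0.
    by rewrite (inj_eq lift_inj) eq_sym (negPf ab) mulr0.
  by rewrite wi big1 // => a _; rewrite !mxE eqxx /= (negPf (neq_lift i a)) mulr0.
suff w'0 : w' = 0 by rewrite wE big1 // => a _; rewrite w'0 mxE scale0r.
rewrite -[w'](mulmxK Hu) (_ : w' *m _ = 0) ?mul0mx //.
apply/rowP => b; rewrite mxE [RHS]mxE.
(* The chart evaluates second derivatives at [p / p_i]; being linear, they only pick up a scalar. *)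
have homZ c g v : g \is 1.-homog -> evalv g (c *: v) = c * evalv g v.
  move=> hg; rewrite -[LHS]mul1r -(@evalv_euler _ _ 1) // evalv_ddir.
  rewrite -[evalv g v]mul1r -(@evalv_euler _ _ 1) // evalv_ddir mulr_sumr.
  apply: eq_bigr => j _; rewrite mxE mulrA; congr (_ * _).
  by rewrite !evalv_homog0 //; apply: mderiv_homog.
have := pw0 (delta_mx 0 (lift i b)); rewrite wE => E.
transitivity ((p 0 i)^-1 * 0); last by rewrite mulr0.
rewrite -[X in _ = _ * X]E polarC12.
have suml u v : polar f (\sum_a w' 0 a *: delta_mx 0 (lift i a)) u v =
    \sum_a w' 0 a * polar f (delta_mx 0 (lift i a)) u v.
  apply: (big_ind2 (fun x y => polar f x u v = y)) => [|x1 x2 y1 y2 <- <-|a _].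
  - by rewrite /polar /ddir big1 ?mcoeff0 // => j _; rewrite mxE scale0r.
  - by rewrite -[x1 in LHS]scale1r polar_linear mul1r.
  - rewrite -[_ *: _ in LHS]addr0 polar_linear /polar.
    rewrite [ddir 0 _]big1 ?mcoeff0 ?addr0 // => j _; by rewrite mxE scale0r.
rewrite suml mulr_sumr.
apply: eq_bigr => a _.
rewrite polarC12 polar_delta2 // [hessian _ _ _ _]mxE /local_equation -/(chart p i).
rewrite !mderiv_chart evalv_chart // homZ; last by do 2!apply: mderiv_homog.
by rewrite mderiv_comm mulrCA.
Qed.

End OrdinaryNode.

(** * Differences of two products of three linear forms *)

Section ProductForm.
Variables (F : fieldType).

Definition linform n (M : 'M[F]_(n, 6)) j : {mpoly F[n]} := \sum_i M i j *: 'X_i.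

Definition product_form n (M : 'M[F]_(n, 6)) (al be : F) : {mpoly F[n]} :=
  al *: (\prod_(k < 3) linform M (lshift 3 k))
  - be *: (\prod_(k < 3) linform M (rshift 3 k)).

Lemma linform_homog n (M : 'M[F]_(n, 6)) j : linform M j \is 1.-homog.
Proof. by apply: rpred_sum => i _; apply: rpredZ; rewrite dhomogX /= mdeg1. Qed.

Lemma product_form_homog n (M : 'M[F]_(n, 6)) al be : product_form M al be \is
  3.-homog.
Proof.
have hom (h : 'I_3 -> 'I_6) : \prod_(k < 3) linform M (h k) \is 3.-homog.
  rewrite !big_ord_recl big_ord0 mulr1 -[3%N]/(1 + (1 + 1))%N.
  by do 2!(apply: dhomogM; first exact: linform_homog); exact: linform_homog.
by rewrite rpredB //; apply: rpredZ; apply: hom.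
Qed.

Lemma evalv_linform n (M : 'M[F]_(n, 6)) j v : evalv (linform M j) v = (v *m M) 0 j.
Proof.
rewrite /evalv /linform raddf_sum mxE; apply: eq_bigr => i _ /=.
by rewrite mevalZ mevalXU mulrC.
Qed.

Lemma evalv_product_form n (M : 'M[F]_(n, 6)) al be v :
  evalv (product_form M al be) v = al * (\prod_(k < 3) (v *m M) 0 (lshift 3 k))
  - be * (\prod_(k < 3) (v *m M) 0 (rshift 3 k)).
Proof.
rewrite /evalv mevalB !mevalZ !rmorph_prod.
by congr (_ * _ - _ * _); apply: eq_bigr => k _; apply: evalv_linform.
Qed.

Lemma lin_subst_product_form m n (A : 'M[F]_(m, n)) (M : 'M[F]_(n, 6)) al be :
  lin_subst A (product_form M al be) = product_form (A *m M) al be.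
Proof.
have lf j : linform M j \mPo [tuple \sum_(i < m) A i j *: 'X_i | j < n] = linform
  (A *m M) j.
  rewrite raddf_sum; under [LHS]eq_bigr => i _.
    rewrite /= comp_mpolyZ comp_mpolyXU -tnth_nth tnth_mktuple scaler_sumr; over.
  rewrite exchange_big; apply: eq_bigr => i _ /=; rewrite mxE scaler_suml.
  by apply: eq_bigr => k _; rewrite scalerA mulrC.
rewrite /lin_subst raddfB /= !comp_mpolyZ !rmorph_prod /=.
by congr (_ *: _ - _ *: _); apply: eq_bigr => k _; apply: lf.
Qed.

Lemma perazzo_product_form : perazzo_form F = product_form 1%:M 1 1.
Proof.
have lf j : linform (1%:M : 'M[F]_6) j = 'X_j.
  rewrite /linform (bigD1 j) //= big1 => [|i ij]; first by rewrite mxE eqxx scale1r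
    addr0.
  by rewrite mxE (negPf ij) scale0r.
by rewrite /product_form !scale1r; congr (_ - _); apply: eq_bigr => k _; rewrite lf.
Qed.

(** At [v] two of the three factors vanish in each product, so both products vanish to order two. *)
Lemma product_form_singular n (M : 'M[F]_(n, 6)) al be (v : 'rV_n) (k l : 'I_3) :
  v != 0 -> v *m M = delta_mx 0 (lshift 3 k) + delta_mx 0 (rshift 3 l) ->
  singular_point (product_form M al be) v.
Proof.
move=> v0 vE.
have vx (i : 'I_3) : evalv (linform M (lshift 3 i)) v = (i == k)%:R.
  by rewrite evalv_linform vE !mxE eqxx /= !eq_shift addr0.
have vy (i : 'I_3) : evalv (linform M (rshift 3 i)) v = (i == l)%:R.
  by rewrite evalv_linform vE !mxE eqxx /= !eq_shift add0r.
have prod0 (h : 'I_3 -> 'I_6) m : (forall i, evalv (linform M (h i)) v = (i ==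
  m)%:R) ->
    evalv (\prod_i linform M (h i)) v = 0 /\
    forall j, evalv (\prod_i linform M (h i))^`M(j) v = 0.
  move=> hv; have h0 := hv ord0; have h1 := hv (lift ord0 ord0).
  have h2 := hv (lift ord0 (lift ord0 ord0)).
  rewrite /evalv !big_ord_recl big_ord0 mulr1; move: h0 h1 h2.
  rewrite -!/(evalv _ v).
  set a := linform M (h ord0); set b := linform M (h _); set c := linform M (h _).
  by case: m {hv} => -[|[|[|//]]] ?; rewrite /evalv -!val_eqE /= => a0 b0 c0;
    (split=> [|j]; rewrite ?mderivM ?mevalD ?mevalM ?mderivM ?mevalD ?mevalM a0 b0
      c0;
     rewrite !(mul0r, mulr0, add0r, addr0)).
have [x0 dx0] := prod0 _ _ vx; have [y0 dy0] := prod0 _ _ vy.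
split=> // [|j]; rewrite /product_form /evalv.
  by rewrite mevalB !mevalZ; move: x0 y0; rewrite /evalv => -> ->; rewrite !mulr0
    subr0.
rewrite mderivB !mderivZ mevalB !mevalZ; move: (dx0 j) (dy0 j).
by rewrite /evalv => -> ->; rewrite !mulr0 subr0.
Qed.

End ProductForm.

(** * Change of the base field *)

Lemma map_product_form (F G : fieldType) (h : {rmorphism F -> G}) n
    (M : 'M[F]_(n, 6)) al be :
  map_mpoly h (product_form M al be) = product_form (map_mx h M) (h al) (h be).
Proof.
have lf j : map_mpoly h (linform M j) = linform (map_mx h M) j.
  rewrite raddf_sum; apply: eq_bigr => i _ /=.
  by rewrite map_mpolyZ map_mpolyX mxE.
rewrite raddfB /= !map_mpolyZ !rmorph_prod.
by congr (_ *: _ - _ *: _); apply: eq_bigr => k _; apply: lf.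
Qed.

Lemma evalv_map (F G : fieldType) (h : {rmorphism F -> G}) n (f : {mpoly F[n]}) v :
  evalv (map_mpoly h f) (map_mx h v) = h (evalv f v).
Proof.
move: f; apply: mpoly_ring_ind; rewrite /evalv.
- by rewrite rmorph1 !meval1 rmorph1.
- by move=> i; rewrite map_mpolyX !mevalXU mxE.
- by move=> c p IH; rewrite map_mpolyZ !mevalZ IH rmorphM.
- by move=> p q IHp IHq; rewrite raddfD !mevalD IHp IHq raddfD.
- by move=> p q IHp IHq; rewrite rmorphM !mevalM IHp IHq rmorphM.
Qed.

Lemma map_mpoly_mderiv (F G : fieldType) (h : {rmorphism F -> G}) n (f : {mpoly
  F[n]}) i :
  (map_mpoly h f)^`M(i) = map_mpoly h f^`M(i).
Proof.
by apply/mpolyP => m; rewrite mcoeff_map_mpoly !mcoeff_mderiv mcoeff_map_mpoly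
  raddfMn.
Qed.

Lemma map_lin_subst (F G : fieldType) (h : {rmorphism F -> G}) m n (A : 'M[F]_(m,
  n)) f :
  map_mpoly h (lin_subst A f) = lin_subst (map_mx h A) (map_mpoly h f).
Proof.
move: f; apply: mpoly_ring_ind; rewrite /lin_subst.
- by rewrite !rmorph1.
- move=> i; rewrite map_mpolyX !comp_mpolyXU -!tnth_nth !tnth_mktuple raddf_sum.
  by apply: eq_bigr => k _ /=; rewrite map_mpolyZ map_mpolyX mxE.
- by move=> c p IH; rewrite comp_mpolyZ !map_mpolyZ comp_mpolyZ IH.
- by move=> p q IHp IHq; rewrite !raddfD /= IHp IHq.
- by move=> p q IHp IHq; rewrite !rmorphM /= IHp IHq.
Qed.

Lemma map_mpoly_inj (F G : fieldType) (h : {rmorphism F -> G}) n :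
  injective (map_mpoly h : {mpoly F[n]} -> {mpoly G[n]}).
Proof.
move=> f g fg; apply/mpolyP => m; apply: (fmorph_inj h).
by rewrite -!mcoeff_map_mpoly fg.
Qed.

Lemma map_mpoly_comp_eq (F G H : fieldType) (h : {rmorphism F -> G})
    (k : {rmorphism G -> H}) (l : {rmorphism F -> H}) n (f : {mpoly F[n]}) :
  (forall a, k (h a) = l a) -> map_mpoly k (map_mpoly h f) = map_mpoly l f.
Proof. by move=> E; apply/mpolyP => m; rewrite !mcoeff_map_mpoly; apply: E. Qed.

Lemma map_mpoly_homog (F G : fieldType) (h : {rmorphism F -> G}) n d (f : {mpoly
  F[n]}) :
  (map_mpoly h f \is d.-homog) = (f \is d.-homog).
Proof.
have sE m : (m \in msupp (map_mpoly h f)) = (m \in msupp f).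
  by rewrite !mcoeff_msupp mcoeff_map_mpoly fmorph_eq0.
by apply/dhomogP/dhomogP => H m mf; apply: H; rewrite ?sE // -sE.
Qed.

Lemma map_mpoly_lift (F G : fieldType) (h : {rmorphism F -> G}) n (p : {mpoly
  G[n]}) :
  (forall m, exists a, p@_m = h a) -> exists f, map_mpoly h f = p.
Proof.
move=> H; rewrite (mpolyE p).
apply: (big_ind (fun q => exists f, map_mpoly h f = q)) => [|_ _ [f <-] [g <-]|m _].
- by exists 0; rewrite raddf0.
- by exists (f + g); rewrite raddfD.
by have [a ->] := H m; exists (a *: 'X_[m]); rewrite map_mpolyZ map_mpolyX.
Qed.

Lemma map_singular_point (F G : fieldType) (h : {rmorphism F -> G}) n (f : {mpoly
  F[n]}) p :
  singular_point f p -> singular_point (map_mpoly h f) (map_mx h p).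
Proof.
case=> p0 fp dfp; split; first by rewrite map_mx_eq0.
  by rewrite evalv_map fp rmorph0.
by move=> i; rewrite map_mpoly_mderiv evalv_map dfp rmorph0.
Qed.

(** * Finite Galois extensions inside an algebraic closure *)

Section FiniteGalois.
Variables (K : fieldType) (E : closedFieldType) (iota : {rmorphism K -> E}).
Hypothesis charK0 : [pchar K] =i pred0.
Hypothesis alg : forall x : E, algebraicOver iota x.

(** That [z] is a sum of multiples of members of [s] puts it in the field that they generate; the
    splitting field axiom needs this as well as the converse. *)
Lemma primitive_element (s : seq E) : exists z : E,
  (exists a : nat -> nat, z = \sum_(i < size s) s`_i *+ a i) /\
  (exists ps, s = [seq (map_poly iota p).[z] | p <- ps]).
Proof.
elim: s => [|x s [z [[a Dz] [ps Ds]]]].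
  by exists 0; split; [exists (fun=> 0%N); rewrite big_ord0|exists [::]].
have [rx nz_rx rx0] := alg x; have [rz nz_rz rz0] := alg (- z).
have [n [[pz Dpz] [px Dpx]]] := pchar0_PET nz_rz rz0 nz_rx rx0 charK0.
rewrite opprK in Dpz Dpx; exists (x *+ n + z); split.
  exists (fun i => if i is k.+1 then a k else n).
  by rewrite /= big_ord_recl /= Dz.
exists (px :: [seq p \Po (- pz) | p <- ps]) => /=; rewrite Dpx; congr (_ :: _).
rewrite -map_comp Ds; apply: eq_map => p /=.
by rewrite map_comp_poly horner_comp rmorphN hornerN Dpz opprK.
Qed.

(** Descent on the size of an annihilating polynomial; excluded middle decides whether a smaller one
    exists. *)
Lemma minimal_annihilator (z : E) : exists2 r : {poly K},
  root (map_poly iota r) z & irreducible_poly r /\ r != 0.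
Proof.
have [p p0 pz] := alg z; move: {2}(size p) (leqnn (size p)) => n.
elim: n p p0 pz => [|n IH] p p0 pz sp.
  by case/negP: p0; rewrite -size_poly_eq0 -leqn0.
have [[q [qz q0 sq]]|noq] := classic (exists q : {poly K},
    [/\ root (map_poly iota q) z, q != 0 & (size q <= n)%N]); first exact: IH qz sq.
exists p => //; split=> //; apply/(subfx_irreducibleP pz p0) => q qz q0.
by rewrite leqNgt; apply/negP => lt; apply: noq; exists q; split=> //; apply:
  leq_trans lt sp.
Qed.

(** The field is K(z) for a primitive element [z] of the roots of a product of annihilating
    polynomials of [s]: a splitting field, and separable in characteristic zero. Of Galois theory,
    only the descent of elements fixed by all endomorphisms over K is exported. *)
Lemma finite_galois_closure (s : seq E) :
  exists (L : fieldType) (i : {rmorphism K -> L}) (j : {rmorphism L -> E}),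
  [/\ forall a, j (i a) = iota a, forall y, y \in s -> exists x, j x = y &
    forall x, (forall sg : {rmorphism L -> L}, (forall a, sg (i a) = i a) -> sg x =
      x) ->
      exists a, x = i a].
Proof.
have [P P0 Ps] : exists2 P : {poly K}, P != 0 & all (root (map_poly iota P)) s.
  elim: s => [|x s [P P0 Ps]]; first by exists 1; rewrite ?oner_eq0.
  have [p p0 px] := alg x; exists (p * P); first by rewrite mulf_neq0.
  rewrite /= rmorphM rootM px; apply: sub_all Ps => y.
  by rewrite rootM => ->; rewrite orbT.
have [rs Dr] := closed_field_poly_normal (map_poly iota P).
have [z [[a Dz] [ps Ers]]] := primitive_element rs.
have [r rz [irr_r nz_r]] := minimal_annihilator z.
pose L : fieldExtType K := SubFieldExtType rz irr_r.
pose j : {rmorphism L -> E} := @subfx_inj _ _ iota z r.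
have jA b : j b%:A = iota b by apply: subfx_inj_base.
pose z1 : L := subfx_root iota z r.
have jz1 : j z1 = z by apply: subfx_inj_root.
have z1gen x : exists p, x = (map_poly (in_alg L) p).[z1] by have [p Dx] :=
  subfxEroot rz nz_r x; exists p.
have jh p : j (map_poly (in_alg L) p).[z1] = (map_poly iota p).[z].
  by rewrite -horner_map jz1 -map_poly_comp (eq_map_poly jA).
pose rs1 := [seq (map_poly (in_alg L) p).[z1] | p <- ps].
have jrs1 : map j rs1 = rs.
  by rewrite [RHS]Ers -map_comp; apply: eq_map => p /=; apply: jh.
have ax : SplittingField.axiom L.
  exists (map_poly (in_alg L) P).
    by apply/polyOver1P; exists P.
  exists rs1.
    have -> : map_poly (in_alg L) P = (lead_coef P)%:A *: \prod_(c <- rs1) ('X -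
      c%:P).
      apply: (map_poly_inj j); rewrite -map_poly_comp (eq_map_poly jA) Dr.
      rewrite lead_coef_map map_polyZ /= jA rmorph_prod -jrs1 big_map; congr (_ *:
        _).
      by apply: eq_bigr => c _; rewrite rmorphB /= map_polyX map_polyC.
    by rewrite eqp_scale // -in_algE fmorph_eq0 lead_coef_eq0.
  apply/vspaceP => x; rewrite memvf; have [p ->] := z1gen x.
  have z1in : z1 \in <<1 & rs1>>%VS.
    suff -> : z1 = \sum_(i < size rs) rs1`_i *+ a i.
      apply: memv_suml => i _; rewrite rpredMn // seqv_sub_adjoin // mem_nth //.
      by rewrite -(size_map j) jrs1.
    apply: (fmorph_inj j); rewrite jz1 Dz rmorph_sum; apply: eq_bigr => i _.
    by rewrite rmorphMn /= -(nth_map 0 0) ?jrs1 // -(size_map j) jrs1.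
  apply: rpred_horner => //; apply/polyOverP => k; rewrite coef_map /=.
  by apply/rpredZ/mem1v.
pose M : splittingFieldType K := HB.pack L (FieldExt_isSplittingField.Build K L ax).
have galM : galois 1 {:M}.
  rewrite /galois sub1v normalFieldf andbT; apply/separableP => x _.
  by apply: pcharf0_separable => p; rewrite (pchar_lalg M).
exists M, (in_alg M : {rmorphism K -> M}), j; split=> [//|y /(allP Ps) yP|x fx].
  have : y \in map j rs1.
    rewrite jrs1 -root_prod_XsubC; move: yP.
    by rewrite Dr rootZ // lead_coef_eq0 map_poly_eq0.
  by case/mapP => x _ ->; exists x.
have : x \in fixedField 'Gal({:M} / 1)%g.
  apply/fixedFieldP; first exact: memvf.
  move=> sg sg1; pose g : {rmorphism M -> M} := gal_repr sg.
  by apply: (fx g) => b; rewrite /= linearZ /= rmorph1.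
by rewrite (galois_fixedField galM) => /vlineP[b ->]; exists b.
Qed.

End FiniteGalois.

(** * Product forms and their nine nodes *)

Section Balanced.
Variable F : fieldType.

(* [M *m balance = 0] says that the sum of the three linear forms x_k equals the
   sum of the three forms y_l, where the columns of [M] are x1, x2, x3, y1, y2,
   y3. *)
Definition balance : 'cV[F]_6 := \col_j (if (j < 3)%N then 1 else -1).

Lemma balanceE n (M : 'M[F]_(n, 6)) i :
  (M *m balance) i 0 = \sum_(k < 3) M i (lshift 3 k) - \sum_(k < 3) M i (rshift 3
    k).
Proof.
rewrite mxE (@big_split_ord _ _ _ 3 3) -sumrN; congr (_ + _).
  by apply: eq_bigr => k _; rewrite mxE /= ltn_ord mulr1.
by apply: eq_bigr => k _; rewrite mxE /= mulrN1.
Qed.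

(** The row space of [M] has dimension five and lies in the five-dimensional kernel of [balance], so
    they coincide. *)
Lemma balanced_surj (M : 'M[F]_(5, 6)) (w : 'rV_6) : row_free M ->
  M *m balance = 0 -> w *m balance = 0 -> exists v, v *m M = w.
Proof.
move=> fM Mb wb.
have rb : \rank balance = 1%N.
  apply/eqP; rewrite eqn_leq rank_leq_col lt0n mxrank_eq0.
  apply/eqP => /colP/(_ (ord0 : 'I_6)); rewrite !mxE => /eqP.
  by rewrite oner_eq0.
have sM : (M <= kermx balance)%MS by apply/sub_kermxP.
have : (kermx balance <= M)%MS.
  by rewrite -(mxrank_leqif_sup sM) mxrank_ker rb (eqP fM).
move=> H; have /submxP[v ->] : (w <= M)%MS.
  by apply: submx_trans H; apply/sub_kermxP.
by exists v.
Qed.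

Lemma linformZ n (M : 'M[F]_(n, 6)) c j : linform (c *: M) j = c *: linform M j.
Proof. by rewrite /linform scaler_sumr; apply: eq_bigr => i _; rewrite mxE scalerA.
  Qed.

Lemma product_formZ n (M : 'M[F]_(n, 6)) c al be : c != 0 ->
  product_form M al be = product_form (c *: M) (al / c ^+ 3) (be / c ^+ 3).
Proof.
move=> c0; have pZ (h : 'I_3 -> 'I_6) :
    \prod_(k < 3) linform (c *: M) (h k) = c ^+ 3 *: \prod_(k < 3) linform M (h k).
  by under eq_bigr do rewrite linformZ; rewrite scaler_prod prodr_const card_ord.
by rewrite /product_form !pZ !scalerA !divfK // expf_neq0.
Qed.

Definition tblmx m n (s : seq (seq F)) : 'M_(m, n) := \matrix_(i, j) (nth [::] s
  i)`_j.

Lemma product_form_of_frame (f : {mpoly F[5]}) (A B C D E : 'rV[F]_5)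
    (N : 'M_(5, 6)) (R : 'M_(6, 5)) al be : [pchar F] =i pred0 -> f \is 3.-homog ->
  frame5 A B C D E -> N *m R = 1%:M -> N *m balance = 0 ->
  (forall t : 'rV_5, evalv f (lc5 (t 0 (inord 0)) (t 0 (inord 1)) (t 0 (inord 2))
      (t 0 (inord 3)) (t 0 (inord 4)) A B C D E) =
    al * (\prod_(k < 3) (t *m N) 0 (lshift 3 k)) -
    be * (\prod_(k < 3) (t *m N) 0 (rshift 3 k))) ->
  exists M : 'M_(5, 6),
    [/\ row_free M, M *m balance = 0 & f = product_form M al be].
Proof.
move=> ch0 hf fr NR Nb fE.
pose P : 'M_5 := \matrix_i [:: A; B; C; D; E]`_i.
have tP (t : 'rV_5) : t *m P = lc5 (t 0 (inord 0)) (t 0 (inord 1)) (t 0 (inord 2))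
      (t 0 (inord 3)) (t 0 (inord 4)) A B C D E.
  rewrite mulmx_sum_row !big_ord_recl big_ord0 addr0 !rowK /= /lc5 !addrA.
  by do 4?(congr (_ + _)); congr (t 0 _ *: _); apply: val_inj; rewrite /= inordK.
have uP : P \in unitmx.
  rewrite -row_free_unit -kermx_eq0; apply/rowV0P => t /sub_kermxP; rewrite tP.
  case/(frame_indep fr) => t0 t1 t2 t3 t4; apply/rowP => i; rewrite [RHS]mxE.
  rewrite -[i]inord_val; case: i => -[|[|[|[|[|//]]]]] /= _; assumption.
exists (invmx P *m N); split.
- apply/row_freeP; exists (R *m P).
  by rewrite mulmxA -(mulmxA _ N) NR mulmx1 mulVmx.
- by rewrite -mulmxA Nb mulmx0.
apply: cubic_eq => // [|v]; first exact: product_form_homog.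
by rewrite evalv_product_form mulmxA -fE -tP mulmxKV.
Qed.

Lemma tblmxE n s (t : 'rV_5) (j : 'I_n) : (t *m tblmx 5 n s) 0 j =
  t 0 (inord 0) * (nth [::] s 0)`_j + t 0 (inord 1) * (nth [::] s 1)`_j +
  t 0 (inord 2) * (nth [::] s 2)`_j + t 0 (inord 3) * (nth [::] s 3)`_j +
  t 0 (inord 4) * (nth [::] s 4)`_j.
Proof.
rewrite mxE !big_ord_recl big_ord0 addr0 !mxE !addrA.
by do 4?(congr (_ + _)); congr (t 0 _ * _); apply: val_inj; rewrite /= inordK.
Qed.

(* In each case, the columns of the first table are the six linear forms in the
   coordinates of the frame, and the second table is a right inverse. *)
Lemma product_form_of_product_frame (f : {mpoly F[5]}) : [pchar F] =i pred0 ->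
  f \is 3.-homog -> product_frame (polar f) ->
  exists (M : 'M_(5, 6)) (al be : F), [/\ al != 0, be != 0, row_free M,
    M *m balance = 0 & f = product_form M al be].
Proof.
move=> ch0 hf [A [B [C [D [E [al [be [z [fr al0 be0 fE zE]]]]]]]]].
have nz d : d.+1%:R != 0 :> F by rewrite (proj1 (pcharf0P F) ch0).
have {}fE a b c d e : evalv f (lc5 a b c d e A B C D E) =
    al * (a * (b + c) * (d + e)) - be * ((a + b) * (c + d) * e)
              + z * (a * e * (b + c + d)).
  by apply: (mulfI (nz 5)); rewrite -polar_diag // fE.
case: zE => zE.
- have [||t|M [? ? ?]] := @product_form_of_frame f A B C D E
    (tblmx 5 6 [:: [:: 1; 0; 0; 1; 0; 0];
      [:: 0; 1; 0; 1; 0; 0];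
      [:: 0; 1; 0; 0; 1; 0];
      [:: 0; 0; 1; 0; 1; 0];
      [:: 0; 0; 1; 0; 0; 1]])
    (tblmx 6 5 [:: [:: 1; -1; 1; 0; 0];
      [:: 0; 0; 1; 0; 0];
      [:: 0; 0; 0; 1; 0];
      [:: 0; 1; -1; 0; 0];
      [:: 0; 0; 0; 0; 0];
      [:: 0; 0; 0; -1; 1]])
    al be ch0 hf fr.
  + apply/matrixP => -[i i5] -[j j5]; rewrite !mxE !big_ord_recl big_ord0 !mxE /=.
    rewrite -val_eqE /=.
    case: i i5 => [|[|[|[|[|//]]]]] _; case: j j5 => [|[|[|[|[|//]]]]] _ /=; ring.
  + apply/colP => i; rewrite balanceE !big_ord_recl !big_ord0 !mxE /=.
    case: i => -[|[|[|[|[|//]]]]] _ /=; ring.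
  + by rewrite fE zE !big_ord_recl !big_ord0 !tblmxE /=; ring.
  by exists M, al, be; rewrite ?oppr_eq0.
- have [||t|M [? ? ?]] := @product_form_of_frame f A B C D E
    (tblmx 5 6 [:: [:: 1; 0; 0; 1; 0; 0];
      [:: 0; 0; -1; 0; -1; 0];
      [:: 0; 0; -1; -1; 0; 0];
      [:: 0; -1; 0; -1; 0; 0];
      [:: 0; 0; 1; 0; 0; 1]])
    (tblmx 6 5 [:: [:: 1; 0; 1; 0; 0];
      [:: 0; 0; 1; -1; 0];
      [:: 0; 0; 0; 0; 0];
      [:: 0; 0; -1; 0; 0];
      [:: 0; -1; 0; 0; 0];
      [:: 0; 0; 0; 0; 1]])
    al be ch0 hf fr.
  + apply/matrixP => -[i i5] -[j j5]; rewrite !mxE !big_ord_recl big_ord0 !mxE /=.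
    rewrite -val_eqE /=.
    case: i i5 => [|[|[|[|[|//]]]]] _; case: j j5 => [|[|[|[|[|//]]]]] _ /=; ring.
  + apply/colP => i; rewrite balanceE !big_ord_recl !big_ord0 !mxE /=.
    case: i => -[|[|[|[|[|//]]]]] _ /=; ring.
  + by rewrite fE zE !big_ord_recl !big_ord0 !tblmxE /=; ring.
  by exists M, al, be; rewrite ?oppr_eq0.
(* Here y3 is minus the last coordinate: the sign is needed for the balance relation and is absorbed
   in [- be]. In the last case the sign is in x1 and in [- al]. *)
- have [||t|M [? ? ?]] := @product_form_of_frame f A B C D E
    (tblmx 5 6 [:: [:: 1; 0; 0; 1; 0; 0];
      [:: 0; 0; 1; 1; 0; 0];
      [:: 0; 0; 1; 0; 1; 0];
      [:: 0; 1; 0; 0; 1; 0];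
      [:: 0; 0; -1; 0; 0; -1]])
    (tblmx 6 5 [:: [:: 1; -1; 0; 0; 0];
      [:: 0; 0; -1; 1; 0];
      [:: 0; 0; 0; 0; 0];
      [:: 0; 1; 0; 0; 0];
      [:: 0; 0; 1; 0; 0];
      [:: 0; 0; 0; 0; -1]])
    al (- be) ch0 hf fr.
  + apply/matrixP => -[i i5] -[j j5]; rewrite !mxE !big_ord_recl big_ord0 !mxE /=.
    rewrite -val_eqE /=.
    case: i i5 => [|[|[|[|[|//]]]]] _; case: j j5 => [|[|[|[|[|//]]]]] _ /=; ring.
  + apply/colP => i; rewrite balanceE !big_ord_recl !big_ord0 !mxE /=.
    case: i => -[|[|[|[|[|//]]]]] _ /=; ring.
  + by rewrite fE zE !big_ord_recl !big_ord0 !tblmxE /=; ring.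
  by exists M, al, (- be); rewrite ?oppr_eq0.
- have [||t|M [? ? ?]] := @product_form_of_frame f A B C D E
    (tblmx 5 6 [:: [:: -1; 0; 0; 0; 0; -1];
      [:: 0; 1; 0; 0; 1; 0];
      [:: 0; 1; 0; 0; 0; 1];
      [:: 0; 0; 1; 0; 0; 1];
      [:: 0; 0; 1; 1; 0; 0]])
    (tblmx 6 5 [:: [:: -1; 0; 0; 0; 0];
      [:: 0; 0; 1; 0; 0];
      [:: 0; 0; 0; 1; 0];
      [:: 0; 0; 0; -1; 1];
      [:: 0; 1; -1; 0; 0];
      [:: 0; 0; 0; 0; 0]])
    (- al) be ch0 hf fr.
  + apply/matrixP => -[i i5] -[j j5]; rewrite !mxE !big_ord_recl big_ord0 !mxE /=.
    rewrite -val_eqE /=.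
    case: i i5 => [|[|[|[|[|//]]]]] _; case: j j5 => [|[|[|[|[|//]]]]] _ /=; ring.
  + apply/colP => i; rewrite balanceE !big_ord_recl !big_ord0 !mxE /=.
    case: i => -[|[|[|[|[|//]]]]] _ /=; ring.
  + by rewrite fE zE !big_ord_recl !big_ord0 !tblmxE /=; ring.
  by exists M, (- al), be; rewrite ?oppr_eq0.
Qed.

End Balanced.

(** The pair [kl] stands for the node with x_k = y_l = 1; incidence means that the [j]-th form is
    nonzero there. Equivalently, [j] is an end of the edge [kl] of K_{3,3}. *)
Definition incident (j : 'I_6) (kl : 'I_3 * 'I_3) : bool :=
  match @split 3 3 j with inl i => kl.1 == i | inr i => kl.2 == i end.

Lemma incident_l (k : 'I_3) kl : incident (lshift 3 k) kl = (kl.1 == k).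
Proof. by rewrite /incident (unsplitK (inl k : 'I_3 + 'I_3)). Qed.

Lemma incident_r (l : 'I_3) kl : incident (rshift 3 l) kl = (kl.2 == l).
Proof. by rewrite /incident (unsplitK (inr l : 'I_3 + 'I_3)). Qed.

Lemma split6 (j : 'I_6) : (exists k : 'I_3, j = lshift 3 k) \/ (exists l : 'I_3, j
  = rshift 3 l).
Proof.
rewrite -[j](@splitK 3 3); case: split => k; [left|right]; by exists k.
Qed.

Lemma eq_split6 : (forall k k' : 'I_3, (lshift 3 k == lshift 3 k' :> 'I_6) = (k ==
  k')) *
  (forall k k' : 'I_3, (rshift 3 k == rshift 3 k' :> 'I_6) = (k == k')) *
  (forall k k' : 'I_3, (lshift 3 k == rshift 3 k' :> 'I_6) = false).
Proof.
split; first split; move=> k k'; [exact: (@eq_lshift 3 3)|exact: (@eq_rshift 3 3)|].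
exact: (@eq_lrshift 3 3).
Qed.

Lemma left_half : (forall k : 'I_3, (lshift 3 k < 3)%N) *
  (forall k : 'I_3, (rshift 3 k < 3)%N = false).
Proof. by split=> k /=. Qed.

Lemma card_incident j : #|[set kl | incident j kl]| = 3%N.
Proof.
case: (split6 j) => -[k ->].
  have -> : [set kl | incident (lshift 3 k) kl] = setX [set k] [set: 'I_3].
    by apply/setP => -[a b]; rewrite !inE incident_l andbT.
  by rewrite cardsX cards1 cardsT card_ord.
have -> : [set kl | incident (rshift 3 k) kl] = setX [set: 'I_3] [set k].
  by apply/setP => -[a b]; rewrite !inE incident_r.
by rewrite cardsX cards1 cardsT card_ord.
Qed.

(** Recovers the two halves x and y from incidence alone, so that a permutation compatible with
    incidence preserves or swaps them. *)
Lemma incident_half (j j' : 'I_6) : j != j' ->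
  ((j < 3)%N == (j' < 3)%N) = ~~ [exists kl, incident j kl && incident j' kl].
Proof.
case: (split6 j) => -[k ->]; case: (split6 j') => -[l ->]; rewrite !left_half => ne.
- apply/esym/existsPn => -[a b]; rewrite !incident_l; apply/negP => /= /andP[/eqP->
  /eqP kl].
  by rewrite kl eqxx in ne.
- by apply/esym/negbTE; rewrite negbK; apply/existsP; exists (k, l);
    rewrite incident_l incident_r !eqxx.
- by apply/esym/negbTE; rewrite negbK; apply/existsP; exists (l, k);
    rewrite incident_l incident_r !eqxx.
- apply/esym/existsPn => -[a b]; rewrite !incident_r; apply/negP => /= /andP[/eqP->
  /eqP kl].
  by rewrite kl eqxx in ne.
Qed.

Lemma incident_inj (j j' : 'I_6) : incident j =1 incident j' -> j = j'.
Proof.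
move=> E; apply/eqP; apply/negPn/negP => ne.
have [o1 [o2 o12]] : exists a b : 'I_3, a != b by exists ord0, ord_max.
case: (split6 j) E ne => -[k ->]; case: (split6 j') => -[l ->] E ne.
- by move: (E (k, k)) ne; rewrite !incident_l /= eqxx => /esym/eqP->; rewrite eqxx.
- have := E (k, o1); have := E (k, o2); rewrite !incident_l !incident_r /= eqxx.
  by move=> /esym/eqP E2 /esym/eqP E1; rewrite E1 E2 eqxx in o12.
- have := E (o1, k); have := E (o2, k); rewrite !incident_r !incident_l /= eqxx.
  by move=> /esym/eqP E2 /esym/eqP E1; rewrite E1 E2 eqxx in o12.
- by move: (E (k, k)) ne; rewrite !incident_r /= eqxx => /esym/eqP->; rewrite eqxx.
Qed.

(* Three cells of a 3 x 3 grid such that no 2 x 2 minor contains exactly one of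
   them form a row or a column. *)
Lemma grid_pattern_bool (b00 b01 b02 b10 b11 b12 b20 b21 b22 : bool) :
  (b00 + b01 + b02 + b10 + b11 + b12 + b20 + b21 + b22 = 3)%N ->
  [&& (b00 ==> [|| b11, b01 | b10]), (b00 ==> [|| b12, b02 | b10]), (b00 ==> [||
b21, b01 | b20]), (b00 ==> [|| b22, b02 | b20]), (b01 ==> [|| b10, b00 | b11]),
(b01 ==> [|| b12, b02 | b11]), (b01 ==> [|| b20, b00 | b21]), (b01 ==> [|| b22,
b02 | b21]), (b02 ==> [|| b10, b00 | b12]), (b02 ==> [|| b11, b01 | b12]), (b02
==> [|| b20, b00 | b22]), (b02 ==> [|| b21, b01 | b22]), (b10 ==> [|| b01, b11 |
b00]), (b10 ==> [|| b02, b12 | b00]), (b10 ==> [|| b21, b11 | b20]), (b10 ==>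
[|| b22, b12 | b20]), (b11 ==> [|| b00, b10 | b01]), (b11 ==> [|| b02, b12 |
b01]), (b11 ==> [|| b20, b10 | b21]), (b11 ==> [|| b22, b12 | b21]), (b12 ==>
[|| b00, b10 | b02]), (b12 ==> [|| b01, b11 | b02]), (b12 ==> [|| b20, b10 |
b22]), (b12 ==> [|| b21, b11 | b22]), (b20 ==> [|| b01, b21 | b00]), (b20 ==>
[|| b02, b22 | b00]), (b20 ==> [|| b11, b21 | b10]), (b20 ==> [|| b12, b22 |
b10]), (b21 ==> [|| b00, b20 | b01]), (b21 ==> [|| b02, b22 | b01]), (b21 ==>
[|| b10, b20 | b11]), (b21 ==> [|| b12, b22 | b11]), (b22 ==> [|| b00, b20 |
b02]), (b22 ==> [|| b01, b21 | b02]), (b22 ==> [|| b10, b20 | b12]) & (b22 ==>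
[|| b11, b21 | b12])] ->
  ([:: b00; b01; b02; b10; b11; b12; b20; b21; b22] == [:: true; true; true;
false; false; false; false; false; false]) || ([:: b00; b01; b02; b10; b11; b12;
b20; b21; b22] == [:: false; false; false; true; true; true; false; false;
false]) || ([:: b00; b01; b02; b10; b11; b12; b20; b21; b22] == [:: false;
false; false; false; false; false; true; true; true]) || ([:: b00; b01; b02;
b10; b11; b12; b20; b21; b22] == [:: true; false; false; true; false; false;
true; false; false]) || ([:: b00; b01; b02; b10; b11; b12; b20; b21; b22] == [::
false; true; false; false; true; false; false; true; false]) || ([:: b00; b01;
b02; b10; b11; b12; b20; b21; b22] == [:: false; false; true; false; false;
true; false; false; true]).
Proof. by case: b00; case: b01; case: b02; case: b10; case: b11; case: b12; case:
  b20; case: b21; case: b22. Qed.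

Lemma grid_pattern (b : 'I_3 * 'I_3 -> bool) : #|[set kl | b kl]| = 3%N ->
  (forall k k' l l', k != k' -> l != l' ->
    b (k, l) ==> [|| b (k', l'), b (k, l') | b (k', l)]) ->
  exists j, b =1 incident j.
Proof.
pose o0 : 'I_3 := @Ordinal 3 0 isT; pose o1 : 'I_3 := @Ordinal 3 1 isT.
pose o2 : 'I_3 := @Ordinal 3 2 isT.
have o3 (k : 'I_3) : [\/ k = o0, k = o1 | k = o2].
  by case: k => -[|[|[|//]]] ?; [constructor 1|constructor 2|constructor 3]; apply:
    val_inj.
have cE : #|[set kl | b kl]| = (b (o0, o0) + b (o0, o1) + b (o0, o2) + b (o1, o0) +
  b (o1, o1) + b (o1, o2) + b (o2, o0) + b (o2, o1) + b (o2, o2))%N.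
  rewrite -sum1_card (eq_bigl b) => [|kl]; last by rewrite inE.
  rewrite big_mkcond /=.
  transitivity (\sum_(k < 3) \sum_(l < 3) (if b (k, l) then 1 else 0))%N.
    by rewrite pair_bigA; apply: eq_bigr => -[].
  rewrite !big_ord_recl !big_ord0 !addn0 /= !addnA.
  have E0 : ord0 = o0 by apply: val_inj.
  have E1 : lift ord0 ord0 = o1 by apply: val_inj.
  have E2 : lift ord0 (lift ord0 ord0) = o2 by apply: val_inj.
  by rewrite E1 E2 E0; do 9?[case: (b _)].
rewrite cE => c3 rect; have := grid_pattern_bool c3.
rewrite !rect // => /(_ isT).
move=> H; have {}H : exists j, forall k l, b (k, l) = incident j (k, l).
  move: H => /orP[/orP[/orP[/orP[/orP[]|]|]|]|] /eqP[E00 E01 E02 E10 E11 E12 E20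
    E21 E22];
    [exists (lshift 3 o0)|exists (lshift 3 o1)|exists (lshift 3 o2)
    |exists (rshift 3 o0)|exists (rshift 3 o1)|exists (rshift 3 o2)] => k l;
    rewrite ?incident_l ?incident_r; case: (o3 k) => ->; case: (o3 l) => ->;
    by rewrite ?E00 ?E01 ?E02 ?E10 ?E11 ?E12 ?E20 ?E21 ?E22.
by case: H => j E; exists j => -[k l].
Qed.

Section BigHalf.
Variables (R : Type) (idx : R) (op : Monoid.com_law idx) (G : 'I_6 -> R) (h : 'I_3
  -> 'I_6).
Hypothesis h_inj : injective h.

Lemma big_left_half : (forall k, (h k < 3)%N) ->
  \big[op/idx]_(k < 3) G (h k) = \big[op/idx]_(k < 3) G (lshift 3 k).
Proof.
move=> hl; pose p k := Ordinal (hl k).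
have hp k : h k = lshift 3 (p k) by apply: val_inj.
have p_inj : injective p by move=> a b ab; apply: h_inj; rewrite !hp ab.
by rewrite [RHS](reindex_inj p_inj); apply: eq_bigr => k _; rewrite hp.
Qed.

Lemma big_right_half : (forall k, ~~ (h k < 3)%N) ->
  \big[op/idx]_(k < 3) G (h k) = \big[op/idx]_(k < 3) G (rshift 3 k).
Proof.
move=> hr.
have hp0 k : exists i, h k = rshift 3 i.
  by case: (split6 (h k)) (hr k) => // -[i ->]; rewrite left_half.
have [p hp] := fin_all_exists hp0.
have p_inj : injective p by move=> a b ab; apply: h_inj; rewrite !hp ab.
by rewrite [RHS](reindex_inj p_inj); apply: eq_bigr => k _; rewrite hp.
Qed.

End BigHalf.

Section FormAutomorphism.
Variable L : fieldType.

Definition node_row (kl : 'I_3 * 'I_3) : 'rV[L]_6 := \row_j (incident j kl)%:R.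

Lemma node_rowE kl : node_row kl = delta_mx 0 (lshift 3 kl.1) + delta_mx 0 (rshift
  3 kl.2).
Proof.
apply/rowP => j; rewrite !mxE eqxx /=; case: (split6 j) => -[k ->].
  by rewrite incident_l !eq_split6 addr0 eq_sym.
by rewrite incident_r (eq_sym (rshift 3 k)) !eq_split6 add0r eq_sym.
Qed.

Lemma node_row_balanced kl : node_row kl *m balance L = 0.
Proof.
apply/colP => i; rewrite ord1 balanceE [RHS]mxE (bigD1 kl.1) //= big1 => [|k kk].
  rewrite (bigD1 kl.2) //= big1 => [|k kk]; rewrite !mxE !(incident_l, incident_r)
    ?eqxx.
    by rewrite !addr0 subrr.
  by rewrite eq_sym (negPf kk).
by rewrite mxE incident_l eq_sym (negPf kk).
Qed.

Lemma node_row_scale kl kl' c : node_row kl = c *: node_row kl' -> kl = kl'.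
Proof.
move=> E; have inc j : (incident j kl)%:R = c * (incident j kl')%:R :> L.
  by have /rowP/(_ j) := E; rewrite !mxE.
case: kl kl' E inc => [k l] [k' l'] _ inc; congr (_, _).
  have := inc (lshift 3 k); rewrite !incident_l /= eqxx; case: eqVneq => // _ /eqP.
  by rewrite mulr0 oner_eq0.
have := inc (rshift 3 l); rewrite !incident_r /= eqxx; case: eqVneq => // _ /eqP.
by rewrite mulr0 oner_eq0.
Qed.

Lemma grid_points (M : 'M[L]_(5, 6)) : row_free M -> M *m balance L = 0 ->
  exists q : 'I_3 * 'I_3 -> 'rV_5, forall kl, q kl *m M = node_row kl.
Proof.
move=> fM bM; apply: (fin_all_exists (P := fun kl v => v *m M = node_row kl)) => kl.
exact: (balanced_surj fM bM (node_row_balanced kl)).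
Qed.

Lemma row_free_inj5 (M : 'M[L]_(5, 6)) (u v : 'rV_5) : row_free M ->
  u *m M = v *m M -> u = v.
Proof. by move=> /row_free_inj H /H. Qed.

Lemma grid_points_singular (M : 'M[L]_(5, 6)) al be (q : 'rV_5) kl :
  q *m M = node_row kl -> singular_point (product_form M al be) q.
Proof.
move=> qE; apply: (@product_form_singular _ _ _ _ _ _ kl.1 kl.2).
  apply/eqP => q0; move: qE; rewrite q0 mul0mx => /rowP/(_ (lshift 3 kl.1)).
  by rewrite !mxE incident_l eqxx => /eqP; rewrite eq_sym oner_eq0.
by rewrite qE node_rowE.
Qed.

(** The first sum puts the total of the x_k on the first y, and the second puts the equal total of
    the y_l on the first x; the last term removes both. Hence five nodes span the balanced rows. *)
Lemma balanced_decomposition (w : 'rV[L]_6) : w *m balance L = 0 ->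
  w = \sum_(k < 3) w 0 (lshift 3 k) *: node_row (k, ord0)
    + \sum_(l < 3) w 0 (rshift 3 l) *: node_row (ord0, l)
    - (\sum_(k < 3) w 0 (lshift 3 k)) *: node_row (ord0, ord0).
Proof.
move=> wb; have {}wb : \sum_(k < 3) w 0 (lshift 3 k) = \sum_(k < 3) w 0 (rshift 3
  k).
  by apply/eqP; rewrite -subr_eq0 -balanceE wb mxE.
have pick (G : 'I_3 -> L) k : \sum_i G i * (i == k)%:R = G k.
  by rewrite (bigD1 k) //= eqxx mulr1 big1 ?addr0 // => j /negPf->; rewrite mulr0.
have ent (h : 'I_3 -> 'I_6) (g : 'I_3 -> 'I_3 * 'I_3) j :
    (\sum_k w 0 (h k) *: node_row (g k)) 0 j = \sum_k w 0 (h k) * (incident j (g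
      k))%:R.
  by rewrite summxE; apply: eq_bigr => k _; rewrite !mxE.
apply/rowP => j; rewrite [RHS]mxE [X in X + _]mxE !ent [X in _ + X]mxE [X in _ -
  X]mxE mxE.
case: (split6 j) => -[k ->].
  under eq_bigr do rewrite incident_l /=.
  under [X in _ + X - _]eq_bigr do rewrite incident_l /=.
  by rewrite pick -mulr_suml -wb incident_l addrK.
under eq_bigr do rewrite incident_r /=.
under [X in _ + X - _]eq_bigr do rewrite incident_r /=.
by rewrite pick -mulr_suml incident_r addrAC subrr add0r.
Qed.

Lemma grid_points_span (M : 'M[L]_(5, 6)) q (u : 'cV_5) : row_free M ->
  M *m balance L = 0 -> (forall kl, q kl *m M = node_row kl) ->
  (forall kl, q kl *m u = 0) -> u = 0.
Proof.
move=> fM bM qE qu; apply/colP => i; rewrite [RHS]mxE.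
have -> : u i 0 = ((delta_mx 0 i : 'rV_5) *m u) 0 0 by rewrite -rowE mxE.
set v := delta_mx 0 i.
have vE : v = \sum_(k < 3) (v *m M) 0 (lshift 3 k) *: q (k, ord0)
  + \sum_(l < 3) (v *m M) 0 (rshift 3 l) *: q (ord0, l)
  - (\sum_(k < 3) (v *m M) 0 (lshift 3 k)) *: q (ord0, ord0).
  apply: (row_free_inj5 fM); rewrite mulmxBl mulmxDl -scalemxAl qE.
  have lin (h : 'I_3 -> 'I_6) (g : 'I_3 -> 'I_3 * 'I_3) :
     (\sum_(k < 3) (v *m M) 0 (h k) *: q (g k)) *m M = \sum_(k < 3) (v *m M) 0 (h
       k) *: node_row (g k).
    by rewrite mulmx_suml; apply: eq_bigr => k _; rewrite -scalemxAl qE.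
  by rewrite !lin [LHS](balanced_decomposition (w := v *m M)) // -mulmxA bM mulmx0.
rewrite vE mulmxBl mulmxDl -scalemxAl qu scaler0 subr0 !mulmx_suml !mxE.
by rewrite !big1 ?addr0 ?mxE ?addr0 // => k _; rewrite -scalemxAl qu scaler0.
Qed.

Definition col_select n (p : 'I_6 -> 'I_6) (M : 'M[L]_(n, 6)) : 'M_(n, 6) :=
  \matrix_(i, j) M i (p j).

(** Exchanging the halves exchanges the two products, which costs a sign on both coefficients. *)
Lemma product_form_col_select n (p : 'I_6 -> 'I_6) sw (M : 'M[L]_(n, 6)) al be :
  injective p -> (forall j, (p j < 3)%N = (j < 3)%N (+) sw) ->
  product_form (col_select p M) al be =
  if sw then product_form M (- be) (- al) else product_form M al be.
Proof.
move=> pinj psw; have lf j : linform (col_select p M) j = linform M (p j).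
  by apply: eq_bigr => i _; rewrite mxE.
have il : injective (p \o (lshift 3 : 'I_3 -> 'I_6)) by apply: inj_comp pinj
  (@lshift_inj 3 3).
have ir : injective (p \o (@rshift 3 3)) by apply: inj_comp pinj (@rshift_inj 3 3).
rewrite /product_form; under eq_bigr do rewrite lf.
under [X in _ - _ *: X]eq_bigr do rewrite lf.
case: sw psw => psw.
  have -> : \prod_(k < 3) linform M (p (lshift 3 k)) = \prod_(k < 3) linform M
    (rshift 3 k).
    by apply: (big_right_half _ _ il) => k; rewrite /= psw left_half.
  have -> : \prod_(k < 3) linform M (p (rshift 3 k)) = \prod_(k < 3) linform M
    (lshift 3 k).
    by apply: (big_left_half _ _ ir) => k; rewrite /= psw left_half.
  by rewrite !scaleNr opprK addrC.
have -> : \prod_(k < 3) linform M (p (lshift 3 k)) = \prod_(k < 3) linform M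
  (lshift 3 k).
  by apply: (big_left_half _ _ il) => k; rewrite /= psw left_half.
have -> // : \prod_(k < 3) linform M (p (rshift 3 k)) = \prod_(k < 3) linform M
  (rshift 3 k).
by apply: (big_right_half _ _ ir) => k; rewrite /= psw left_half.
Qed.

Lemma product_form_coef (M : 'M[L]_(5, 6)) al be al' be' : row_free M ->
  M *m balance L = 0 -> product_form M al be = product_form M al' be' ->
  al = al' /\ be = be'.
Proof.
move=> fM bM E.
have test (w : 'rV_6) : w *m balance L = 0 ->
    al * (\prod_(k < 3) w 0 (lshift 3 k)) - be * (\prod_(k < 3) w 0 (rshift 3 k)) =
    al' * (\prod_(k < 3) w 0 (lshift 3 k)) - be' * (\prod_(k < 3) w 0 (rshift 3 k)).
  by move=> /(balanced_surj fM bM)[v <-]; rewrite -!evalv_product_form E.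
(* Balanced rows at which one product is 1 and the other 0. *)
have := test (\row_j nth 0 [:: 1; 1; 1; 3%:R; 0; 0] j).
have := test (\row_j nth 0 [:: 3%:R; 0; 0; 1; 1; 1] j).
have bal (s : seq L) : s`_0 + s`_1 + s`_2 = s`_3 + s`_4 + s`_5 ->
    (\row_(j < 6) s`_j) *m balance L = 0.
  move=> sE; apply/colP => i; rewrite ord1 balanceE !big_ord_recl !big_ord0 !mxE /=.
  by rewrite !addr0 !addrA sE subrr.
rewrite !bal; try by rewrite /=; ring.
rewrite !big_ord_recl !big_ord0 !mxE /= !(mul0r, mulr0, mul1r, mulr1, subr0, sub0r).
by move=> /(_ erefl)/oppr_inj-> /(_ erefl)->.
Qed.

(* A column of [N] is a linear form which, like a column of [M], vanishes at
   exactly six of the nine nodes; by [grid_pattern] the other three form a row or a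
   column of the grid, so it is a multiple of a column of [M]. *)
Lemma form_automorphism (M N : 'M[L]_(5, 6)) al be al' be' (i0 : 'I_5)
    (q : 'I_3 * 'I_3 -> 'rV_5) : row_free M -> row_free N ->
  M *m balance L = 0 -> N *m balance L = 0 ->
  \sum_(k < 3) M i0 (lshift 3 k) = 1 -> \sum_(k < 3) N i0 (lshift 3 k) = 1 ->
  product_form M al be = product_form N al' be' ->
  (forall kl, q kl *m M = node_row kl) ->
  (forall p, singular_point (product_form M al be) p -> exists kl, same_point p (q
    kl)) ->
  exists p : 'I_6 -> 'I_6, N = col_select p M /\
    forall n (B : 'M_(n, 6)), product_form (col_select p B) al' be' = product_form
      B al be.
Proof.
move=> fM fN bM bN sM sN E qE qsing.
have [q' qE'] := grid_points fN bN.
(* Both matrices define the same cubic, so each node of the grid of [N] is, up to a scalar, a node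
   of the grid of [M]. *)
have tau0 kl : exists kl', exists2 c, c != 0 & q' kl = c *: q kl'.
  have sq := grid_points_singular al' be' (qE' kl); rewrite -E in sq.
  by have [kl' [c c0 H]] := qsing _ sq; exists kl', c.
have [tau {}tau0] := fin_all_exists tau0.
have tau_inj : injective tau.
  move=> a b ab; have [c c0 Ea] := tau0 a; have [d d0 Eb] := tau0 b.
  apply: (@node_row_scale _ _ (c / d)); rewrite -!qE' Ea Eb ab -scalemxAl
    -scalemxAl scalerA.
  by rewrite divfK.
have tau_surj kl : exists kl', kl = tau kl'.
  by have [g _ gK] := injF_bij tau_inj; exists (g kl); rewrite gK.
have yE j kl c : q' kl = c *: q (tau kl) ->
    c * (q (tau kl) *m N) 0 j = (incident j kl)%:R.
  move=> Ec; have : (q' kl *m N) 0 j = (incident j kl)%:R by rewrite qE' mxE.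
  by rewrite Ec -scalemxAl mxE.
(* Opposite corners of a rectangle in the grid have equal sums, so a linear form cannot be nonzero
   at exactly one of the four corners. *)
have rect (P : 'M[L]_(5, 6)) j k k' l l' : (q (k, l) *m P) 0 j + (q (k', l') *m P)
  0 j =
    (q (k, l') *m P) 0 j + (q (k', l) *m P) 0 j.
  suff qq : q (k, l) + q (k', l') = q (k, l') + q (k', l).
    have addE (u v : 'rV[L]_6) : (u + v) 0 j = u 0 j + v 0 j by rewrite mxE.
    by rewrite -!addE -!mulmxDl qq.
  apply: (row_free_inj5 fM); rewrite !mulmxDl !qE; apply/rowP => i; rewrite !mxE.
  by case: (split6 i) => -[m ->]; rewrite ?incident_l ?incident_r //= addrC.
have col0 j : exists m, exists lam, [/\ forall kl, incident j kl = incident m (tau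
  kl),
    forall i, N i j = lam * M i m & forall kl, incident m kl -> (q kl *m N) 0 j =
      lam].
  pose b kl := (q kl *m N) 0 j != 0.
  have bE kl : b (tau kl) = incident j kl.
    have [c c0 Ec] := tau0 kl; have := yE j kl c Ec; rewrite /b => H.
    apply/idP/idP => [y0|].
      by move: (mulf_neq0 c0 y0); rewrite H; case: incident => //; rewrite eqxx.
    by move=> inc; apply: contraTneq isT => y0; move/eqP: H;
      rewrite y0 mulr0 inc eq_sym oner_eq0.
  have [|k k' l l' kk' ll'|m bm] := @grid_pattern b.
  - apply: etrans _ (card_incident j).
    have -> : [set kl | b kl] = tau @: [set kl | incident j kl].
      apply/setP => kl; rewrite inE; apply/idP/imsetP => [bkl|[kl' + ->]].
        by have [kl' klE] := tau_surj kl; exists kl' => //; rewrite inE -bE -klE.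
      by rewrite inE bE.
    exact: card_imset.
  - apply/implyP => bkl; apply: contraT; rewrite !negb_or !negbK.
    move=> /and3P[/eqP z1 /eqP z2 /eqP z3]; have := rect N j k k' l l'.
    by rewrite z1 z2 z3 !addr0 => /eqP; rewrite (negPf bkl).
  have off kl : ~~ incident m kl -> (q kl *m N) 0 j = 0.
    by rewrite -bm negbK => /eqP.
  (* In a rectangle with two corners off the line [m], the two values on the line agree by
     [rect]. *)
  have [lam lamE] : exists lam, forall kl, incident m kl -> (q kl *m N) 0 j = lam.
    have nex (k : 'I_3) : exists k', k' != k.
      by have [->|?] := eqVneq k ord0; [exists ord_max|exists ord0; rewrite eq_sym].
    case: (split6 m) off => -[k ->] off; have [k' k'k] := nex k.
      exists ((q (k, ord0) *m N) 0 j) => -[a l]; rewrite incident_l /= => /eqP->.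
      have := rect N j k k' l ord0; rewrite !(off (k', _)) ?incident_l //.
      by rewrite !addr0.
    exists ((q (ord0, k) *m N) 0 j) => -[l a]; rewrite incident_r /= => /eqP->.
    have := rect N j l ord0 k k'; rewrite !(off (_, k')) ?incident_r //.
    by rewrite addr0 add0r.
  exists m, lam; split=> // [kl|i]; first by rewrite -bE bm.
  apply/eqP; rewrite -subr_eq0; apply/eqP.
  have u0 : col j N - lam *: col m M = 0.
    apply: (grid_points_span fM bM qE) => kl; apply/rowP => z; rewrite [RHS]mxE.
    have colE (P : 'M[L]_(5, 6)) i' : (q kl *m col i' P) 0 0 = (q kl *m P) 0 i'.
      by rewrite !mxE; apply: eq_bigr => x _; rewrite mxE.
    have subE (u v : 'M[L]_1) : (u - lam *: v) 0 0 = u 0 0 - lam * v 0 0.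
      by rewrite !mxE.
    have ndE : (node_row kl) 0 m = (incident m kl)%:R by rewrite mxE.
    rewrite ord1 mulmxBr -scalemxAr subE !colE qE ndE.
    have [inc|inc] := boolP (incident m kl); first by rewrite lamE // mulr1 subrr.
    by rewrite off // mulr0 subrr.
  by have /colP/(_ i) := u0; rewrite !mxE.
have [p {}col0] := fin_all_exists col0; have [lam {}col0] := fin_all_exists col0.
(* At a common node both scalars are the inverse of the factor between the two normalizations of
   this node; connectedness of K_{3,3} then makes all six equal. *)
have share j j' kl : incident j kl -> incident j' kl -> lam j = lam j'.
  move=> ij ij'; have [c c0 Ec] := tau0 kl; apply: (mulfI c0).
  have [H _ L1] := col0 j; have [H' _ L2] := col0 j'.
  rewrite -(L1 (tau kl)) -?H // -(L2 (tau kl)) -?H' // (yE _ _ _ Ec) (yE _ _ _ Ec).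
  by rewrite ij ij'.
have lamE j : lam j = lam (rshift 3 ord0).
  case: (split6 j) => -[k ->].
    by apply: (share _ _ (k, ord0)); rewrite ?incident_l ?incident_r.
  transitivity (lam (lshift 3 (ord0 : 'I_3))).
    by apply: (share _ _ (ord0, k)); rewrite ?incident_l ?incident_r.
  by apply: (share _ _ (ord0, ord0)); rewrite ?incident_l ?incident_r.
have pinc j kl : incident j kl = incident (p j) (tau kl) by have [] := col0 j.
have p_inj : injective p.
  by move=> a b ab; apply: incident_inj => kl; rewrite [LHS]pinc [RHS]pinc ab.
have phalf j j' : ((p j < 3)%N == (p j' < 3)%N) = ((j < 3)%N == (j' < 3)%N).
  have [->|ne] := eqVneq j j'; first by rewrite !eqxx.
  rewrite !incident_half ?(inj_eq p_inj) //; congr (~~ _).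
  apply/existsP/existsP => -[kl].
    by have [kl' ->] := tau_surj kl; rewrite -(pinc j) -(pinc j') => H; exists kl'.
  by rewrite (pinc j) (pinc j') => H; exists (tau kl).
pose sw := ~~ (p ord0 < 3)%N.
have psw j : (p j < 3)%N = (j < 3)%N (+) sw.
  have := phalf j ord0; rewrite /sw /=.
  by case: (p j < 3)%N; case: (p ord0 < 3)%N; case: (j < 3)%N.
(* If [p] swaps the halves, this is the sum over the y forms, which is the same by balance. *)
have sumP : \sum_(k < 3) M i0 (p (lshift 3 k)) = 1.
  have il : injective (p \o (lshift 3 : 'I_3 -> 'I_6)) by apply: inj_comp p_inj
    (@lshift_inj 3 3).
  case: (boolP sw) => swE.
    have -> : \sum_(k < 3) M i0 (p (lshift 3 k)) = \sum_(k < 3) M i0 (rshift 3 k).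
      by apply: (big_right_half _ (M i0) il) => k; rewrite /= psw swE left_half.
    by rewrite -sM; apply/esym/eqP; rewrite -subr_eq0 -balanceE bM mxE.
  rewrite -sM; apply: (big_left_half _ (M i0) il) => k.
  by rewrite /= psw (negPf swE) left_half.
have lam1 j : lam j = 1.
  rewrite lamE -sN -[LHS]mulr1 -sumP mulr_sumr; apply: eq_bigr => k _.
  by have [_ -> _] := col0 (lshift 3 k); rewrite lamE.
have NE : N = col_select p M.
  by apply/matrixP => i j; have [_ -> _] := col0 j; rewrite lam1 mul1r mxE.
(* Comparing coefficients on [M] fixes [al'] and [be'], after which the identity holds for any
   matrix; the descent uses it for the 6 x 6 one. *)
exists p; split=> // n B.
move: E; rewrite NE !(product_form_col_select _ _ _ p_inj psw).
case: (sw) => /(product_form_coef fM bM)[-> ->] //; rewrite !opprK.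

Qed.

End FormAutomorphism.

(** * Descent to the base field *)

Lemma nodal_product_form (K : fieldType) (E : closedFieldType) (iota : {rmorphism K
  -> E})
    (f : {mpoly K[5]}) : [pchar E] =i pred0 -> nine_nodal_cubic_threefold iota f ->
  exists (M : 'M[E]_(5, 6)) al be i0, [/\ (al != 0) /\ (be != 0), row_free M,
    M *m balance E = 0, \sum_(k < 3) M i0 (lshift 3 k) = 1 &
    map_mpoly iota f = product_form M al be].
Proof.
move=> ch0 [[f0 hf] [s [s_inj s_sing s_node]]].
have hF : map_mpoly iota f \is 3.-homog by rewrite map_mpoly_homog.
set g := map_mpoly iota f in hF s_sing s_node *.
have nz d : d.+1%:R != 0 :> E by rewrite (proj1 (pcharf0P E) ch0).
have sing a : singular_point g (s a).
  by apply/s_sing; exists a; exists 1; rewrite ?oner_eq0 ?scale1r.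
have dim5 : \dim {: 'rV[E]_5} = 5%N by rewrite dimvf /dim /= mul1n.
have nodes i : node (polar g) (s (inord i)).
  have sp := sing (inord i); split.
  - by case: sp.
  - by move=> v; apply: polar_singular.
  - by move=> k; apply: ordinary_node_kernel (s_node _).
have pf : product_frame (polar g).
  apply: (nine_nodes_product (nz 1%N) (nz 2) dim5 (polar_linear g) (polarC12 g)
    (polarC23 g) (s := fun i => s (inord i))) => [i _|i j i9 j9 ij [c E1]].
    exact: nodes.
  case/eqP: ij; rewrite -(inordK i9) -(inordK j9); congr (nat_of_ord _).
  apply/esym/s_inj; exists c => //; apply/eqP => c0.
  by have [/eqP[]] := sing (inord j); rewrite E1 c0 scale0r.
have [M [al [be [al0 be0 fM bM gE]]]] := product_form_of_product_frame ch0 hF pf.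
have [v vE] := balanced_surj fM bM (node_row_balanced E (ord0, ord0)).
(* The form x1 + x2 + x3 takes the value 1 at a node, so one of its coefficients is nonzero and can
   be scaled to 1. *)
have [i0 e0] : exists i0, \sum_(k < 3) M i0 (lshift 3 k) != 0.
  apply/existsP; apply: contraT => /existsPn all0.
  have : \sum_(k < 3) (v *m M) 0 (lshift 3 k) = 0.
    under eq_bigr do rewrite mxE; rewrite exchange_big big1 // => i _ /=.
    by rewrite -mulr_sumr; have /negPn/eqP-> := all0 i; rewrite mulr0.
  rewrite vE (bigD1 (ord0 : 'I_3)) //= big1 => [|k k0]; rewrite mxE incident_l /=.
    by rewrite ?eqxx addr0 => /eqP; rewrite oner_eq0.
  by rewrite eq_sym (negPf k0).
set e := \sum_(k < 3) _ in e0; have ei0 : e^-1 != 0 by rewrite invr_eq0.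
exists (e^-1 *: M), (al / e^-1 ^+ 3), (be / e^-1 ^+ 3), i0; split.
- by split; rewrite mulf_neq0 // invr_eq0 expf_neq0.
- by rewrite /row_free eqmx_scale.
- by rewrite -scalemxAl bM scaler0.
- by under eq_bigr do rewrite mxE; rewrite -mulr_sumr mulVf.
by rewrite gE (product_formZ _ _ _ ei0).
Qed.

(** The quadratic form of the x_k^2 minus the y_l^2 is not zero on the balanced rows. If it vanished
    at all vectors over K, polarization at standard basis vectors would make its bilinear form zero
    over L. *)
Lemma rational_nonvanishing (K L : fieldType) (i : {rmorphism K -> L}) (M :
  'M[L]_(5, 6)) :
  [pchar L] =i pred0 -> row_free M -> M *m balance L = 0 ->
  exists v : 'rV[K]_5, let w := map_mx i v *m M in
    (\row_j (w 0 j ^+ 2)) *m balance L != 0.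
Proof.
move=> ch0 fM bM; apply: NNPP => nov.
have nz d : d.+1%:R != 0 :> L by rewrite (proj1 (pcharf0P L) ch0).
pose Q (u v : 'rV[L]_5) := \sum_j (u *m M) 0 j * (v *m M) 0 j * balance L j 0.
have sqE (w : 'rV[L]_6) : ((\row_j (w 0 j ^+ 2)) *m balance L) 0 0 =
    \sum_j w 0 j * w 0 j * balance L j 0.
  by rewrite mxE; apply: eq_bigr => j _; rewrite [in LHS]mxE.
have addE (x y : 'rV[L]_6) j : (x + y) 0 j = x 0 j + y 0 j by rewrite mxE.
have scaleE c (x : 'rV[L]_6) j : (c *: x) 0 j = c * x 0 j by rewrite mxE.
have QD u u' v : Q (u + u') v = Q u v + Q u' v.
  rewrite /Q -big_split; apply: eq_bigr => j _.
  by rewrite mulmxDl addE !mulrDl.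
have QZ c u v : Q (c *: u) v = c * Q u v.
  rewrite /Q mulr_sumr; apply: eq_bigr => j _.
  by rewrite -scalemxAl scaleE !mulrA.
have QC u v : Q u v = Q v u.
  by apply: eq_bigr => j _; rewrite [X in X * _]mulrC.
have Q0 v : Q (map_mx i v) (map_mx i v) = 0.
  apply/eqP; apply: contraT => Qv; case: nov; exists v => /=.
  by apply: contraNneq Qv => z; rewrite /Q -sqE z mxE.
have Qd a b : Q (delta_mx 0 a) (delta_mx 0 b) = 0.
  have QDr u v v' : Q u (v + v') = Q u v + Q u v' by rewrite QC QD !(QC u).
  have md c : map_mx i (delta_mx 0 c) = delta_mx 0 c :> 'rV_5 by rewrite
    map_delta_mx.
  have := Q0 (delta_mx 0 a + delta_mx 0 b); rewrite map_mxD !QD !QDr.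
  rewrite -!md !Q0 add0r addr0 (QC (map_mx i (delta_mx 0 b))) => E.
  by apply: (mulfI (nz 1%N)); rewrite mulr0 -E; ring.
have Qall u v : Q u v = 0.
  have Qs (w x : 'rV_5) : Q w x = \sum_a w 0 a * Q (delta_mx 0 a) x.
    rewrite {1}[w]row_sum_delta; elim/big_rec2: _ => [|a y1 y2 _ <-].
      by rewrite -(scale0r 0) QZ mul0r.
    by rewrite QD QZ.
  rewrite Qs big1 // => a _; rewrite QC Qs big1 ?mulr0 // => b _.
  by rewrite Qd mulr0.
(* A balanced row whose squares are not: 1 + 1 - 4 = -2. *)
pose w : 'rV[L]_6 := \row_j [:: 1; 1; 0; 2%:R; 0; 0]`_j.
have wb : w *m balance L = 0.
  apply/colP => z; rewrite ord1 balanceE !big_ord_recl !big_ord0 !mxE /=; ring.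
have [v vE] := balanced_surj fM bM wb.
have := Qall v v; rewrite /Q vE -sqE balanceE !big_ord_recl !big_ord0 !mxE /=.
move=> /eqP; apply/negP.
by rewrite (_ : _ - _ = - 2%:R :> L) ?oppr_eq0 ?(nz 1%N) //; ring.
Qed.

Lemma product_form_diag (F : fieldType) n (B : 'M[F]_(n, 6)) (d : 'rV_6) :
  product_form (B *m diag_mx d) 1 1 = product_form B (\prod_(k < 3) d 0 (lshift 3
    k))
    (\prod_(k < 3) d 0 (rshift 3 k)).
Proof.
have lf j : linform (B *m diag_mx d) j = d 0 j *: linform B j.
  rewrite /linform scaler_sumr; apply: eq_bigr => i _.
  by rewrite mul_mx_diag mxE scalerA mulrC.
rewrite /product_form !scale1r -!scaler_prod.
by congr (_ - _); apply: eq_bigr => k _; rewrite lf.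
Qed.

Lemma mulmx_col_select (F : fieldType) m n p (A : 'M[F]_(m, n)) M :
  A *m col_select p M = col_select p (A *m M).
Proof. by apply/matrixP => a b; rewrite !mxE; apply: eq_bigr => k _; rewrite mxE.
  Qed.

Theorem proposition3p2 (K : fieldType) (charK0 : [pchar K] =i pred0)
  (Kbar : closedFieldType) (iota : {rmorphism K -> Kbar})
  (Kbar_closure : algebraic_closure_of iota)
  (f : {mpoly K[5]}) (f_nodal : nine_nodal_cubic_threefold iota f) :
  exists g : {mpoly K[6]},
    perazzo_cubic_fourfold iota g /\
    exists h : 'cV[K]_6, h != 0 /\ isom_hyperplane_section f g h.
Proof.
have charE : [pchar Kbar] =i pred0 by move=> p; rewrite (fmorph_pchar iota) charK0.
have [M [al [be [i0 [[al0 be0] fM bM sM fE]]]]] := nodal_product_form charE f_nodal.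
have [L [i [j [ij jL fixL]]]] := finite_galois_closure charK0 Kbar_closure
  ([:: al; be] ++ [seq M x.1 x.2 | x <- enum [set: 'I_5 * 'I_6]]).
have [alL jal] : exists a, j a = al by apply: jL; rewrite inE eqxx.
have [beL jbe] : exists b, j b = be by apply: jL; rewrite !inE eqxx orbT.
have [ML jM] : exists ML : 'M[L]_(5, 6), map_mx j ML = M.
  have jMx (x : 'I_5 * 'I_6) : exists y, j y = M x.1 x.2.
    apply: jL; rewrite mem_cat; apply/orP; right.
    by apply: map_f; rewrite mem_enum inE.
  have [m mE] := fin_all_exists jMx; exists (\matrix_(a, b) m (a, b)).
  by apply/matrixP => a b; rewrite !mxE mE.
subst al be M; rewrite !fmorph_eq0 in al0 be0; rewrite row_free_map in fM.
have balj : map_mx j (balance L) = balance Kbar.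
  by apply/colP => k; rewrite !mxE; case: ifP => _; rewrite ?rmorphN rmorph1.
rewrite -balj -map_mxM in bM; have {}bM : ML *m balance L = 0.
  by apply: (map_mx_inj (f := j)); rewrite bM map_mx0.
have {}sM : \sum_(k < 3) ML i0 (lshift 3 k) = 1.
  by apply: (fmorph_inj j); rewrite rmorph1 -sM rmorph_sum; apply: eq_bigr => k _;
    rewrite mxE.
have fL : map_mpoly i f = product_form ML alL beL.
  by apply: (map_mpoly_inj (h := j)); rewrite map_product_form (map_mpoly_comp_eq _
    ij).
have charL : [pchar L] =i pred0 by move=> p; rewrite (fmorph_pchar i) charK0.
have [q qE] := grid_points fM bM.
(* The nine grid points are pairwise not proportional, hence exhaust the nine nodes over [Kbar]. The
   factor between [p] and a grid point is a quotient of coordinates, so it already lies in [L]. *)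
have qsing p : singular_point (product_form ML alL beL) p -> exists kl, same_point
  p (q kl).
  have [_ [s [s_inj s_sing _]]] := f_nodal.
  have jf : map_mpoly iota f = map_mpoly j (product_form ML alL beL).
    by rewrite -fL (map_mpoly_comp_eq _ ij).
  have tau0 kl : exists a, same_point (map_mx j (q kl)) (s a).
    by apply/s_sing; rewrite jf; apply/map_singular_point/grid_points_singular.
  have [tau {}tau0] := fin_all_exists tau0.
  have tau_inj : injective tau.
    move=> a b ab; have [c c0 Ea] := tau0 a; have [d d0 Eb] := tau0 b.
    apply: (@node_row_scale Kbar _ _ (c / d)).
    have jq kl : map_mx j (q kl) *m map_mx j ML = node_row Kbar kl.
      by rewrite -map_mxM qE; apply/rowP => k; rewrite !mxE rmorph_nat.
    by rewrite -!jq Ea Eb ab -!scalemxAl scalerA divfK.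
  move=> /(map_singular_point j); rewrite -jf => /s_sing[a [c c0 pE]].
  have /codomP[kl aE] : a \in codom tau.
    by apply: inj_card_onto; rewrite // card_prod !card_ord.
  have [d d0 qs] := tau0 kl; exists kl.
  have {}pE : map_mx j p = (c / d) *: map_mx j (q kl).
    by rewrite pE aE qs scalerA divfK.
  have [q0 _ _] := grid_points_singular alL beL (qE kl).
  have [z qz] : exists z, q kl 0 z != 0.
    by apply/existsP; apply: contraNT q0 => /existsPn H; apply/eqP/rowP => z;
      rewrite mxE; apply/eqP/negPn/H.
  have pz : j (p 0 z) = (c / d) * j (q kl 0 z).
    by have /rowP/(_ z) := pE; rewrite !mxE.
  have cd : c / d = j (p 0 z / q kl 0 z).
    by rewrite fmorph_div pz mulfK // fmorph_eq0.
  exists (p 0 z / q kl 0 z); first by rewrite -(fmorph_eq0 j) -cd mulf_neq0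
    ?invr_eq0.
  by apply: (map_mx_inj (f := j)); rewrite map_mxZ -cd.
have [v vQ] := rational_nonvanishing i charL fM bM.
set w := map_mx i v *m ML in vQ.
pose r : 'rV[L]_6 := \row_k (w 0 k ^+ 2).
pose B : 'M[L]_6 := col_mx ML r.
(* Multiplying a relation between the rows by [balance] kills the rows of [ML] but not [r], so [r]
   has coefficient 0; the rest is row-freeness of [ML]. *)
have uB : B \in unitmx.
  rewrite -row_free_unit -kermx_eq0; apply/rowV0P => y /sub_kermxP.
  move=> yB; pose y' : 'rV[L]_(5 + 1) := y.
  have {}yB : lsubmx y' *m ML + rsubmx y' *m r = 0 by rewrite -mul_row_col hsubmxK.
  have : rsubmx y' *m (r *m balance L) = 0.
    have /(congr1 (mulmx^~ (balance L))) := yB.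
    by rewrite mulmxDl -!mulmxA bM mulmx0 add0r mul0mx.
  rewrite [r *m _]mx11_scalar mul_mx_scalar => /eqP; rewrite scaler_eq0.
  have /negPf-> /= : (r *m balance L) 0 0 != 0.
    apply: contraNneq vQ => r0; apply/eqP; rewrite -/r [LHS]mx11_scalar r0.
    by rewrite raddf0.
  move=> /eqP y1; rewrite y1 mul0mx addr0 in yB.
  have y0 : lsubmx y' = 0 by apply: (row_free_inj5 fM); rewrite yB mul0mx.
  by rewrite -[y]/y' -[y']hsubmxK y0 y1 row_mx0.
(* An automorphism over K only permutes the columns of [B], compatibly with the coefficients, so
   every coefficient of the form is fixed. *)
have [g gE] : exists g, map_mpoly i g = product_form B alL beL.
  apply: map_mpoly_lift => m; apply: fixL => sg sgi.
  have fsg : product_form ML alL beL =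
      product_form (map_mx sg ML) (sg alL) (sg beL).
    by rewrite -map_product_form -fL (map_mpoly_comp_eq _ sgi).
  have fN : row_free (map_mx sg ML) by rewrite row_free_map.
  have bN : map_mx sg ML *m balance L = 0.
    have -> : balance L = map_mx sg (balance L).
      by apply/colP => k; rewrite !mxE; case: ifP => _; rewrite ?rmorphN rmorph1.
    by rewrite -map_mxM bM map_mx0.
  have sN : \sum_(k < 3) map_mx sg ML i0 (lshift 3 k) = 1.
    by rewrite -(rmorph1 sg) -sM rmorph_sum; apply: eq_bigr => k _; rewrite mxE.
  have [p [NE pB]] := form_automorphism fM fN bM bN sM sN fsg qE qsing.
  (* The vector [v] is rational, so [sg] acts on [w] through [ML] alone. *)
  have wE : map_mx sg w = col_select p w.
    rewrite /w map_mxM NE mulmx_col_select; congr (col_select p (_ *m _)).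
    by apply/rowP => k; rewrite !mxE sgi.
  have BE : map_mx sg B = col_select p B.
    apply/matrixP => a b; rewrite [LHS]mxE [RHS]mxE.
    have Eab c : (\row_k (w 0 k ^+ 2) : 'rV[L]_6) 0 c = w 0 c ^+ 2 by rewrite mxE.
    rewrite /B [in LHS]mxE [in RHS]mxE; case: split => k.
      by have /matrixP/(_ k b) := NE; rewrite !mxE.
    have /rowP/(_ b) := wE; rewrite ord1 /r !Eab rmorphXn /=.
    by rewrite [in LHS]mxE [in RHS]mxE => ->.
  by rewrite -mcoeff_map_mpoly map_product_form BE pB.
have jg : map_mpoly iota g = product_form (map_mx j B) (j alL) (j beL).
  by rewrite -(map_mpoly_comp_eq _ ij) gE map_product_form.
pose A : 'M[K]_(5, 6) := row_mx 1%:M (0 : 'M_(5, 1)).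
have AB : map_mx i A *m B = ML.
  have -> : map_mx i A = row_mx 1%:M 0.
    rewrite -[LHS]/(map_mx i (row_mx 1%:M 0 : 'M_(5, 5 + 1))).
    by rewrite map_row_mx map_mx1 map_mx0.
  rewrite -[LHS]/(row_mx 1%:M (0 : 'M_(5, 1)) *m col_mx ML r) mul_row_col.
  by rewrite mul1mx mul0mx addr0.
have Ag : lin_subst A g = f.
  by apply: (map_mpoly_inj (h := i)); rewrite map_lin_subst gE
    lin_subst_product_form AB fL.
have hg : g \is 3.-homog by rewrite -(map_mpoly_homog i) gE product_form_homog.
have [[f0 _] _] := f_nodal.
exists g; split.
  split; first split=> //.
    by apply: contraNneq f0 => g0; rewrite -Ag g0 /lin_subst raddf0.
  (* Scaling one form in each product absorbs the coefficients, without cube roots. *)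
  pose d : 'rV[Kbar]_6 := \row_k [:: j alL; 1; 1; j beL; 1; 1]`_k.
  exists (map_mx j B *m diag_mx d).
    rewrite unitmx_mul map_unitmx uB unitmxE det_diag unitfE.
    by rewrite !big_ord_recl big_ord0 !mxE /= !mulf_neq0 ?oner_eq0 ?fmorph_eq0.
  exists 1; first exact: oner_neq0.
  rewrite scale1r perazzo_product_form lin_subst_product_form mulmx1
    product_form_diag jg.
  by rewrite !big_ord_recl !big_ord0 !mxE /= !mulr1.
exists (col_mx (0 : 'cV_5) (1%:M : 'M_1)); split.
  apply/eqP => /(congr1 (@dsubmx _ 5 1 1)); rewrite col_mxKd linear0 => /eqP.
  by rewrite -mxrank_eq0 mxrank1.
exists A; split.
- apply/row_freeP; exists (col_mx 1%:M (0 : 'M_(1, 5))).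
  rewrite -[LHS]/(row_mx 1%:M (0 : 'M_(5, 1)) *m col_mx 1%:M (0 : 'M_(1, 5))).
  by rewrite mul_row_col mul1mx mul0mx addr0.
- rewrite -[LHS]/(row_mx (1%:M : 'M_5) (0 : 'M_(5, 1)) *m col_mx 0 1%:M).
  by rewrite mul_row_col mulmx0 mul0mx addr0.
by exists 1; rewrite ?oner_eq0 // scale1r.
Qed.
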